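(* Let $\tau<-1$. Then the equilibrium measure $\mu_\tau$ is absolutely continuous with $$\operatorname{supp}(\mu_\tau)=[-\beta_\tau,\beta_\tau],\qquad \beta_\tau=\sqrt{1-\left(\frac{1+\tau}{\tau}\right)^2}\in(0,1),$$ and is given on its support by $$d\mu_\tau(x)=-\frac{\tau}{\pi}\left(\frac{\pi}{2}-\arctan\left(\sqrt{\frac{1-\beta_\tau^2}{\beta_\tau^2-x^2}}\right)\right)dx ,$$ so that $$C^{\mu_\tau}(z)=\tau\log\left(\frac{(z^2-\beta_\tau^2)^{1/2}+\sqrt{1-\beta_\tau^2}}{z+1}\right),\qquad z\in\mathbb{C}\setminus[-\beta_\tau,\beta_\tau].$$ Furthermore, for $z\in\mathbb{C}\setminus[-\beta_\tau,\beta_\tau]$, $V^{\mu_\tau}(z)=-\operatorname{Re} g^{\mu_\tau}(z)$, where $$g^{\mu_\tau}(z)=zC^{\mu_\tau}(z)+(1+\tau)\log\left(\frac{\beta_\tau}{2}\Phi\left(\frac{z}{\beta_\tau}\right)\right)-\tau\log\left(\frac{(z^2-\beta_\tau^2)^{1/2}+z\sqrt{1-\beta_\tau^2}}{1+\sqrt{1-\beta_\tau^2}}\right)-1 .$$ In particular, for $z\in\mathbb{C}\setminus[-\beta_\tau,\beta_\tau]$, $$V^{\mu_\tau}(z)=-\operatorname{Re}(zC^{\mu_\tau}(z))-(1+\tau)\log\left|\frac{\beta_\tau}{2}\Phi\left(\frac{z}{\beta_\tau}\right)\right|+\tau\log\left|\frac{(z^2-\beta_\tau^2)^{1/2}+z\sqrt{1-\beta_\tau^2}}{1+\sqrt{1-\beta_\tau^2}}\right|+1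 .$$ On the support, i.e. for $x\in[-\beta_\tau,\beta_\tau]$, $$V^{\mu_\tau}(x)=\frac{\tau}{2}\left[(1+x)\log(1+x)+(1-x)\log(1-x)-2\right]+\omega_\tau ,$$ where the equilibrium constant is $$\omega_\tau=(1+\tau)\log(2)-\log(\beta_\tau)+1+\tau-\tau\log\left(1+\sqrt{1-\beta_\tau^2}\right).$$
   Context: For a (signed) Borel measure $\sigma$ on $[-1,1]$, its logarithmic potential is $V^\sigma(z)=\int\log\frac{1}{|x-z|}\,d\sigma(x)$, and its Cauchy transform is $C^\sigma(z)=\int\frac{1}{z-x}\,d\sigma(x)$ for $z\in\mathbb{C}\setminus\operatorname{supp}(\sigma)$. Let $\lambda$ be the absolutely continuous probability measure $\frac12 dx$ on $[-1,1]$. For $\tau\in\mathbb{R}$, the equilibrium measure $\mu_\tau$ is the unique probability measure on $[-1,1]$ for which there is a constant $\omega_\tau\in\mathbb{R}$ (the equilibrium constant) such that $$V^{\mu_\tau}(x)+\tau V^\lambda(x)=\omega_\tau \ \text{ for } x\in\operatorname{supp}(\mu_\tau),\qquad V^{\mu_\tau}(x)+\tau V^\lambda(x)\ge\omega_\tau\ \text{ for } x\in[-1,1].$$ Equivalently, $\mu_\tau$ minimizes $\int V^\sigma\,d\sigma+2\tau\int V^\lambda\,d\sigma$ among probability measures $\sigma$ on $[-1,1]$. Conventions: $\sqrt{\cdot}$ is the nonnegative square root of nonnegative reals; $\log$ is the principal branch in $\mathbb{C}\setminus(-\infty,0]$, with $\operatorname{Re}\log w=\ln|w|$ for all $w\neq0$;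 for $b>0$, $(z^2-b^2)^{1/2}$ is the branch holomorphic in $\mathbb{C}\setminus[-b,b]$ with $(z^2-b^2)^{1/2}\sim z$ as $z\to\infty$. The function $\Phi(z)=z+(z^2-1)^{1/2}$, mapping $\mathbb{C}\setminus[-1,1]$ onto $\{w\in\mathbb{C}:|w|>1\}$, is the inverse of the Joukowski map. In the formula for $C^{\mu_\tau}$ the singularity of the quotient at $z=-1$ is removable and its value there is understood as the limit. *)

(* Defs.v *)
From HB Require Import structures.
From mathcomp Require Import all_boot all_order all_algebra.
From mathcomp Require Import complex.
From mathcomp Require Import all_classical all_reals all_analysis.

Set Implicit Arguments.
Unset Strict Implicit.
Unset Printing Implicit Defensive.

Import Order.TTheory GRing.Theory Num.Theory numFieldNormedType.Exports.

Local Open Scope classical_set_scope.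
Local Open Scope ring_scope.
Local Open Scope complex_scope.

Notation normc := Normc.normc.

Section ComplexFunctions.
Context {R : realType}.
Implicit Types (b : R) (z w : R[i]).

Definition carg z : R :=
  let t := acos (complex.Re z / normc z) in
  if 0 <= complex.Im z then t else - t.

(* Principal branch, with argument pi on the negative axis: see [carg_polar] and
   [carg_bounds]. *)
Definition clog z : R[i] := ln (normc z) +i* carg z.

Definition csegment b : set R[i] := [set x%:C | x in `[- b, b]].

(* [sqrtc] is the principal square root of the library, so this is
   z (1 - b^2 / z^2)^(1/2), and 1 - b^2 / z^2 is a nonpositive real (or z = 0)
   exactly when z is in [-b, b].  By [sqrt_branchK], [sqrt_branch_derivable] and
   [sqrt_branch_equiv] this is the branch of (z^2 - b^2)^(1/2) that is
   holomorphic off [-b, b] and equivalent to z at infinity. *)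
Definition sqrt_branch b z : R[i] := z * sqrtc (1 - b%:C ^+ 2 / z ^+ 2).

Definition Phi z : R[i] := z + sqrt_branch 1 z.

End ComplexFunctions.

Section ComplexFunctionsTheory.
Context {R : realType}.
Implicit Types (b : R) (z w : R[i]).

Lemma carg_polar z :
  z = normc z * cos (carg z) +i* (normc z * sin (carg z)).
Proof.
have [->|z0] := eqVneq z 0; first by rewrite Normc.normc0 !mul0r.
case: z z0 => x y z0; rewrite /carg /=.
set n := Num.sqrt _.
have n2 : n ^+ 2 = x ^+ 2 + y ^+ 2 by rewrite sqr_sqrtr// addr_ge0 ?sqr_ge0.
have n0 : 0 < n.
  rewrite sqrtr_gt0 lt_neqAle addr_ge0 ?sqr_ge0// andbT eq_sym.
  rewrite paddr_eq0 ?sqr_ge0// !sqrf_eq0.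
  by apply: contra z0 => /andP[/eqP -> /eqP ->].
have xn : (x / n) ^+ 2 + (y / n) ^+ 2 = 1.
  by rewrite !expr_div_n -mulrDl n2 divff// -n2 expf_neq0// gt_eqF.
have nK t : n * (t / n) = t by rewrite mulrCA divff ?mulr1// gt_eqF.
have x1 : -1 <= x / n <= 1.
  rewrite -ler_norml -(@ler_pXn2r _ 2) ?nnegrE// real_normK ?num_real//.
  by rewrite expr1n -xn lerDl sqr_ge0.
have sx : Num.sqrt (1 - (x / n) ^+ 2) = `|y| / n.
  by rewrite -xn addrC addKr sqrtr_sqr normrM normfV (gtr0_norm n0).
case: ifPn => y0.
  rewrite acosK ?in_itv// sin_acos// sx (ger0_norm y0).
  by rewrite !nK.
rewrite cosN sinN acosK ?in_itv// sin_acos// sx ltr0_norm ?ltNge//.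
by rewrite mulNr opprK !nK.
Qed.

Lemma carg_bounds z : - pi < carg z <= pi.
Proof.
have : -1 <= complex.Re z / normc z <= 1.
  have [->|z0] := eqVneq z 0; first by rewrite Normc.normc0 invr0 mulr0 lerN10 ler01.
  case: z z0 => x y z0 /=; rewrite -ler_norml normrM normfV.
  rewrite (ger0_norm (sqrtr_ge0 _)) ler_pdivrMr; last first.
    rewrite sqrtr_gt0 lt_neqAle addr_ge0 ?sqr_ge0// andbT eq_sym.
    rewrite paddr_eq0 ?sqr_ge0// !sqrf_eq0.
    by apply: contra z0 => /andP[/eqP -> /eqP ->].
  by rewrite mul1r -sqrtr_sqr ler_wsqrtr// lerDl sqr_ge0.
move=> h; rewrite /carg; case: ifPn => y0.
  by rewrite acos_lepi// (lt_le_trans _ (acos_ge0 h))// oppr_lt0 pi_gt0.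
rewrite (le_trans _ (pi_ge0 R)) ?oppr_le0 ?acos_ge0// andbT ltrN2.
apply: acos_ltpi; case/andP: h => _ ->; rewrite andbT.
case: z y0 => x y /=; rewrite -ltNge => y0.
have y2 : 0 < y ^+ 2 by rewrite exprn_even_gt0//= lt_eqF.
have xy2 : 0 < x ^+ 2 + y ^+ 2 by rewrite ltr_wpDl ?sqr_ge0.
have n0 : 0 < Num.sqrt (x ^+ 2 + y ^+ 2) by rewrite sqrtr_gt0.
rewrite ltr_pdivlMr// mulN1r ltrNl (le_lt_trans (ler_norm _))// normrN.
by rewrite -sqrtr_sqr ltr_sqrt// ltrDl.
Qed.

Lemma sqrt_branchK b z : z != 0 -> sqrt_branch b z ^+ 2 = z ^+ 2 - b%:C ^+ 2.
Proof.
move=> z0.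
by rewrite exprMn sqr_sqrtc mulrBr mulr1 mulrC divfK// expf_neq0.
Qed.

Lemma Re_sqrtc_ge0 w : 0 <= complex.Re (sqrtc w).
Proof. by case: w => x y /=; exact: sqrtr_ge0. Qed.

Lemma Re_sqrtc_gt0 w :
  ~ (complex.Im w = 0 /\ complex.Re w <= 0) -> 0 < complex.Re (sqrtc w).
Proof.
case: w => x y /= xy; rewrite sqrtr_gt0 divr_gt0//.
have [y0|y0] := eqVneq y 0.
  have x0 : 0 < x by rewrite ltNge; apply/negP => x0; exact: xy.
  by rewrite ltr_wpDl ?sqrtr_ge0.
rewrite -ltrBlDr sub0r (le_lt_trans (ler_norm _))// normrN -sqrtr_sqr.
by rewrite ltr_sqrt ?ltrDl ?ltr_wpDl ?sqr_ge0// exprn_even_gt0.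
Qed.

Lemma sqrt_branch_Re_gt0 b z : ~ csegment b z -> 0 < b ->
  0 < complex.Re (sqrtc (1 - b%:C ^+ 2 / z ^+ 2)).
Proof.
move=> zb b0; apply: Re_sqrtc_gt0 => -[].
have z0 : z != 0.
  apply/eqP => z0; apply: zb; exists 0; last by rewrite z0.
  by rewrite /= in_itv/= oppr_le0 (ltW b0).
set w := 1 - _ => w1 w2.
have wE : w = (complex.Re w)%:C by case: w w1 w2 => ? ? /= ->.
move: wE w2; set r := complex.Re w => wE r0.
have r1 : 0 < 1 - r by rewrite subr_gt0 (le_lt_trans r0).
have r1' : (1 - r)%:C != 0 by rewrite eq_complex /= eqxx andbT gt_eqF.
pose t := Num.sqrt (b ^+ 2 / (1 - r)).
have t2 : t ^+ 2 = b ^+ 2 / (1 - r).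
  by rewrite sqr_sqrtr// divr_ge0 ?sqr_ge0// ltW.
have tb : t <= b.
  rewrite -(@ler_pXn2r _ 2) ?nnegrE ?sqrtr_ge0 ?(ltW b0)// t2.
  by rewrite ler_pdivrMr// ler_peMr ?sqr_ge0// lerDl oppr_ge0.
have t0 : 0 <= t by exact: sqrtr_ge0.
have z2 : z ^+ 2 = t%:C ^+ 2.
  have : 1 - w = b%:C ^+ 2 / z ^+ 2 by rewrite /w opprB addrC subrK.
  rewrite wE -(rmorph1 (real_complex R)) -rmorphB => e.
  rewrite -(rmorphXn (real_complex R)) t2 rmorphM fmorphV rmorphXn /=.
  apply: (mulIf r1'); rewrite divfK//.
  by rewrite [(1 - r)%:C]e mulrC divfK// expf_neq0.
move/eqP: z2; rewrite eqf_sqr => /orP[/eqP zt|/eqP zt]; apply: zb.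
- by exists t; rewrite //= in_itv/= tb (le_trans _ t0)// oppr_le0 ltW.
- exists (- t); last by rewrite rmorphN.
  by rewrite /= in_itv/= lerN2 tb (le_trans _ (ltW b0))// oppr_le0.
Qed.

Lemma sqrt_branch_neq0 b z : ~ csegment b z -> 0 < b -> sqrt_branch b z != 0.
Proof.
move=> zb b0; rewrite mulf_neq0//.
  apply/eqP => z0; apply: zb; exists 0; last by rewrite z0.
  by rewrite /= in_itv/= oppr_le0 (ltW b0).
by apply/eqP => s0; have := sqrt_branch_Re_gt0 zb b0; rewrite s0/= ltxx.
Qed.

Lemma sqrtc_lip w w0 : 0 < complex.Re (sqrtc w0) ->
  `|sqrtc w0 - sqrtc w| <= `|w0 - w| / (complex.Re (sqrtc w0))%:C.
Proof.
move=> r0; rewrite ler_pdivlMr ?ltcR//.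
rewrite -[in leRHS](sqr_sqrtc w0) -[in leRHS](sqr_sqrtc w) subr_sqr normrM ler_wpM2l//.
rewrite normc_def lecR; set u := sqrtc w0 + sqrtc w.
have : complex.Re (sqrtc w0) <= complex.Re u.
  by have := Re_sqrtc_ge0 w; rewrite /u; case: sqrtc => ? ?; case: sqrtc => ? ? /=; rewrite lerDl.
move=> /le_trans; apply; rewrite (le_trans (ler_norm _))// -sqrtr_sqr.
by rewrite ler_wsqrtr// lerDl sqr_ge0.
Qed.

Lemma sqrtc_continuous (w : R[i]^o) : 0 < complex.Re (sqrtc w) ->
  {for w, continuous (@sqrtc R : R[i]^o -> R[i]^o)}.
Proof.
move=> w0; apply/(@cvgrPdist_lt _ R[i]^o R[i]^o (nbhs w) _ (@sqrtc R)) => e e0.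
have r0 : 0 < (complex.Re (sqrtc w))%:C by rewrite ltcR.
near=> v; apply: le_lt_trans (sqrtc_lip v w0) _.
rewrite ltr_pdivrMr//; near: v.
apply: (@cvgr_dist_lt _ _ _ (nbhs w) _ id w); first exact: cvg_id.
by rewrite mulr_gt0.
Unshelve. all: by end_near. Qed.

Lemma sqrt_branch_continuous b (z : R[i]^o) : ~ csegment b z -> 0 < b ->
  {for z, continuous (sqrt_branch b : R[i]^o -> R[i]^o)}.
Proof.
move=> zb b0.
have z0 : z != 0.
  apply/eqP => z0; apply: zb; exists 0; last by rewrite z0.
  by rewrite /= in_itv/= oppr_le0 (ltW b0).
have FF : Filter (nbhs z) by exact: nbhs_filter.
have zz : (x : R[i]^o) @[x --> z] --> z by exact: cvg_id.
have gz : (1 - b%:C ^+ 2 / x ^+ 2 : R[i]^o) @[x --> z] --> (1 - b%:C ^+ 2 / z ^+ 2 : R[i]^o).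
  apply: (@cvgB _ R[i]^o _ (nbhs z) FF (cst 1)); first exact: (@cvg_cst R[i]^o).
  apply: (@cvgM R[i] _ (nbhs z) FF (cst (b%:C ^+ 2))); first exact: (@cvg_cst R[i]^o).
  apply: (@cvgV R[i] _ (nbhs z) FF (fun x => x ^+ 2)); first by rewrite expf_neq0.
  by rewrite expr2; exact: (@cvgM R[i] _ (nbhs z) FF id id).
apply: (@cvgM R[i] _ (nbhs z) FF id (fun x => sqrtc (1 - b%:C ^+ 2 / x ^+ 2)));
  first exact: zz.
apply: (@cvg_comp _ _ _ _ (@sqrtc R) _ _ _ gz).
exact/sqrtc_continuous/sqrt_branch_Re_gt0.
Qed.

Lemma sqrt_branch_derivable b (z : R[i]^o) : ~ csegment b z -> 0 < b ->
  derivable (sqrt_branch b : R[i]^o -> R[i]^o) z 1.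
Proof.
move=> zb b0; set s := (sqrt_branch b : R[i]^o -> R[i]^o).
have sz : s z != 0 by exact: sqrt_branch_neq0.
have z0 : z != 0 by apply: contra sz => /eqP ->; rewrite /s /sqrt_branch mul0r.
have ss : s z + s z != 0 by rewrite -mulr2n mulrn_eq0.
have FF0 : Filter (0 : R[i]^o)^' by exact: dnbhs_filter.
have idz : (h : R[i]^o) + z @[h --> (0 : R[i]^o)^'] --> (z : R[i]^o).
  rewrite -[X in _ --> X]add0r; apply: (@cvgD _ R[i]^o); last exact: cvg_cst.
  exact: nbhs_dnbhs.
have sh : s (h + z) + s z @[h --> (0 : R[i]^o)^'] --> s z + s z.
  apply: (@cvgD _ R[i]^o); last exact: cvg_cst.
  by apply: cvg_comp idz _; exact: sqrt_branch_continuous.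
rewrite /derivable; apply/cvg_ex; exists ((z + z) / (s z + s z) : R[i]^o).
have : (h + z + z) / (s (h + z) + s z) @[h --> (0 : R[i]^o)^']
    --> (z + z) / (s z + s z).
  apply: (@cvgM R[i] _ _ FF0 (fun h => h + z + z) (fun h => (s (h + z) + s z)^-1)).
    by apply: (@cvgD _ R[i]^o _ _ FF0 (fun h => h + z) (cst z) _ _ idz); exact: (@cvg_cst R[i]^o).
  exact: (@cvgV R[i] _ _ FF0 (fun h => s (h + z) + s z)).
apply: cvg_trans; apply: near_eq_cvg; near=> h.
have h0 : h != 0 by near: h; exact: nbhs_dnbhs_neq.
have hz : h + z != 0.
  by near: h; exact: (@cvgr_neq0 _ R[i]^o _ _ FF0 (fun h => h + z) z idz z0).
have shz : s (h + z) + s z != 0.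
  by near: h; exact: (@cvgr_neq0 _ R[i]^o _ _ FF0 (fun h => s (h + z) + s z) _ sh ss).
apply: (mulIf shz); rewrite divfK// /=.
rewrite /GRing.scale/= mulr1 -mulrA -subr_sqr !sqrt_branchK//.
rewrite addrAC opprB addrA subrK subr_sqr addrK mulrA mulVf// mul1r.
Unshelve. all: by end_near. Qed.

Lemma sqrt_branch_equiv b (e : R) : 0 < e ->
  exists M : R, forall z, M < normc z -> normc (sqrt_branch b z / z - 1) < e.
Proof.
move=> e0; exists (Num.max 1 (b ^+ 2 / e)) => z.
rewrite gt_max => /andP[z1 zM].
have nz : 0 < normc z by rewrite (lt_trans _ z1).
have z0 : z != 0 by apply: contraTneq nz => ->; rewrite Normc.normc0 ltxx.
rewrite /sqrt_branch mulrC mulKf//.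
rewrite -ltcR; have nE w : (normc w)%:C = `|w| by [].
rewrite nE distrC -(sqrtc1 R); apply: le_lt_trans (sqrtc_lip _ _) _.
  by rewrite sqrtc1 /=.
rewrite sqrtc1 /= divr1 opprB addrC subrK -nE ltcR.
rewrite Normc.normcM Normc.normcV !expr2 !Normc.normcM.
rewrite /= expr0n addr0 sqrtr_sqr -normrM ger0_norm -expr2 ?sqr_ge0//.
rewrite ltr_pdivrMr ?mulr_gt0// mulrC -ltr_pdivrMr// (lt_le_trans zM)//.
by rewrite ler_peMr// ltW.
Qed.

End ComplexFunctionsTheory.

Section Potentials.
Context {R : realType}.

(* The kernel log (1 / |x - z|) is +oo at x = z. *)
Definition log_potential (mu : {measure set (measurableTypeR R) -> \bar R}) (z : R[i]) : \bar R :=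
  (\int[mu]_x (- lne (normc (x%:C - z))%:E))%E.

Definition cauchy_transform (mu : {measure set (measurableTypeR R) -> \bar R}) (z : R[i]) : R[i] :=
  (\int[mu]_x complex.Re (z - x%:C)^-1)%R +i*
  (\int[mu]_x complex.Im (z - x%:C)^-1)%R.

Definition supp (mu : {measure set (measurableTypeR R) -> \bar R}) : set R :=
  [set x | forall U : set R, open U -> U x -> (0 < mu U)%E].

Fact ltrN11 : (-1 < 1 :> R). Proof. by rewrite (@lt_trans _ _ 0) ?ltrN10. Qed.

Definition lambda : probability (measurableTypeR R) R := uniform_prob ltrN11.

Definition is_equilibrium (tau : R) (mu : probability (measurableTypeR R) R) (omega : R) : Prop :=
  [/\ mu `[(-1 : R), 1]%classic = 1%E,
      forall x : R, supp mu x ->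
        (log_potential mu x%:C + tau%:E * log_potential lambda x%:C
         = omega%:E)%E &
      forall x : R, x \in `[-1, 1] ->
        (omega%:E <=
         log_potential mu x%:C + tau%:E * log_potential lambda x%:C)%E].

End Potentials.

(* Main.v *)
Require Import Defs.
From HB Require Import structures.
From mathcomp Require Import all_boot all_order all_algebra.
From mathcomp Require Import complex.
From mathcomp Require Import all_classical all_reals all_analysis.
From mathcomp Require Import measurable_realfun.
From mathcomp Require Import ring lra.

(** Why the theorem is true.  Put [kappa = (1 + tau) / tau], which lies in
    ]0, 1[, so that [- tau = (1 - kappa)^-1] and [beta^2 = 1 - kappa^2].  For
    [0 < k < 1] let [a_k = sqrt (1 - k^2)], let [alpha_k] be the arcsine law of
    [-a_k, a_k], that is the law of [a_k cos t] for [t] uniform, and let [p_k]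
    be its logarithmic potential.  Then [p_k = - ln (a_k / 2)] on [-a_k, a_k]
    and [p_k <= - ln (a_k / 2)] everywhere.  Archimedes' hat-box theorem says
    that the first coordinate of a uniform point of the sphere is uniform;
    slicing the sphere along another axis, the uniform law [lambda] is therefore
    the average of the [alpha_k] over all heights [k] in ]0, 1[ ([archimedes],
    [integral_lambda]).  Averaging over the cap [kappa < k < 1] only, one gets
    the measure [cap_measure], supported by [-beta, beta], and
      V^cap + tau V^lambda
        = - tau int_kappa^1 p_k dk + tau int_0^1 p_k dk = tau int_0^kappa p_k dk.
    Since [tau < 0], this is at least [- tau int_0^kappa ln (a_k / 2) dk], with
    equality exactly where [x] lies in all the segments involved, that is for
    [|x| <= beta].  So the cap measure satisfies the conditions that define the
    equilibrium measure, and the right-hand side is the equilibrium constant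
    ([cap_field_ge], [cap_field_eq], [equilibrium_constantE]).

    The equilibrium measure is unique ([potential_unique]) because
    [ln (3 / |x - y|)] is, for [x] and [y] in [-1, 1], a superposition of products
    [1_I(x) 1_I(y)] over intervals [I] ([window_kernel]).  The mutual energy of
    two measures is then an integral of products of the masses that they give
    to the intervals.  Integrating the equilibrium conditions of two solutions
    against both of them shows that the energy of their difference is at most
    zero; this energy is an integral of squares, so both give the same mass to
    almost every interval and are equal.

    All the formulas are now computed for the cap measure.  Its density at [x]
    is proportional to the length of the arc of the circle of radius
    [sqrt (1 - x^2)] above height [kappa], which is an arc cosine
    ([cap_density_arctan]).  Off the support the arcsine laws have potential
    [- ln |(z + s_k) / 2|] and Cauchy transform [1 / s_k], where [s_k] is the
    branch of the square root of [z^2 - 1 + k^2] that is equivalent to [z] at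
    infinity ([arcsine_log], [arcsine_cauchy]).  As [ds_k / dk = k / s_k], the
    function [log ((s_k + k) / (z + 1))] is a primitive of [1 / s_k] that
    vanishes at [k = 1] ([cderive_log_slope], [clog_slope1]), and
    [log_primitive] is one for the potential; integrating from [kappa] to [1]
    gives the two closed forms ([cap_cauchy], [cap_log_potential]). *)

Set Implicit Arguments.
Unset Strict Implicit.
Unset Printing Implicit Defensive.

Import Order.TTheory GRing.Theory Num.Theory numFieldNormedType.Exports.

Local Open Scope classical_set_scope.
Local Open Scope ring_scope.
Local Open Scope complex_scope.


(** * Complex arithmetic and derivatives along real paths *)

Section ComplexArithmetic.
Context {R : realType}.
Implicit Types (z w : R[i]) (x : R).

(** The plane cut along the closed negative half-line, where [clog] and
    [sqrtc] are smooth. *)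
Definition slit : set R[i] := [set w | ~ (complex.Im w = 0 /\ complex.Re w <= 0)].

Lemma eq_ReIm z w : complex.Re z = complex.Re w -> complex.Im z = complex.Im w -> z = w.
Proof. by case: z => ? ?; case: w => ? ? /= -> ->. Qed.

Lemma ReM z w : complex.Re (z * w)
  = complex.Re z * complex.Re w - complex.Im z * complex.Im w.
Proof. by case: z => ? ?; case: w. Qed.

Lemma ImM z w : complex.Im (z * w)
  = complex.Re z * complex.Im w + complex.Im z * complex.Re w.
Proof. by case: z => ? ?; case: w. Qed.

Lemma ReD z w : complex.Re (z + w) = complex.Re z + complex.Re w.
Proof. by case: z => ? ?; case: w. Qed.

Lemma ImD z w : complex.Im (z + w) = complex.Im z + complex.Im w.
Proof. by case: z => ? ?; case: w. Qed.

Lemma ReN z : complex.Re (- z) = - complex.Re z. Proof. by case: z. Qed.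

Lemma ImN z : complex.Im (- z) = - complex.Im z. Proof. by case: z. Qed.

Lemma normcE z : normc z = Num.sqrt (complex.Re z ^+ 2 + complex.Im z ^+ 2).
Proof. by case: z. Qed.

Lemma sqr_normc z : normc z ^+ 2 = complex.Re z ^+ 2 + complex.Im z ^+ 2.
Proof. by rewrite normcE sqr_sqrtr// addr_ge0 ?sqr_ge0. Qed.

Lemma normc_ge0 z : 0 <= normc z.
Proof. by rewrite normcE sqrtr_ge0. Qed.

Lemma normc_gt0 z : (0 < normc z) = (z != 0).
Proof.
rewrite lt_neqAle normc_ge0 andbT eq_sym; congr (~~ _).
by apply/eqP/eqP => [/Normc.eq0_normc//|->//]; rewrite Normc.normc0.
Qed.

Lemma sqr_normc_gt0 z : z != 0 -> 0 < complex.Re z ^+ 2 + complex.Im z ^+ 2.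
Proof. by rewrite -normc_gt0 -sqr_normc => ?; rewrite exprn_gt0. Qed.

Lemma ReV z : complex.Re z^-1
  = complex.Re z / (complex.Re z ^+ 2 + complex.Im z ^+ 2).
Proof. by case: z. Qed.

Lemma ImV z : complex.Im z^-1
  = - (complex.Im z / (complex.Re z ^+ 2 + complex.Im z ^+ 2)).
Proof. by case: z => x y /=; rewrite ?mulNr. Qed.

Lemma slit_neq0 w : slit w -> w != 0.
Proof. by move=> sw; apply/eqP => w0; apply: sw; rewrite w0. Qed.

Lemma slit_normcD_gt0 w : slit w -> 0 < normc w + complex.Re w.
Proof.
move=> sw; have n0 : 0 < normc w by rewrite normc_gt0 slit_neq0.
rewrite ltNge; apply/negP => h; apply: sw.
have r0 : complex.Re w <= - normc w by lra.
have := sqr_normc w => e.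
have i0 : complex.Im w ^+ 2 <= 0 by nra.
split; last by lra.
by apply/eqP; rewrite -sqrf_eq0 eq_le i0 sqr_ge0.
Qed.

(** The half-angle formula for the tangent: unlike the definition through
    [acos], which splits at the real axis, it is smooth on the whole slit
    plane. *)
Lemma carg_atan w : slit w ->
  carg w = 2 * atan (complex.Im w / (normc w + complex.Re w)).
Proof.
move=> sw; have n0 : 0 < normc w by rewrite normc_gt0 slit_neq0.
have nD := slit_normcD_gt0 sw.
have := carg_polar w; set n := normc w; set t := carg w => wE.
have [xE yE] : complex.Re w = n * cos t /\ complex.Im w = n * sin t.
  by split; rewrite [in LHS]wE.
have /andP[t1 t2] := carg_bounds w; rewrite -/t in t1 t2.
have c0 : 0 < 1 + cos t.
  by move: nD; rewrite xE -/n -[X in X + _]mulr1 -mulrDr pmulr_rgt0.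
have tpi : t != pi by apply: contraTneq c0 => ->; rewrite cospi subrr ltxx.
have {}t2 : t < pi by rewrite lt_neqAle tpi.
have tE : t = t / 2 + t / 2 by field.
have ch : 0 < cos (t / 2).
  by apply: cos_gt0_pihalf; lra.
have -> : complex.Im w / (n + complex.Re w) = tan (t / 2).
  rewrite xE yE /tan.
  have ct : cos t = cos (t / 2) ^+ 2 - sin (t / 2) ^+ 2.
    by rewrite {1}tE cosD -!expr2.
  have st : sin t = 2 * (sin (t / 2) * cos (t / 2)).
    by rewrite {1}tE sinD [in RHS]mulrC mulr_natr mulr2n; congr (_ + _); rewrite mulrC.
  have -> : n + n * cos t = n * (2 * cos (t / 2) ^+ 2).
    by rewrite ct sin2cos2; ring.
  rewrite st; field.
  by rewrite !gt_eqF//= ltr0n.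
rewrite tanK ?in_itv/=; last by apply/andP; split; lra.
by field.
Qed.

End ComplexArithmetic.

Section ComplexPaths.
Context {R : realType}.
Implicit Types (F G : R -> R[i]) (k : R) (D E : R[i]).

(** Only paths [R -> R[i]] have to be differentiated, and for these the
    componentwise derivative gives access to the theorems on real functions. *)
Definition cderive F k D :=
  is_derive k 1 (fun t => complex.Re (F t)) (complex.Re D) /\
  is_derive k 1 (fun t => complex.Im (F t)) (complex.Im D).

Lemma cderive_eq F k D E : cderive F k D -> D = E -> cderive F k E.
Proof. by move=> + <-. Qed.

Lemma cderive_cst D k : cderive (fun=> D) k 0.
Proof. by split; apply: is_derive_cst. Qed.

Lemma cderive_real k : cderive (fun t => t%:C) k 1.
Proof. by split => /=; [exact: is_derive_id|exact: is_derive_cst]. Qed.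

Lemma cderiveD F G k D E :
  cderive F k D -> cderive G k E -> cderive (fun t => F t + G t) k (D + E).
Proof.
move=> [F1 F2] [G1 G2]; split.
  rewrite ReD (_ : (fun _ => _) = (fun t => complex.Re (F t)) + (fun t => complex.Re (G t))).
    exact: is_deriveD.
  by apply/funext => t; rewrite ReD.
rewrite ImD (_ : (fun _ => _) = (fun t => complex.Im (F t)) + (fun t => complex.Im (G t))).
  exact: is_deriveD.
by apply/funext => t; rewrite ImD.
Qed.

Lemma cderiveM F G k D E : cderive F k D -> cderive G k E ->
  cderive (fun t => F t * G t) k (F k * E + D * G k).
Proof.
move=> [F1 F2] [G1 G2]; split.
  rewrite (_ : (fun _ => _) =
    (fun t => complex.Re (F t)) * (fun t => complex.Re (G t)) -
    (fun t => complex.Im (F t)) * (fun t => complex.Im (G t))).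
    apply: (is_derive_eq (is_deriveB (is_deriveM F1 G1) (is_deriveM F2 G2))).
    rewrite ReD !ReM /GRing.scale/=; ring.
  by apply/funext => t; rewrite ReM.
rewrite (_ : (fun _ => _) =
    (fun t => complex.Re (F t)) * (fun t => complex.Im (G t)) +
    (fun t => complex.Im (F t)) * (fun t => complex.Re (G t))).
  apply: (is_derive_eq (is_deriveD (is_deriveM F1 G2) (is_deriveM F2 G1))).
  rewrite ImD !ImM /GRing.scale/=; ring.
by apply/funext => t; rewrite ImM.
Qed.

Definition sqmod F : R -> R :=
  (fun t => complex.Re (F t)) * (fun t => complex.Re (F t)) +
  (fun t => complex.Im (F t)) * (fun t => complex.Im (F t)).

Lemma sqmodE F t : sqmod F t = complex.Re (F t) ^+ 2 + complex.Im (F t) ^+ 2.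
Proof. by rewrite /sqmod !fctE !expr2. Qed.

Lemma sqmod_gt0 F t : F t != 0 -> 0 < sqmod F t.
Proof. by rewrite sqmodE; exact: sqr_normc_gt0. Qed.

Lemma is_derive_sqmod F k D : cderive F k D ->
  is_derive k 1 (sqmod F) (2 * (complex.Re (F k) * complex.Re D
                              + complex.Im (F k) * complex.Im D)).
Proof.
move=> [F1 F2]; apply: (is_derive_eq (is_deriveD (is_deriveM F1 F1) (is_deriveM F2 F2))).
by rewrite /GRing.scale/=; ring.
Qed.

Lemma cderiveV F k D : F k != 0 -> cderive F k D ->
  cderive (fun t => (F t)^-1) k (- D / F k ^+ 2).
Proof.
move=> Fk0 [F1 F2].
pose n := sqmod F.
have nk0 : n k != 0 by rewrite gt_eqF// sqmod_gt0.
have nE := sqmodE F : forall t, n t = _.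
have dn := is_derive_sqmod (conj F1 F2) : is_derive k 1 n _.
have dV := is_deriveV nk0 dn.
rewrite nE in nk0.
split.
  rewrite (_ : (fun _ => _) = (fun t => complex.Re (F t)) * (fun t => (n t)^-1)).
    apply: is_derive_eq; rewrite ReM ReN ImN expr2 ReV ImV !ReM !ImM /GRing.scale/= nE.
    have -> : (complex.Re (F k) * complex.Re (F k) - complex.Im (F k) * complex.Im (F k)) ^+ 2 +
     (complex.Re (F k) * complex.Im (F k) + complex.Im (F k) * complex.Re (F k)) ^+ 2 =
     (complex.Re (F k) ^+ 2 + complex.Im (F k) ^+ 2) ^+ 2 by ring.
    by field.
  by apply/funext => t; rewrite ReV -nE.
rewrite (_ : (fun _ => _) = - ((fun t => complex.Im (F t)) * (fun t => (n t)^-1))).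
  apply: is_derive_eq; rewrite ImM ReN ImN expr2 ReV ImV !ReM !ImM /GRing.scale/= nE.
  have -> : (complex.Re (F k) * complex.Re (F k) - complex.Im (F k) * complex.Im (F k)) ^+ 2 +
     (complex.Re (F k) * complex.Im (F k) + complex.Im (F k) * complex.Re (F k)) ^+ 2 =
     (complex.Re (F k) ^+ 2 + complex.Im (F k) ^+ 2) ^+ 2 by ring.
  by field.
by apply/funext => t; rewrite ImV -nE.
Qed.

(** [ln |F|] is the real part of [log F], but needs no branch, so that it is
    differentiable wherever [F] does not vanish. *)
Lemma is_derive_ln_normc F k D : F k != 0 -> cderive F k D ->
  is_derive k 1 (fun t => ln (normc (F t))) (complex.Re (D / F k)).
Proof.
move=> Fk0 [F1 F2].
pose n := sqmod F.
have n0 : 0 < n k by exact: sqmod_gt0.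
have nE := sqmodE F : forall t, n t = _.
have dn := is_derive_sqmod (conj F1 F2) : is_derive k 1 n _.
have sn := is_derive1_sqrt n0.
have s0 : 0 < Num.sqrt (n k) by rewrite sqrtr_gt0.
have dl := is_derive1_ln s0.
rewrite (_ : (fun _ => _) = (@ln R \o (Num.sqrt \o n))); last first.
  by apply/funext => t /=; rewrite normcE -nE.
apply: is_derive_eq.
rewrite ReM ReV ImV -nE.
have e : n k = Num.sqrt (n k) ^+ 2 by rewrite sqr_sqrtr// ltW.
rewrite [in X in _ = X]e invfM; field.
by rewrite ?gt_eqF.
Qed.

Lemma cderive_clog F k D : slit (F k) -> cderive F k D ->
  cderive (fun t => clog (F t)) k (D / F k).
Proof.
move=> sF dF; have F0 := slit_neq0 sF; split; first exact: is_derive_ln_normc.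
pose n := sqmod F.
have n0 : 0 < n k by exact: sqmod_gt0.
have nE := sqmodE F : forall t, n t = _.
pose d := Num.sqrt \o n + (fun t => complex.Re (F t)).
have dE t : d t = normc (F t) + complex.Re (F t) by rewrite /d !fctE normcE -nE.
have dk0 : 0 < d k by rewrite dE slit_normcD_gt0.
have dkn : d k != 0 by rewrite gt_eqF.
have [F1 F2] := dF.
have sn := is_derive1_sqrt n0.
have dn := is_derive_sqmod (conj F1 F2) : is_derive k 1 n _.
have dd : is_derive k 1 d ((complex.Re (F k) * complex.Re D
                              + complex.Im (F k) * complex.Im D) / Num.sqrt (n k)
                            + complex.Re D).
  apply: is_derive_eq; congr (_ + _).
  by field; rewrite gt_eqF ?sqrtr_gt0.
have dV := is_deriveV dkn dd.
pose g := (fun t => complex.Im (F t)) * (fun t => (d t)^-1).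
pose h := 2 *: (@atan R \o g).
have nearE : \forall t \near k, h t = complex.Im (clog (F t)).
  have /cvgr_gt : d t @[t --> k] --> d k.
    apply: differentiable_continuous; apply/derivable1_diffP; exact: ex_derive.
  move=> /(_ 0 dk0); apply: filterS => t dt.
  rewrite /= carg_atan ?dE//; first by rewrite /h /g !fctE /= dE.
  move=> [i0 r0]; move: dt; rewrite dE normcE i0 expr0n/= addr0 sqrtr_sqr.
  by rewrite ler0_norm// addNr ltxx.
have dh : is_derive k 1 h (complex.Im (D / F k)).
  apply: is_derive_eq.
  rewrite ImM ReV ImV -nE /g !fctE /GRing.scale/=.
  have dkE : d k = Num.sqrt (n k) + complex.Re (F k) by [].
  have e : n k = Num.sqrt (n k) ^+ 2 by rewrite sqr_sqrtr// ltW.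
  have e2 : complex.Im (F k) ^+ 2 = Num.sqrt (n k) ^+ 2 - complex.Re (F k) ^+ 2.
    by rewrite -e nE; ring.
  rewrite [in X in _ = X]e.
  have sk0 : 0 < Num.sqrt (n k) by rewrite sqrtr_gt0.
  move: dkn; rewrite dkE; move: e2 sk0; move: (Num.sqrt (n k)) => s e2 s0 ds.
  have q0 : 1 + (complex.Im (F k) * (s + complex.Re (F k))^-1) ^+ 2 =
      2 * s / (s + complex.Re (F k)).
    by rewrite exprMn e2; field.
  rewrite q0; move: e2; set x := complex.Re (F k); set y := complex.Im (F k).
  set x' := complex.Re D; set y' := complex.Im D => e2.
  transitivity (
     ((s + x) * s * y' - y * s * x' - x * x' * y - y ^+ 2 * y') / ((s + x) * s ^+ 2)).
    by field; rewrite ds gt_eqF.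
  rewrite e2; by field; rewrite ds gt_eqF.
exact: near_eq_is_derive nearE dh.
Qed.

End ComplexPaths.

Section ComplexSqrtPath.
Context {R : realType}.
Implicit Types (F : R -> R[i]) (k : R) (D E : R[i]).

Lemma is_derive_cvg (f : R -> R) k (e : R) : is_derive k 1 f e -> f t @[t --> k] --> f k.
Proof. by move=> [df _]; apply: differentiable_continuous; exact/derivable1_diffP. Qed.

Lemma cderive_unique F k D E : cderive F k D -> cderive F k E -> D = E.
Proof.
move=> [[_ D1] [_ D2]] [[_ E1] [_ E2]].
by apply: eq_ReIm; [rewrite -D1 -E1|rewrite -D2 -E2].
Qed.

Lemma Re_sqrtcE (w : R[i]) :
  complex.Re (sqrtc w) = Num.sqrt ((normc w + complex.Re w) / 2).
Proof. by case: w. Qed.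

Lemma Im_sqrtcE (w : R[i]) : slit w ->
  complex.Im (sqrtc w) = complex.Im w / (2 * complex.Re (sqrtc w)).
Proof.
move=> sw; have r0 := Re_sqrtc_gt0 sw.
have : complex.Im (sqrtc w ^+ 2) = complex.Im w by rewrite sqr_sqrtc.
rewrite expr2 ImM => <-; field; by rewrite gt_eqF.
Qed.

Lemma slit_near F k D : slit (F k) -> cderive F k D ->
  \forall t \near k, slit (F t).
Proof.
move=> sF [F1 F2].
pose n := sqmod F.
have n0 : 0 < n k by exact/sqmod_gt0/slit_neq0.
pose d := Num.sqrt \o n + (fun t => complex.Re (F t)).
have dE t : d t = normc (F t) + complex.Re (F t) by rewrite /d !fctE normcE -sqmodE.
have sn := is_derive1_sqrt n0.
have [e de] : exists e, is_derive k 1 d e.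
  have [e de] : exists e, is_derive k 1 n e by eexists; exact: is_deriveD.
  by eexists; exact: is_deriveD.
have := is_derive_cvg de; rewrite dE.
move=> /cvgr_gt /(_ 0 (slit_normcD_gt0 sF)); apply: filterS => t.
rewrite dE => dt [i0 r0]; move: dt; rewrite normcE i0 expr0n/= addr0 sqrtr_sqr.
by rewrite ler0_norm// addNr ltxx.
Qed.

(** The components of the square root are differentiable by their explicit
    formulas; the value of the derivative then follows by differentiating
    [sqrtc F ^ 2 = F]. *)
Lemma cderive_sqrtc F k D : slit (F k) -> cderive F k D ->
  cderive (fun t => sqrtc (F t)) k (D / (2 * sqrtc (F k))).
Proof.
move=> sF dF; have F0 := slit_neq0 sF.
have [F1 F2] := dF.
pose n := sqmod F.
have n0 : 0 < n k by exact: sqmod_gt0.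
have nE := sqmodE F : forall t, n t = _.
have dn := is_derive_sqmod dF : is_derive k 1 n _.
have sn := is_derive1_sqrt n0.
pose d := 2^-1 *: (Num.sqrt \o n + (fun t => complex.Re (F t))).
have dE t : d t = (normc (F t) + complex.Re (F t)) / 2.
  by rewrite /d !fctE normcE -nE mulrC.
have d0 : 0 < d k by rewrite dE divr_gt0// slit_normcD_gt0.
have sd := is_derive1_sqrt d0.
pose s := Num.sqrt \o d.
have sE t : s t = complex.Re (sqrtc (F t)) by rewrite Re_sqrtcE /s /= dE.
have s0 : s k != 0 by rewrite sE gt_eqF ?Re_sqrtc_gt0.
have [e1 ds] : exists e, is_derive k 1 s e by eexists; exact: is_derive1_comp.
have dV := is_deriveV s0 ds.
pose g := 2^-1 *: ((fun t => complex.Im (F t)) * (fun t => (s t)^-1)).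
have [e2 dg] : exists e, is_derive k 1 g e by eexists; exact: is_deriveZ.
have dS : cderive (fun t => sqrtc (F t)) k (e1 +i* e2).
  split => /=.
    by rewrite (_ : (fun _ => _) = s)//; apply/funext => t; rewrite sE.
  apply: near_eq_is_derive dg.
  apply: filterS (slit_near sF dF) => t st.
  by rewrite Im_sqrtcE// /g !fctE /= sE invfM; rewrite /GRing.scale/=; ring.
have := cderiveM dS dS.
rewrite (_ : (fun _ => _) = F); last by apply/funext => t; rewrite -expr2 sqr_sqrtc.
move=> /(cderive_unique dF) DE.
have r0 : sqrtc (F k) != 0.
  by apply/eqP => e; move: s0; rewrite sE e eqxx.
by apply: (cderive_eq dS); rewrite [D in RHS]DE; field; rewrite r0.
Qed.

End ComplexSqrtPath.

(** * Integrals over the circle by angle doubling *)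

Section ChebyshevDoubling.
Context {R : realType}.
Local Notation leb := (@lebesgue_measure R).
Implicit Types (f F G : R -> R).

Lemma continuous_integrable f a b : continuous f ->
  leb.-integrable `[a, b] (EFin \o f).
Proof.
move=> cf; apply: continuous_compact_integrable; first exact: segment_compact.
exact: continuous_subspaceT.
Qed.

Lemma Rintegral_affine f (a b c d : R) : a <= b -> 0 < c -> continuous f ->
  \int[leb]_(t in `[c * a + d, c * b + d]) f t =
  c * \int[leb]_(t in `[a, b]) f (c * t + d).
Proof.
move=> ab c0 cf.
pose h t := c * t + d.
have dh (t : R) : is_derive t (1 : R) h c.
  rewrite (_ : h = c *: id + cst d); last by apply/funext.
  by apply: is_derive_eq; rewrite addr0 /GRing.scale/= mulr1.
have hE : derive1 h = cst c by apply/funext => t; rewrite derive1E; case: (dh t).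
have ch : continuous h.
  by move=> t; apply: differentiable_continuous; apply/derivable1_diffP; case: (dh t).
rewrite -RintegralZl//; last first.
  apply: continuous_integrable => t.
  exact: (continuous_comp (ch t) (cf _)).
congr fine.
rewrite -[c * a + d]/(h a) -[c * b + d]/(h b).
rewrite (@integration_by_substitution_increasing _ h f a b)//.
- by apply: eq_integral => t _; rewrite hE /= !fctE mulrC.
- by move=> x y _ _ xy; rewrite /h ltrD2r ltr_pM2l.
- by move=> x _; rewrite hE; exact: cvg_cst.
- by rewrite hE; exact: is_cvg_cst.
- by rewrite hE; exact: is_cvg_cst.
- split.
  + by move=> x _; case: (dh x).
  + by apply: cvg_at_right_filter; exact: ch.
  + by apply: cvg_at_left_filter; exact: ch.
- exact: continuous_subspaceT.
Qed.

Lemma Rintegral_reflect f (a b c : R) : a <= b -> continuous f ->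
  \int[leb]_(t in `[c - b, c - a]) f t = \int[leb]_(t in `[a, b]) f (c - t).
Proof.
move=> ab cf.
have cg : continuous (fun t : R => f (t + c)).
  move=> t; apply: (@continuous_comp R R R (fun t => t + c) f); last exact: cf.
  by apply: cvgD; [exact: cvg_id|exact: cvg_cst].
have e x : c - x = 1 * (- x) + c by rewrite mul1r addrC.
rewrite !e Rintegral_affine ?lerN2// mul1r.
transitivity (\int[leb]_(t in `[- b, - a]) f (t + c)).
  by apply: eq_Rintegral => t _; rewrite mul1r.
congr fine; rewrite integration_by_substitution_oppr//.
  by apply: eq_integral => t _ /=; rewrite addrC.
exact: continuous_subspaceT.
Qed.

(** Up to the factor [pi], the mean of [F] for the arcsine law of
    [[-1, 1]]. *)
Definition cos_integral F := \int[leb]_(t in `[0, pi]) F (cos t).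

Definition continuous_pm1 F := forall x, -1 <= x <= 1 -> {for x, continuous F}.

Lemma continuous_pm1_cos F : continuous_pm1 F -> continuous (fun t => F (cos t)).
Proof.
move=> cF t; apply: (continuous_comp (@continuous_cos R t)); apply: cF.
by rewrite cos_geN1 cos_le1.
Qed.

Lemma cos_integral_opp F : continuous_pm1 F ->
  cos_integral (fun x => F (- x)) = cos_integral F.
Proof.
move=> cF; rewrite /cos_integral.
have := Rintegral_reflect pi (pi_ge0 R) (continuous_pm1_cos cF).
rewrite subrr subr0 => ->; apply: eq_Rintegral => t _.
by rewrite cosB cospi sinpi mul0r addr0 mulN1r.
Qed.

(** The doubled angle runs over [[0, 2 pi]], on which the cosine takes every
    value twice, symmetrically. *)
Lemma cos_integral_T2 G : continuous_pm1 G ->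
  \int[leb]_(t in `[0, pi]) G (2 * cos t ^+ 2 - 1) = cos_integral G.
Proof.
move=> cG; set h := fun t => G (2 * cos t ^+ 2 - 1).
have hE t : h t = G (cos (2 * t + 0)).
  by rewrite /h addr0 !mulr_natl cos_mulr2n.
have ch : continuous h.
  move=> t; rewrite (_ : h = fun t => G (cos (2 * t + 0))); last exact/funext.
  apply: (@continuous_comp R R R (fun t => 2 * t + 0) (fun t => G (cos t))).
    by apply: cvgD; [apply: cvgM; [exact: cvg_cst|exact: cvg_id]|exact: cvg_cst].
  exact: (continuous_pm1_cos cG).
have p0 := pi_gt0 R.
have pE : pi = 2 * (pi / 2) + 0 :> R by field.
have -> : cos_integral G = 2 * \int[leb]_(t in `[0, pi / 2]) h t.
  rewrite /cos_integral {1}pE -[X in `[X, _]](_ : 2 * 0 + 0 = _); last by rewrite mulr0 addr0.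
  rewrite Rintegral_affine//; last 2 first.
  - by rewrite divr_ge0 ?pi_ge0.
  - exact: continuous_pm1_cos.
  by congr (_ * _); apply: eq_Rintegral => t _; rewrite hE.
have := @Rintegral_reflect h 0 (pi / 2) pi _ ch.
rewrite subr0 (_ : pi - pi / 2 = pi / 2); last by field.
move=> /(_ _) e.
have p2 : 0 <= pi / 2 :> R by rewrite divr_ge0 ?pi_ge0.
have := @Rintegral_itvB _ h (BLeft 0) (BRight pi) (pi / 2).
move=> /(_ (continuous_integrable _ _ ch)); rewrite !bnd_simp => /(_ p2) /(_ _) spl.
rewrite -[LHS](subrK (\int[leb]_(t in `[0, (pi / 2)]) h t)) spl; last by lra.

rewrite Rintegral_itv_obnd_cbnd; last first.
  by apply: integrableS (continuous_integrable 0 pi ch) => //; apply: subset_itvr; rewrite bnd_simp.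
rewrite e//.
have -> : \int[leb]_(t in `[0, (pi / 2)]) h (pi - t) = \int[leb]_(t in `[0, (pi / 2)]) h t.
  by apply: eq_Rintegral => t _; rewrite /h cosB cospi sinpi mul0r addr0 mulN1r sqrrN.
by ring.
Qed.

Lemma continuous_pm1_integrable F : continuous_pm1 F ->
  leb.-integrable `[0, pi] (EFin \o (fun t => F (cos t))).
Proof. by move=> cF; apply: continuous_integrable; exact: continuous_pm1_cos. Qed.

(** The angle doubling behind both arcsine integrals: averaging [F] over
    [t |-> pi - t] leaves a function of [cos (2 t)], and doubling the angle
    preserves the arcsine law. *)
Lemma cos_integral_double F G : continuous_pm1 F -> continuous_pm1 G ->
  (forall x, -1 <= x <= 1 -> F x + F (- x) = 2 * G (2 * x ^+ 2 - 1)) ->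
  cos_integral F = cos_integral G.
Proof.
move=> cF cG FG.
have cF' : continuous_pm1 (fun x => F (- x)).
  move=> x x1; apply: continuous_comp; first exact: opp_continuous.
  by apply: cF; lra.
have cG' : continuous_pm1 (fun x => G (2 * x ^+ 2 - 1)).
  move=> x x1; apply: (@continuous_comp R R R (fun x => 2 * x ^+ 2 - 1)).
    apply: cvgB; last exact: cvg_cst.
    by apply: cvgM; [exact: cvg_cst|exact: exprn_continuous].
  by apply: cG; nra.
suff : cos_integral F + cos_integral F = cos_integral G + cos_integral G by lra.
have iF := continuous_pm1_integrable cF; have iF' := continuous_pm1_integrable cF'.
have iG := continuous_pm1_integrable cG'.
rewrite -{2}(cos_integral_opp cF) -RintegralD//.
rewrite -cos_integral_T2// -RintegralD//.
apply: eq_Rintegral => t _; rewrite /= FG ?cos_geN1 ?cos_le1//.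
by rewrite mulrDl mul1r.
Qed.

Lemma cos_integral_cst (k : R) : cos_integral (fun=> k) = pi * k.
Proof.
have mE : leb `[0, pi]%classic = pi%:E.
  by rewrite lebesgue_measure_itv/= lte_fin pi_gt0 oppr0 adde0.
by rewrite /cos_integral Rintegral_cst// [X in fine X]mE mulrC.
Qed.

Lemma cos_integralD F G : continuous_pm1 F -> continuous_pm1 G ->
  cos_integral (fun x => F x + G x) = cos_integral F + cos_integral G.
Proof.
move=> cF cG; have iF := continuous_pm1_integrable cF.
have iG := continuous_pm1_integrable cG.
by rewrite /cos_integral RintegralD.
Qed.

Lemma cos_integral_bound F (M : R) : continuous_pm1 F ->
  (forall x, -1 <= x <= 1 -> `|F x| <= M) -> `|cos_integral F| <= M * pi.
Proof.
move=> cF FM; have iF := continuous_pm1_integrable cF.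
apply: le_trans (le_normr_Rintegral _ iF) _ => //.
have M0 : 0 <= M by apply: le_trans (FM 0 _); rewrite ?normr_ge0//; apply/andP; split; lra.
apply: (@le_trans _ _ (\int[leb]_(t in `[0, pi]) M)).
  apply: le_Rintegral => //.
  - exact: (integrable_norm iF).
  - by apply: continuous_integrable => x; exact: cvg_cst.
  - by move=> x _; apply: FM; rewrite cos_geN1 cos_le1.
by have := cos_integral_cst M; rewrite /cos_integral => ->; rewrite mulrC.
Qed.


End ChebyshevDoubling.

Section ArcsineIntegrals.
Context {R : realType}.
Implicit Types (x r : R) (u z w c : R[i]).

Lemma cderive_affine z w x : cderive (fun t : R => z + w * t%:C) x w.
Proof.
apply: (cderive_eq (cderiveD (cderive_cst z x) (cderiveM (cderive_cst w x) (cderive_real x)))).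
by rewrite mulr1 mul0r add0r addr0.
Qed.

Lemma continuous_ln_normc_affine z w x : z + w * x%:C != 0 ->
  {for x, continuous (fun t : R => ln (normc (z + w * t%:C)))}.
Proof. by move=> h; exact: is_derive_cvg (is_derive_ln_normc h (cderive_affine z w x)). Qed.

Lemma continuous_Re_div_affine c z w x : z + w * x%:C != 0 ->
  {for x, continuous (fun t : R => complex.Re (c / (z + w * t%:C)))}.
Proof.
move=> h; have [h1 _] := cderiveM (cderive_cst c x) (cderiveV h (cderive_affine z w x)).
exact: is_derive_cvg h1.
Qed.

Lemma ger0_normc x : 0 <= x -> normc x%:C = x.
Proof. by move=> x0; rewrite normcE /= expr0n addr0 sqrtr_sqr ger0_norm. Qed.

Lemma normc_real x : normc x%:C = `|x|.
Proof. by rewrite normcE /= expr0n addr0 sqrtr_sqr. Qed.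

Lemma normcN z : normc (- z) = normc z.
Proof. by rewrite -[- z]mulN1r Normc.normcM -(rmorphN1 (real_complex R)) normc_real normrN1 mul1r. Qed.

Lemma normc1 : normc (1 : R[i]) = 1.
Proof. by rewrite (_ : 1 = 1%:C)// normc_real normr1. Qed.

Lemma normc_triangle z w : normc (z + w) <= normc z + normc w.
Proof. by rewrite -lecR rmorphD/=; exact: (@ler_normD _ R[i]). Qed.

Lemma normcB_ge z w : normc z - normc w <= normc (z + w).
Proof. by rewrite lerBlDr; have := normc_triangle (z + w) (- w); rewrite addrK normcN. Qed.

Lemma Re_le_normc z : `|complex.Re z| <= normc z.
Proof. by rewrite normcE -sqrtr_sqr ler_wsqrtr// lerDl sqr_ge0. Qed.

(** The denominator [1 - 2 u x + u^2] of the generating series of the Chebyshev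
    polynomials.  For [x = cos t] it factors as
    [(1 - u e^(it)) (1 - u e^(-it))]. *)
Definition chebD u x : R[i] := (1 + u ^+ 2) + (- (2 * u)) * x%:C.

Lemma chebD_factor u x : -1 <= x <= 1 ->
  exists e : R[i], [/\ normc e = 1, normc e^-1 = 1 & chebD u x = (1 - u * e) * (1 - u * e^-1)].
Proof.
move=> x1; have x2 : 0 <= 1 - x ^+ 2 by nra.
pose y := Num.sqrt (1 - x ^+ 2); have y2 : y ^+ 2 = 1 - x ^+ 2 by rewrite sqr_sqrtr.
pose e := x +i* y; pose f := x -i* y.
have n1 : normc e = 1 by rewrite normcE /= y2 addrC subrK sqrtr1.
have ef : e * f = 1 by rewrite /e /f; apply: eq_ReIm; rewrite ?ReM ?ImM /=; nra.
have fE : e^-1 = f.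
  have e0 : e != 0 by apply: contra_eqN n1 => /eqP ->; rewrite Normc.normc0 eq_sym oner_eq0.
  by apply: (mulfI e0); rewrite ef mulfV.
exists e; split => //; first by rewrite Normc.normcV n1 invr1.
rewrite fE; have eDf : e + f = 2 * x%:C.
  by apply: eq_ReIm; rewrite ?ReD ?ImD ?ReM ?ImM /=; ring.
rewrite /chebD; transitivity (1 + u ^+ 2 * (e * f) - u * (e + f)); last by ring.
by rewrite ef eDf; ring.
Qed.

Lemma chebD_ge u x : -1 <= x <= 1 -> normc u < 1 ->
  (1 - normc u) ^+ 2 <= normc (chebD u x).
Proof.
move=> x1 u1; have [e [e1 f1 ->]] := chebD_factor u x1.
rewrite Normc.normcM expr2; apply: ler_pM; rewrite ?subr_ge0 ?(ltW u1)//.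
  by have := normcB_ge 1 (- (u * e)); rewrite normcN Normc.normcM e1 mulr1 normc1.
by have := normcB_ge 1 (- (u * e^-1)); rewrite normcN Normc.normcM f1 mulr1 normc1.
Qed.

Lemma chebD_le u x : -1 <= x <= 1 -> normc (chebD u x) <= (1 + normc u) ^+ 2.
Proof.
move=> x1; have [e [e1 f1 ->]] := chebD_factor u x1.
rewrite Normc.normcM expr2; apply: ler_pM; rewrite ?normc_ge0//.
  by have := normc_triangle 1 (- (u * e)); rewrite normcN Normc.normcM e1 mulr1 normc1.
by have := normc_triangle 1 (- (u * e^-1)); rewrite normcN Normc.normcM f1 mulr1 normc1.
Qed.

Lemma chebD_neq0 u x : -1 <= x <= 1 -> normc u < 1 -> chebD u x != 0.
Proof.
move=> x1 u1; rewrite -normc_gt0 (lt_le_trans _ (chebD_ge x1 u1))//.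
by rewrite exprn_gt0// subr_gt0.
Qed.

(** The relation that angle doubling exploits: [u] becomes [u^2] when [x]
    becomes the Chebyshev polynomial [2 x^2 - 1]. *)
Lemma chebD_double u x : chebD u x * chebD u (- x) = chebD (u ^+ 2) (2 * x ^+ 2 - 1).
Proof.
rewrite /chebD rmorphB rmorphM rmorphN rmorphXn /= (_ : 2%:C = 2); last first.
  by rewrite -[2%:R]/(2%:R) rmorph_nat.
by rewrite (_ : 1%:C = 1)//; ring.
Qed.

Lemma normcX2_le u r : normc u <= r -> r < 1 -> normc (u ^+ 2) <= normc u * r.
Proof. by move=> ur r1; rewrite expr2 Normc.normcM ler_wpM2l ?normc_ge0. Qed.

Lemma continuous_ln_chebD u : normc u < 1 ->
  continuous_pm1 (fun x => ln (normc (chebD u x))).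
Proof. by move=> u1 x x1; apply: continuous_ln_normc_affine; exact: chebD_neq0. Qed.

Lemma cos_integralZ (F : R -> R) k : continuous_pm1 F ->
  cos_integral (fun x => k * F x) = k * cos_integral F.
Proof.
by move=> cF; rewrite /cos_integral RintegralZl//; exact: continuous_pm1_integrable.
Qed.

Lemma cos_integral_ln_chebD_double u : normc u < 1 ->
  cos_integral (fun x => ln (normc (chebD u x))) =
  2^-1 * cos_integral (fun x => ln (normc (chebD (u ^+ 2) x))).
Proof.
move=> u1; have u2 : normc (u ^+ 2) < 1.
  rewrite expr2 Normc.normcM -[ltRHS]mulr1 ltr_pM ?normc_ge0//.
have c2 := continuous_ln_chebD u2.
rewrite -cos_integralZ//; apply: cos_integral_double.
- exact: continuous_ln_chebD.
- by move=> x x1; apply: cvgM; [exact: cvg_cst|exact: c2].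
move=> x x1; have x1' : -1 <= - x <= 1 by lra.
rewrite -lnM ?posrE ?normc_gt0 ?chebD_neq0// -Normc.normcM chebD_double.
by rewrite mulrA divff ?mul1r// pnatr_eq0.
Qed.

Lemma le_half_pow0 (a C : R) : 0 <= a -> (forall n, a <= C / 2 ^+ n) -> a = 0.
Proof.
move=> a0 aC; apply/eqP; rewrite eq_le a0 andbT.
have : (C / 2 ^+ n) @[n --> \oo] --> C * 0.
  apply: cvgM; first exact: cvg_cst.
  under eq_fun do rewrite -exprVn.
  by apply: cvg_expr; rewrite ger0_norm ?invr_ge0// invf_lt1// ltr1n.
rewrite mulr0 => h; rewrite -(cvg_lim _ h)//; apply: limr_ge.
  by apply/cvg_ex; exists 0.
by near=> n; exact: aC.
Unshelve. all: by end_near. Qed.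

(** Iterating [u |-> u^2] halves the integral each time while it stays bounded on
    every disc of radius less than [1], so it vanishes. *)
Lemma cos_integral_ln_chebD u : normc u < 1 ->
  cos_integral (fun x => ln (normc (chebD u x))) = 0.
Proof.
move=> u1; set r := normc u.
pose B := - (2 * ln (1 - r)).
have r0 : 0 <= r by exact: normc_ge0.
have bound n v : normc v <= r ->
    `|cos_integral (fun x => ln (normc (chebD v x)))| <= (B * pi) / 2 ^+ n.
  elim: n v => [|n ih] v vr.
    rewrite expr0 divr1; apply: cos_integral_bound.
      by apply: continuous_ln_chebD; exact: le_lt_trans u1.
    move=> x x1; have v1 : normc v < 1 by exact: le_lt_trans u1.
    have r1 : 0 < 1 - r by rewrite subr_gt0.
    have l2 (y : R) : 0 < y -> 2 * ln y = ln (y ^+ 2).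
      by move=> y0; rewrite lnXn// mulr_natl.
    have D0 : 0 < normc (chebD v x) by rewrite normc_gt0 chebD_neq0.
    have v0 := normc_ge0 v.
    rewrite ler_norml /B opprK l2// ler_ln ?posrE ?exprn_gt0//; apply/andP; split.
      by apply: le_trans (chebD_ge x1 v1); nra.
    rewrite -lnV ?posrE ?exprn_gt0// ler_ln ?posrE ?invr_gt0 ?exprn_gt0//.
    apply: le_trans (chebD_le _ x1) _.
    rewrite -[leRHS]mul1r ler_pdivlMr ?exprn_gt0// -exprMn.
    apply: exprn_ile1; nra.
  rewrite cos_integral_ln_chebD_double ?(le_lt_trans vr)//.
  rewrite normrM ger0_norm ?invr_ge0// [in leRHS]exprS invfM mulrCA ler_pM2l ?invr_gt0//.
  apply: ih; apply: le_trans (normcX2_le vr u1) _.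
  by rewrite -[leRHS]mul1r ler_wpM2r// (ltW (le_lt_trans vr u1)).
apply/eqP; rewrite -normr_eq0; apply/eqP.
by apply: (@le_half_pow0 _ (B * pi)) => // n; exact: bound.
Qed.

(** The Poisson kernel, with a complex parameter. *)
Definition chebK u x : R[i] := (1 - u ^+ 2) / chebD u x.

Lemma continuous_Re_chebK c u : normc u < 1 ->
  continuous_pm1 (fun x => complex.Re (c * (chebK u x - 1))).
Proof.
move=> u1 x x1.
rewrite (_ : (fun _ => _) = fun x => complex.Re (c * (1 - u ^+ 2) / chebD u x) - complex.Re c); last first.
  by apply/funext => t; rewrite mulrBr mulr1 ReD ReN /chebK mulrA.
apply: cvgB; last exact: cvg_cst.
by apply: continuous_Re_div_affine; exact: chebD_neq0.
Qed.

Lemma chebK_double u x : -1 <= x <= 1 -> normc u < 1 ->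
  chebK u x + chebK u (- x) = 2 * chebK (u ^+ 2) (2 * x ^+ 2 - 1).
Proof.
move=> x1 u1; have x1' : -1 <= - x <= 1 by lra.
have D1 := chebD_neq0 x1 u1; have D2 := chebD_neq0 x1' u1.
rewrite /chebK -chebD_double; apply: (mulIf D1); apply: (mulIf D2).
rewrite [RHS](_ : _ = 2 * (1 - (u ^+ 2) ^+ 2)); last by field; rewrite D2 D1.
rewrite [LHS](_ : _ = (1 - u ^+ 2) * (chebD u x + chebD u (- x))); last by field; rewrite D2 D1.
by rewrite /chebD rmorphN /=; ring.
Qed.

(** Angle doubling replaces [u] by [u^2] without changing the integral, and
    [chebK u - 1] tends to [0] with [u]. *)
Lemma cos_integral_chebK c u : normc u < 1 ->
  cos_integral (fun x => complex.Re (c * (chebK u x - 1))) = 0.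
Proof.
move=> u1; set r := normc u.
pose B := normc c * (4 / (1 - r) ^+ 2) * pi.
have r0 : 0 <= r by exact: normc_ge0.
have r1 : 0 < 1 - r by rewrite subr_gt0.
have B0 : 0 <= B.
  by rewrite /B !mulr_ge0 ?normc_ge0 ?invr_ge0 ?exprn_ge0 ?pi_ge0// ltW.
have bound n v : normc v <= r ->
    `|cos_integral (fun x => complex.Re (c * (chebK v x - 1)))| <= B * normc v * r ^+ n.
  elim: n v => [|n ih] v vr; have v1 : normc v < 1 by exact: le_lt_trans u1.
    rewrite expr0 mulr1 /B mulrAC.
    apply: cos_integral_bound; first exact: continuous_Re_chebK.
    move=> x x1; apply: le_trans (Re_le_normc _) _.
    rewrite Normc.normcM -mulrA ler_wpM2l ?normc_ge0//.
    have D0 := chebD_neq0 x1 v1.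
    have -> : chebK v x - 1 = 2 * v * (x%:C - v) / chebD v x.
      apply: (mulIf D0); rewrite mulrBl /chebK !divfK// mul1r /chebD; ring.
    rewrite Normc.normcM Normc.normcV.
    have Dr : (1 - r) ^+ 2 <= normc (chebD v x).
      apply: le_trans (chebD_ge x1 v1); rewrite ler_pXn2r ?nnegrE ?(ltW r1)//; lra.
    have [v0 n0] := (normc_ge0 v, normc_ge0 (2 * v * (x%:C - v))).
    have xv : normc (x%:C - v) <= 2.
      apply: le_trans (normc_triangle _ _) _; rewrite normcN normc_real.
      by have : `|x| <= 1 by [rewrite ler_norml]; lra.
    have nn : normc (2 * v * (x%:C - v)) <= 4 * normc v.
      rewrite !Normc.normcM (_ : normc 2 = 2); last first.
        by rewrite (_ : 2 = 2%:C) ?normc_real ?ger0_norm// rmorph_nat.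
      by nra.
    rewrite [leRHS](_ : _ = 4 * normc v * ((1 - r) ^+ 2)^-1); last by ring.
    have iD : 0 <= (normc (chebD v x))^-1 by rewrite invr_ge0 normc_ge0.
    apply: ler_pM => //.
    by rewrite lef_pV2 ?posrE ?normc_gt0 ?exprn_gt0.
  have v2r := normcX2_le vr u1.
  have v0 := normc_ge0 v.
  have v2 : normc (v ^+ 2) <= r.
    by apply: le_trans v2r _; rewrite -[leRHS]mul1r ler_wpM2r// (ltW v1).
  have v21 : normc (v ^+ 2) < 1 by exact: le_lt_trans u1.
  have -> : cos_integral (fun x => complex.Re (c * (chebK v x - 1))) =
    cos_integral (fun x => complex.Re (c * (chebK (v ^+ 2) x - 1))).
    apply: cos_integral_double; [exact: continuous_Re_chebK|exact: continuous_Re_chebK|].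
    move=> x x1; rewrite -ReD -mulrDr.
    have -> : chebK v x - 1 + (chebK v (- x) - 1) = chebK v x + chebK v (- x) - 2 by ring.
    rewrite chebK_double// -[X in _ - X]mulr1 -mulrBr mulrCA.
    by rewrite (_ : 2 = 2%:C) ?ReM/= ?mul0r ?subr0// rmorph_nat.
  apply: le_trans (ih _ v2) _.
  rewrite [leRHS](_ : _ = B * (normc v * r) * r ^+ n); last by rewrite exprS; ring.
  by rewrite ler_wpM2r ?exprn_ge0// ler_wpM2l.
apply/eqP; rewrite -normr_eq0 eq_le normr_ge0 andbT.
have : (B * r * r ^+ n) @[n --> \oo] --> B * r * 0.
  by apply: cvgM; [exact: cvg_cst|apply: cvg_expr; rewrite ger0_norm].
rewrite mulr0 => h; rewrite -(cvg_lim _ h)//; apply: limr_ge.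
  by apply/cvg_ex; exists 0.
by near=> n; exact: bound.
Unshelve. all: by end_near. Qed.

End ArcsineIntegrals.

(** * Potential and Cauchy transform of the arcsine laws *)

Section ArcsinePotential.
Context {R : realType}.
Local Notation leb := (@lebesgue_measure R).
Implicit Types (b x M : R) (z c : R[i]).

Lemma csegment0 b : 0 <= b -> csegment b 0.
Proof. by move=> b0; exists 0 => //; rewrite /= in_itv/= oppr_le0 b0. Qed.

Lemma notin_csegment_neq0 b z : 0 <= b -> ~ csegment b z -> z != 0.
Proof. by move=> b0 zb; apply/eqP => z0; apply: zb; rewrite z0; exact: csegment0. Qed.

(** The numbers [z + s] and [z - s] have product [b^2], and the first one is
    larger in modulus because [Re (s / z) > 0]. *)
Lemma normc_joukowski_gt b z : 0 < b -> ~ csegment b z ->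
  b < normc (z + sqrt_branch b z).
Proof.
move=> b0 zb; have z0 := notin_csegment_neq0 (ltW b0) zb.
set s := sqrt_branch b z.
have s2 : s ^+ 2 = z ^+ 2 - b%:C ^+ 2 by exact: sqrt_branchK.
have prod : normc (z + s) * normc (z - s) = b ^+ 2.
  rewrite -Normc.normcM (_ : _ * _ = (b ^+ 2)%:C); last first.
    by rewrite rmorphXn/= mulrC -subr_sqr s2; ring.
  by rewrite normc_real ger0_norm ?sqr_ge0.
have Rs := sqrt_branch_Re_gt0 zb b0.
set t := sqrtc _ in Rs.
have lt2 : normc (z - s) ^+ 2 < normc (z + s) ^+ 2.
  rewrite /s /sqrt_branch -/t (_ : z - z * t = z * (1 - t)); last by ring.
  rewrite (_ : z + z * t = z * (1 + t)); last by ring.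
  rewrite !Normc.normcM !exprMn ltr_pM2l ?exprn_gt0 ?normc_gt0//.
  by rewrite !sqr_normc !ReD !ImD ReN ImN /=; nra.
have [n1 n2] := (normc_ge0 (z + s), normc_ge0 (z - s)).
have lt1 : normc (z - s) < normc (z + s) by rewrite -(@ltr_pXn2r _ 2) ?nnegrE.
rewrite ltNge; apply/negP => le_b.
have : b * b <= b * normc (z - s) by rewrite -expr2 -prod ler_wpM2r.
by rewrite ler_pM2l// leNgt (lt_le_trans lt1 le_b).
Qed.

(** The exterior conformal coordinate [p] of the segment, normalized by
    [z = p + (b / 2)^2 / p]. *)
Definition joukowski b z : R[i] := (z + sqrt_branch b z) / 2.

Lemma normc_half z : normc (z / 2) = normc z / 2.
Proof.
by rewrite Normc.normcM (_ : 2^-1 = (2^-1)%:C) ?normc_real ?ger0_norm// fmorphV rmorph_nat.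
Qed.

Lemma joukowski_gt b z : 0 < b -> ~ csegment b z -> b / 2 < normc (joukowski b z).
Proof.
by move=> b0 zb; rewrite /joukowski normc_half ltr_pM2r// normc_joukowski_gt.
Qed.

Lemma joukowski_neq0 b z : 0 < b -> ~ csegment b z -> joukowski b z != 0.
Proof.
move=> b0 zb; rewrite -normc_gt0 (lt_trans _ (joukowski_gt b0 zb))//.
by rewrite divr_gt0.
Qed.

Definition jou_inv b z : R[i] := (b / 2)%:C / joukowski b z.

Lemma jou_inv_lt1 b z : 0 < b -> ~ csegment b z -> normc (jou_inv b z) < 1.
Proof.
move=> b0 zb; have j := joukowski_gt b0 zb.
rewrite Normc.normcM Normc.normcV normc_real ger0_norm ?divr_ge0 ?(ltW b0)//.
by rewrite ltr_pdivrMr ?mul1r// (lt_trans _ j)// divr_gt0.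
Qed.

Lemma half_real b : (b / 2)%:C = b%:C / 2 :> R[i].
Proof. by rewrite rmorphM fmorphV rmorph_nat. Qed.

Lemma joukowskiE b z : z != 0 ->
  joukowski b z * (z - sqrt_branch b z) = b%:C ^+ 2 / 2.
Proof.
move=> z0; rewrite /joukowski.
rewrite (_ : _ / 2 * _ = (z ^+ 2 - sqrt_branch b z ^+ 2) / 2); last by ring.
by rewrite sqrt_branchK//; congr (_ / 2); ring.
Qed.

(** In the coordinate [p], the distance from [z] to the point [b cos t] is a
    Chebyshev denominator with parameter [b / (2 p)], of modulus less
    than [1]. *)
Lemma joukowski_chebD b z x : 0 < b -> ~ csegment b z ->
  z - (b * x)%:C = joukowski b z * chebD (jou_inv b z) x.
Proof.
move=> b0 zb; have p0 := joukowski_neq0 b0 zb.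
have z0 := notin_csegment_neq0 (ltW b0) zb.
have e := joukowskiE b z0.
have zE : z = joukowski b z + (z - sqrt_branch b z) / 2 by rewrite /joukowski; field.
apply: (mulfI p0).
rewrite /chebD /jou_inv half_real rmorphM /=.
move: e; set p := joukowski b z; set m := z - sqrt_branch b z => e.
transitivity (p ^+ 2 + (p * m) / 2 - p * (b%:C * x%:C)).
  by rewrite {1}zE -/p -/m; ring.
rewrite e; by field.
Qed.

Lemma joukowski_sqrt_branch b z : 0 < b -> ~ csegment b z ->
  sqrt_branch b z = joukowski b z * (1 - jou_inv b z ^+ 2).
Proof.
move=> b0 zb; have p0 := joukowski_neq0 b0 zb.
have z0 := notin_csegment_neq0 (ltW b0) zb.
have e := joukowskiE b z0.
have sE : sqrt_branch b z = joukowski b z - (z - sqrt_branch b z) / 2 by rewrite /joukowski; field.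
apply: (mulfI p0); rewrite /jou_inv half_real.
move: e sE; set p := joukowski b z; set m := z - sqrt_branch b z => e sE.
rewrite sE; transitivity (p ^+ 2 - (p * m) / 2); first by ring.
by rewrite e; field.
Qed.

Lemma segment_affine_neq0 b z x : 0 < b -> ~ csegment b z -> -1 <= x <= 1 ->
  z - (b * x)%:C != 0.
Proof.
move=> b0 zb x1; rewrite joukowski_chebD// mulf_neq0 ?joukowski_neq0//.
by rewrite chebD_neq0// jou_inv_lt1.
Qed.

Lemma arcsine_log b z : 0 < b -> ~ csegment b z ->
  cos_integral (fun x => ln (normc (z - (b * x)%:C))) = pi * ln (normc (joukowski b z)).
Proof.
move=> b0 zb; have u1 := jou_inv_lt1 b0 zb.
have p0 := joukowski_neq0 b0 zb.
transitivity (cos_integral (fun x => ln (normc (joukowski b z)) + ln (normc (chebD (jou_inv b z) x)))).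
  apply: eq_Rintegral => t _.
  rewrite joukowski_chebD// Normc.normcM lnM ?posrE ?normc_gt0//.
  by rewrite chebD_neq0// cos_geN1 cos_le1.
rewrite cos_integralD; last 2 first.
- by move=> t _; exact: cvg_cst.
- exact: continuous_ln_chebD.
by rewrite cos_integral_ln_chebD// addr0 cos_integral_cst.
Qed.

Lemma arcsine_cauchy b z c : 0 < b -> ~ csegment b z ->
  cos_integral (fun x => complex.Re (c / (z - (b * x)%:C))) =
  pi * complex.Re (c / sqrt_branch b z).
Proof.
move=> b0 zb; have u1 := jou_inv_lt1 b0 zb.
have p0 := joukowski_neq0 b0 zb; have s0 := sqrt_branch_neq0 zb b0.
set s := sqrt_branch b z in s0 *.
transitivity (cos_integral (fun x => complex.Re (c / s) +
    complex.Re (c / s * (chebK (jou_inv b z) x - 1)))).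
  apply: eq_Rintegral => t _; rewrite -ReD; congr (complex.Re _).
  have D0 : chebD (jou_inv b z) (cos t) != 0 by rewrite chebD_neq0// cos_geN1 cos_le1.
  rewrite mulrBr mulr1 [RHS]addrC subrK joukowski_chebD// /chebK.
  have := joukowski_sqrt_branch b0 zb; rewrite -/s => sE.
  have k0 : 1 - jou_inv b z ^+ 2 != 0.
    by apply: contra_neq s0 => k0; rewrite sE k0 mulr0.
  by rewrite sE; field; rewrite D0 k0 p0.
rewrite cos_integralD; last 2 first.
- by move=> t _; exact: cvg_cst.
- exact: continuous_Re_chebK.
by rewrite cos_integral_chebK// addr0 cos_integral_cst.
Qed.

End ArcsinePotential.

Section ArcsinePotentialOnSegment.
Context {R : realType}.
Local Notation leb := (@lebesgue_measure R).
Implicit Types (b c x M d : R).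

(** The kernel [ln (M / d)], nonnegative for distances [d <= M]: the constant
    [M] makes all the monotone convergence and Fubini-Tonelli theorems
    available, although the logarithmic kernel itself changes sign. *)
Definition logker M d : \bar R := if d == 0 then +oo%E else (ln M - ln d)%:E.

Lemma logkerE M d : 0 <= d -> logker M d = ((ln M)%:E - lne d%:E)%E.
Proof.
move=> d0; rewrite /logker; case: ifPn => [/eqP ->|dn0].
  by rewrite le0_lneNy.
by rewrite lne_EFin// lt_neqAle eq_sym dn0.
Qed.

Lemma logker_ge0 M d : 0 <= d -> d <= M -> (0 <= logker M d)%E.
Proof.
move=> d0 dM; rewrite /logker; case: ifPn => // dn0.
have {}d0 : 0 < d by rewrite lt_neqAle eq_sym dn0.
by rewrite lee_fin subr_ge0 ler_ln ?posrE// (lt_le_trans d0).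
Qed.

Lemma measurable_logker M : measurable_fun [set: R] (logker M).
Proof.
apply: measurable_fun_ifT => //=.
  exact: measurable_fun_eqr.
by apply/measurable_EFinP; apply: measurable_funB.
Qed.

Lemma cos_integralE (F : R -> R) : continuous_pm1 F ->
  (\int[leb]_(t in `[0%R, pi]) (F (cos t))%:E = (cos_integral F)%:E)%E.
Proof.
move=> cF; rewrite /cos_integral /Rintegral fineK//.
by apply: integrable_fin_num => //; exact: continuous_pm1_integrable.
Qed.

(** The square of the distance from [2 x] to the point [u + u^-1] of the ellipse
    with foci [2] and [-2], for [u] of argument [acos c] and [q = |u| + |u|^-1]. *)
Let ell (q c x : R) := q ^+ 2 - 4 * q * c * x + 4 * x ^+ 2 - 4 + 4 * c ^+ 2.

(** Divide [1 - 2 u x + u^2] by [u]: what remains is [u + u^-1 - 2 x]. *)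
Lemma chebD_ell (r c x : R) : 0 < r -> -1 <= c <= 1 ->
  normc (chebD (r%:C * (c +i* Num.sqrt (1 - c ^+ 2))) x) ^+ 2
  = r ^+ 2 * ell (r + r^-1) c x.
Proof.
move=> r0 c1; have y0 : 0 <= 1 - c ^+ 2 by nra.
pose y := Num.sqrt (1 - c ^+ 2); have y2 : y ^+ 2 = 1 - c ^+ 2 by rewrite sqr_sqrtr.
rewrite -/y sqr_normc /chebD.
rewrite (_ : complex.Re _ = 1 + r ^+ 2 * (c ^+ 2 - y ^+ 2) - 2 * r * c * x); last first.
  by rewrite !expr2 !(ReD, ImD, ReM, ImM, ReN, ImN) /=; ring.
rewrite (_ : complex.Im _ = r ^+ 2 * (2 * c * y) - 2 * r * y * x); last first.
  by rewrite !expr2 !(ReD, ImD, ReM, ImM, ReN, ImN) /=; ring.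
rewrite /ell; have rn0 : r != 0 by rewrite gt_eqF.
rewrite [LHS](_ : _ = (1 + r ^+ 2 * (c ^+ 2 - y ^+ 2) - 2 * r * c * x) ^+ 2
   + y ^+ 2 * (r ^+ 2 * (2 * c) - 2 * r * x) ^+ 2); last by ring.
by rewrite y2; field.
Qed.

(** Confocal ellipses: the point of parameter [c] recedes from every point of
    the focal segment as the ellipse grows. *)
Lemma ell_mono (q q' c x : R) : 2 <= q' -> q' <= q -> -1 <= c <= 1 -> -1 <= x <= 1 ->
  ell q' c x <= ell q c x.
Proof.
move=> q2 qq c1 x1; have cx : c * x <= 1 by nra.
rewrite -subr_ge0 /ell.
rewrite (_ : _ - _ = (q - q') * ((q + q') - 4 * (c * x))); last by ring.
by apply: mulr_ge0; lra.
Qed.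

Lemma ell_le (q c x : R) : 2 <= q -> q <= 5 / 2 -> -1 <= c <= 1 -> -1 <= x <= 1 ->
  ell q c x <= (9 / 2) ^+ 2.
Proof.
move=> q2 q5 c1 x1; have cx : - (c * x) <= 1 by nra.
have x2 : x ^+ 2 <= 1 by nra.
have c2 : c ^+ 2 <= 1 by nra.
have qcx : q * - (c * x) <= 5 / 2 by nra.
rewrite /ell; nra.
Qed.

(** The potential is constant on the segment.  For [c = cos s], approach
    [e^(is)] by [u = r e^(is)] with [r < 1], where the integral is already
    known.  After division by [|u|] the integrands are monotone in [r]
    ([ell_mono]), so monotone convergence passes to the limit; the bound
    [9 / 4 * b <= M] makes them nonnegative ([ell_le]). *)
Lemma arcsine_log_on b c M : 0 < b -> -1 <= c <= 1 -> 9 / 4 * b <= M ->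
  (\int[leb]_(t in `[0%R, pi]) logker M `|b * c - b * cos t|%R
   = (pi * (ln M - ln (b / 2)))%:E)%E.
Proof.
move=> b0 c1 bM; have M0 : 0 < M by lra.
have c2 : 0 <= 1 - c ^+ 2 by clear -c1; nra.
have acos_in : acos c \in `[0, pi] by rewrite in_itv/= acos_ge0// acos_lepi.
pose D := `[0, pi]%classic `\ acos c : set R.
have mD : measurable D by apply: measurableD.
have mk : measurable_fun setT (fun t => logker M `|b * c - b * cos t|%R).
  apply: (measurableT_comp (measurable_logker M)); apply: measurableT_comp => //.
  apply: measurable_funB => //; apply: measurable_funM => //.
  by apply: continuous_measurable_fun; exact: continuous_cos.
rewrite -(@integral_setD1 _ _ (acos c))//; last exact: measurable_funTS.
(* Any sequence increasing to [1] would do; this one starts at [1 / 2], so that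
   [q 0 = 5 / 2], as [ell_le] requires. *)
pose r n : R := (1 + harmonic n)^-1.
have h0 n : 0 < harmonic n :> R by exact: harmonic_gt0.
have r0 n : 0 < r n by rewrite invr_gt0 addr_gt0.
have r1 n : r n < 1 by rewrite invf_lt1 ?addr_gt0// ltrDl.
have hle (m n : nat) : (m <= n)%N -> harmonic n <= harmonic m :> R.
  by move=> mn; rewrite lef_pV2 ?posrE ?ltr0n// ler_nat.
have h1 n : harmonic n <= 1 :> R by apply: le_trans (hle 0 n _) _; rewrite //= invr1.
pose q n := r n + (r n)^-1.
have qE n : q n = 2 + harmonic n ^+ 2 / (1 + harmonic n).
  by rewrite /q /r invrK; field; rewrite gt_eqF ?addr_gt0.
have q2 n : 2 <= q n by rewrite qE lerDl divr_ge0 ?sqr_ge0// addr_ge0 ?ltW.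
have qle (m n : nat) : (m <= n)%N -> q n <= q m.
  move=> mn; rewrite !qE lerD2l ler_pdivrMr ?addr_gt0// mulrAC ler_pdivlMr ?addr_gt0//.
  rewrite -subr_ge0; move: (hle _ _ mn) (h0 m) (h0 n); move: (harmonic m) (harmonic n) => a a' aa a0 a'0.
  rewrite (_ : _ - _ = (a - a') * (a + a' + a * a')); last by ring.
  by rewrite mulr_ge0 ?subr_ge0// !addr_ge0 ?mulr_ge0 ?ltW.
have qlt n : q n <= 5 / 2.
  rewrite qE (_ : 5 / 2 = 2 + 2^-1); last by field.
  rewrite lerD2l ler_pdivrMr ?addr_gt0//.
  by move: (h1 n) (h0 n); move: (harmonic n) => a a1 a0; clear -a1 a0; nra.
have ch : (1 + harmonic n : R) @[n --> \oo] --> (1 : R).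
  rewrite -[X in _ --> X]addr0; apply: cvgD; [exact: cvg_cst|exact: cvg_harmonic].
have cvgr : r n @[n --> \oo] --> (1 : R).
  by rewrite -[X in _ --> X]invr1; apply: cvgV.
have cvgq : q n @[n --> \oo] --> (2 : R).
  have -> : q = fun n => r n + (1 + harmonic n) by apply/funext => n; rewrite /q /r invrK.
  by apply: cvgD.
pose e : R[i] := c +i* Num.sqrt (1 - c ^+ 2).
have ne : normc e = 1.
  by rewrite normcE /= sqr_sqrtr// addrC subrK sqrtr1.
pose u n := (r n)%:C * e.
have nu n : normc (u n) = r n.
  by rewrite Normc.normcM ne mulr1 normc_real ger0_norm// ltW.
pose g n x := (ln M - ln (b / 2) + ln (r n)) - ln (normc (chebD (u n) x)).
have u1 n : normc (u n) < 1 by rewrite nu.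
have cg n : continuous_pm1 (g n).
  move=> x x1; apply: cvgB; first exact: cvg_cst.
  exact: (continuous_ln_chebD (u1 n) x1).
have b2 : 0 < b / 2 by rewrite divr_gt0.
have ell_gt0 n x : -1 <= x <= 1 -> 0 < ell (q n) c x.
  move=> x1; have : 0 < normc (chebD (u n) x) ^+ 2 by rewrite exprn_gt0// normc_gt0 chebD_neq0.
  by rewrite chebD_ell// pmulr_rgt0// exprn_gt0.
have gE n x : -1 <= x <= 1 -> g n x = ln M - ln (b / 2) - 2^-1 * ln (ell (q n) c x).
  move=> x1; rewrite /g; have n0 : 0 < normc (chebD (u n) x) by rewrite normc_gt0 chebD_neq0.
  have : ln (normc (chebD (u n) x) ^+ 2) = ln (r n ^+ 2 * ell (q n) c x).
    by rewrite chebD_ell.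
  rewrite lnM ?posrE ?exprn_gt0 ?ell_gt0// !lnXn// -!(mulr_natl (ln _)) => h; lra.
have gint n : (\int[leb]_(t in D) (g n (cos t))%:E = (pi * (ln M - ln (b / 2) + ln (r n)))%:E)%E.
  have mg : measurable_fun setT (EFin \o (fun t => g n (cos t))).
    by apply/measurable_EFinP; apply: continuous_measurable_fun; exact: continuous_pm1_cos.
  rewrite integral_setD1//; last exact: measurable_funTS.
  rewrite cos_integralE// /g; congr EFin.
  transitivity (cos_integral (fun=> (ln M - ln (b / 2) + ln (r n))) +
    -1 * cos_integral (fun x => ln (normc (chebD (u n) x)))).
    rewrite -cos_integralZ; last exact: continuous_ln_chebD.
    rewrite -cos_integralD.
    - by apply: eq_Rintegral => t _; rewrite mulN1r.
    - by move=> x _; exact: cvg_cst.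
    - by move=> x x1; apply: cvgM; [exact: cvg_cst|exact: continuous_ln_chebD].
  by rewrite cos_integral_ln_chebD// mulr0 addr0 cos_integral_cst.
have cosDn t : D t -> c - cos t != 0.
  move=> [/= t1 t2]; rewrite subr_eq0; apply/eqP => ct; apply: t2.
  by rewrite /= ct cosK.
have ell2 t : ell 2 c (cos t) = (2 * `|c - cos t|) ^+ 2.
  by rewrite exprMn real_normK ?num_real// /ell; ring.
have glim t : D t -> (g n (cos t))%:E @[n --> \oo] --> logker M `|b * c - b * cos t|%R.
  move=> Dt; have ct := cosDn t Dt; have cta : 0 < `|c - cos t| by rewrite normr_gt0.
  have t1 : -1 <= cos t <= 1 by rewrite cos_geN1 cos_le1.
  rewrite -mulrBr normrM (gtr0_norm b0) /logker mulf_eq0 !gt_eqF//=.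
  apply: cvg_EFin; first by near=> n.
  rewrite (_ : ln M - _ = ln M - ln (b / 2) - 2^-1 * ln (ell 2 c (cos t))); last first.
    rewrite ell2 lnXn ?mulr_gt0// -(mulr_natl (ln _)) mulKf ?pnatr_eq0//.
    rewrite -addrA -opprD -lnM ?posrE ?mulr_gt0//; congr (_ - ln _); by field.
  rewrite (_ : _ \o _ = fun n => ln M - ln (b / 2) - 2^-1 * ln (ell (q n) c (cos t))); last first.
    by apply/funext => n /=; rewrite gE.
  apply: cvgB; first exact: cvg_cst.
  apply: cvgM; first exact: cvg_cst.
  apply: (@cvg_comp _ _ _ (fun n => ell (q n) c (cos t)) (@ln R)); last first.
    by apply: continuous_ln; rewrite ell2 exprn_gt0// mulr_gt0.
  have -> : (fun n => ell (q n) c (cos t)) = fun n => q n * q n - q n * (4 * c * cos t) + (4 * cos t ^+ 2 - 4 + 4 * c ^+ 2).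
    by apply/funext => n; rewrite /ell; ring.
  rewrite (_ : ell 2 c (cos t) = 2 * 2 - 2 * (4 * c * cos t) + (4 * cos t ^+ 2 - 4 + 4 * c ^+ 2)); last by rewrite /ell; ring.
  apply: cvgD; last exact: cvg_cst.
  by apply: cvgB; apply: cvgM => //; exact: cvg_cst.
transitivity (\int[leb]_(t in D) limn (fun n => (g n (cos t))%:E))%E.
  by apply: eq_integral => t; rewrite inE => Dt; apply/esym/cvg_lim => //; exact: glim.
have mono : (\int[leb]_(t in D) limn (fun n => (g n (cos t))%:E))%E =
   limn (fun n => (\int[leb]_(t in D) (g n (cos t))%:E)%E).
  apply: (@monotone_convergence _ _ _ leb D mD (fun n t => (g n (cos t))%:E)).
  - move=> n; apply/measurable_EFinP; apply: measurable_funTS.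
    by apply: continuous_measurable_fun; exact: continuous_pm1_cos.
  - move=> n t _; have t1 : -1 <= cos t <= 1 by rewrite cos_geN1 cos_le1.
    rewrite lee_fin gE// subr_ge0.
    have : ell (q n) c (cos t) <= (2 * M / b) ^+ 2.
      apply: (@le_trans _ _ ((9 / 2) ^+ 2)).
        exact: ell_le.
      rewrite ler_pXn2r ?nnegrE ?divr_ge0 ?mulr_ge0 ?(ltW M0) ?(ltW b0)//.
      rewrite ler_pdivlMr//; lra.
    rewrite -ler_ln ?posrE ?ell_gt0 ?exprn_gt0 ?divr_gt0 ?mulr_gt0// lnXn ?divr_gt0 ?mulr_gt0//.
    rewrite (_ : 2 * M / b = M / (b / 2)); last by field; rewrite gt_eqF.
    by rewrite ln_div ?posrE// -(mulr_natl (_ - _)) => ?; lra.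
  - move=> t _ m n mn; have t1 : -1 <= cos t <= 1 by rewrite cos_geN1 cos_le1.
    rewrite lee_fin !gE// lerB// ler_pM2l// ler_ln ?posrE ?ell_gt0//.
    by apply: ell_mono => //; exact: qle.
rewrite mono; apply/cvg_lim => //.
under eq_fun do rewrite gint.
apply: cvg_EFin; first by near=> n.
apply: cvgM; first exact: cvg_cst.
have cl : ln (r n) @[n --> \oo] --> (0 : R).
  by rewrite -(@ln1 R); apply: cvg_comp cvgr (continuous_ln ltr01).
rewrite -[X in _ --> X]addr0; apply: cvgD cl; exact: cvg_cst.
Unshelve. all: by end_near. Qed.

End ArcsinePotentialOnSegment.

(** * Improper integrals and measures with a density *)

Section FundamentalTheorem.
Context {R : realType}.
Local Notation leb := (@lebesgue_measure R).
Implicit Types (f F : R -> R) (a b : R).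

Lemma FTC_cc f F a b : a < b ->
  (forall x, x \in `[a, b] -> {for x, continuous f}) ->
  (forall x, x \in `[a, b] -> is_derive x (1 : R) F (f x)) ->
  (\int[leb]_(x in `[a, b]) (f x)%:E = (F b - F a)%:E)%E.
Proof.
move=> ab cf dF.
have cF x : x \in `[a, b] -> {for x, continuous F}.
  by move=> /dF; exact: is_derive_cvg.
have [aa bb] : a \in `[a, b] /\ b \in `[a, b] by rewrite !in_itv/= !lexx !ltW.
rewrite (@continuous_FTC2 _ f F)//.
- apply/continuous_within_itvP => //; split.
  + by move=> x xab; apply: cf; exact: subset_itv_oo_cc.
  + exact/cvg_at_right_filter/cf.
  + exact/cvg_at_left_filter/cf.
- split.
  + by move=> x xab; case: (dF x (subset_itv_oo_cc xab)).
  + exact/cvg_at_right_filter/cF.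
  + exact/cvg_at_left_filter/cF.
- by move=> x xab; rewrite derive1E; case: (dF x (subset_itv_oo_cc xab)).
Qed.

(** Improper integrals of nonnegative functions, by exhausting the open
    interval by compact ones: [F] needs only one-sided limits at the ends. *)
Lemma ge0_FTC_oo f F a b (la lb : R) : a < b ->
  (forall x, x \in `]a, b[ -> 0 <= f x) ->
  (forall x, x \in `]a, b[ -> {for x, continuous f}) ->
  (forall x, x \in `]a, b[ -> is_derive x (1 : R) F (f x)) ->
  F x @[x --> a^'+] --> la -> F x @[x --> b^'-] --> lb ->
  (\int[leb]_(x in `]a, b[) (f x)%:E = (lb - la)%:E)%E.
Proof.
move=> ab f0 cf dF Fa Fb.
pose d n : R := (b - a) / 3 * harmonic n.
have ba0 : 0 < (b - a) / 3 by rewrite divr_gt0// subr_gt0.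
have d0 n : 0 < d n by rewrite mulr_gt0// harmonic_gt0.
have dle (m n : nat) : (m <= n)%N -> d n <= d m.
  by move=> mn; rewrite ler_pM2l// lef_pV2 ?posrE ?ltr0n// ler_nat.
have d3 n : d n <= (b - a) / 3.
  by apply: le_trans (dle 0 n _) _; rewrite // /d /= invr1 mulr1.
have cd : d n @[n --> \oo] --> (0 : R).
  rewrite -[X in _ --> X](mulr0 ((b - a) / 3)); apply: cvgM; [exact: cvg_cst|exact: cvg_harmonic].
pose S n := `[a + d n, b - d n]%classic : set R.
have Sab : \bigcup_n S n = `]a, b[%classic.
  rewrite eqEsubset; split => x.
    by move=> [n _]; rewrite /S /= !in_itv/= => /andP[h1 h2]; have := d0 n; lra.
  rewrite /= in_itv/= => /andP[ax xb].
  have m0 : 0 < Num.min (x - a) (b - x) by rewrite lt_min !subr_gt0 ax xb.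
  have /cvgr_lt/(_ _ m0)[n _ /(_ n (leqnn n)) /=] := cd.
  rewrite lt_min => /andP[h1 h2]; exists n => //.
  by rewrite /S /= in_itv/=; lra.
have Ssub n x : x \in `[a + d n, b - d n] -> x \in `]a, b[.
  by rewrite !in_itv/= => /andP[h1 h2]; have := d0 n; lra.
have int n : (\int[leb]_(x in S n) (f x)%:E = (F (b - d n) - F (a + d n))%:E)%E.
  have lt_n : a + d n < b - d n by have := d3 n; lra.
  have cn x : x \in `[a + d n, b - d n] -> {for x, continuous f} by move=> /Ssub; exact: cf.
  have dn x : x \in `[a + d n, b - d n] -> is_derive x (1 : R) F (f x) by move=> /Ssub; exact: dF.
  have h := FTC_cc lt_n cn dn.
  by rewrite /S h.
have mf : measurable_fun `]a, b[ f.
  by apply: open_continuous_measurable_fun => // x; rewrite inE; exact: cf.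
have : (\int[leb]_(x in S n) (f x)%:E)%E @[n --> \oo] --> (\int[leb]_(x in `]a, b[) (f x)%:E)%E.
  rewrite -Sab; apply: (@ge0_nondecreasing_set_cvg_integral _ (measurableTypeR R) R S (fun x => (f x)%:E) leb).
  - move=> m n mn; rewrite subsetEset => x; rewrite /S /= !in_itv/= => /andP[h1 h2].
    by have := dle _ _ mn; lra.
  - by move=> n; exact: measurable_itv.
  - move=> n; apply/measurable_EFinP; apply: measurable_funS mf => // x.
    exact: Ssub.
  - by move=> n x /Ssub ?; rewrite lee_fin f0.
under eq_fun do rewrite int.
move=> /(cvg_unique (@ereal_hausdorff R)); apply.
apply: cvg_EFin; first by near=> n.
apply: cvgB.
- move/cvg_at_leftP : Fb; apply; split.
    by move=> n; rewrite gtrBl.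
  rewrite -[X in _ --> X]subr0; apply: cvgB => //; exact: cvg_cst.
- move/cvg_at_rightP : Fa; apply; split.
    by move=> n; rewrite ltrDl.
  rewrite -[X in _ --> X]addr0; apply: cvgD => //; exact: cvg_cst.
Unshelve. all: by end_near. Qed.

End FundamentalTheorem.

Section AcosEndpoints.
Context {R : realType}.

Lemma acos_cvg_left1 : @acos R x @[x --> 1^'-] --> (0 : R).
Proof.
apply/cvgrPdist_lt => e e0.
pose e' := Num.min e pi.
have p0 := pi_gt0 R.
have e'0 : 0 < e' by rewrite lt_min e0.
have e'pi : e' <= pi by rewrite ge_min lexx orbT.
have c1 : cos e' < 1.
  by rewrite -(@cos0 R) ltr_cos// in_itv/= ?lexx ?(ltW p0)// (ltW e'0).
near=> x.
have x1 : -1 <= x <= 1.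
  apply/andP; split; last by near: x; exact: nbhs_left_le.
  by near: x; apply: nbhs_left_ge; rewrite ltrN11.
rewrite sub0r normrN ger0_norm ?acos_ge0//.
apply: (@lt_le_trans _ _ e'); last by rewrite ge_min lexx.
rewrite -ltr_cos ?in_itv/= ?acos_ge0 ?acos_lepi ?(ltW e'0)//.
rewrite acosK ?in_itv//=.
Unshelve. all: by end_near. Qed.

Lemma acos_cvg_rightN1 : @acos R x @[x --> (-1)^'+] --> (pi : R).
Proof.
have h : @acos R (- x) @[x --> (-1)^'+] --> (0 : R).
  exact/(@cvg_at_leftNP _ _ (@acos R))/acos_cvg_left1.
have : pi - @acos R (- x) @[x --> (-1)^'+] --> (pi - 0 : R).
  by apply: cvgB => //; exact: cvg_cst.
rewrite subr0; apply: cvg_trans; apply: near_eq_cvg; near=> x.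
have x1 : -1 <= x <= 1.
  apply/andP; split; first by near: x; exact: nbhs_right_ge.
  by near: x; apply: nbhs_right_le; rewrite ltrN11.
by rewrite acosN// opprB addrC subrK.
Unshelve. all: by end_near. Qed.

End AcosEndpoints.

Section DensityMeasure.
Context d (T : measurableType d) (R : realType) (mu : {measure set T -> \bar R}).
Variables (f : T -> R) (f0 : forall x, 0 <= f x) (mf : measurable_fun setT f).
Local Open Scope ereal_scope.

(** The proofs are arguments so that the measure structure can be attached to
    the function of sets. *)
Definition density_measure of (forall x, 0 <= f x)%R & measurable_fun setT f :=
  fun A : set T => \int[mu]_(x in A) (f x)%:E.

Local Notation dens := (density_measure f0 mf).

Let dens0 : dens set0 = 0. Proof. by rewrite /density_measure integral_set0. Qed.

Let dens_ge0 A : 0 <= dens A.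
Proof. by apply: integral_ge0 => x _; rewrite lee_fin. Qed.

Let mfE : measurable_fun setT (EFin \o f).
Proof. exact/measurable_EFinP. Qed.

Let dens_sigma_additive : semi_sigma_additive dens.
Proof.
move=> /= F mF tF mUF; rewrite /density_measure; apply: cvg_toP.
  apply: ereal_nondecreasing_is_cvgn => m n mn.
  apply: lee_sum_nneg_natr => // k _ _.
  exact: dens_ge0.
rewrite ge0_integral_bigcup//=.
- exact: measurable_funTS.
- by move=> x _; rewrite lee_fin.
Qed.

HB.instance Definition _ := isMeasure.Build _ _ _ dens
  dens0 dens_ge0 dens_sigma_additive.

Let integral_dens_indic E : measurable E ->
  \int[dens]_x (\1_E x)%:E = \int[mu]_x ((f x)%:E * (\1_E x)%:E).
Proof.
move=> mE; rewrite integral_indic//= setIT /density_measure integral_mkcond.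
apply: eq_integral => x _; rewrite patchE indicE.
by case: (x \in E); rewrite ?mule1 ?mule0.
Qed.

Import HBNNSimple.

Let integral_dens_nnsfun (g : {nnsfun T >-> R}) :
  \int[dens]_x (g x)%:E = \int[mu]_x ((f x)%:E * (g x)%:E).
Proof.
have mI (r : R) : measurable_fun setT (fun x => (\1_(g @^-1` [set r]) x)%:E : \bar R).
  exact/measurable_EFinP/measurable_indic.
have I0 (r : R) x : 0 <= (\1_(g @^-1` [set r]) x)%:E :> \bar R by rewrite lee_fin.
under [LHS]eq_integral do rewrite fimfunE -fsumEFin//.
rewrite [LHS]ge0_integral_fsum//; last 2 first.
  - by move=> r; apply/measurable_EFinP; exact: measurable_funM.
  - by move=> n x _; rewrite EFinM nnfun_muleindic_ge0.
under [RHS]eq_integral.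
  move=> x xD; rewrite fimfunE -fsumEFin// ge0_mule_fsumr; last first.
    by move=> r; rewrite EFinM nnfun_muleindic_ge0.
  over.
rewrite [RHS]ge0_integral_fsum//; last 2 first.
  - move=> r; apply: emeasurable_funM => //.
    by apply/measurable_EFinP; exact: measurable_funM.
  - by move=> n x _; apply: mule_ge0; [rewrite lee_fin|rewrite EFinM nnfun_muleindic_ge0].
apply: eq_fsbigr => r; rewrite inE => -[x _ gxr].
have r0 : (0 <= r)%R by rewrite -gxr.
under [LHS]eq_integral do rewrite EFinM.
under [RHS]eq_integral do rewrite EFinM muleCA.
rewrite !ge0_integralZl//.
- by rewrite integral_dens_indic.
- exact: emeasurable_funM.
- by move=> y _; apply: mule_ge0; rewrite ?lee_fin.
Qed.

Lemma integral_density (g : T -> \bar R) : measurable_fun setT g ->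
  (forall x, 0 <= g x) -> \int[dens]_x g x = \int[mu]_x ((f x)%:E * g x).
Proof.
move=> mg g0; pose g_ := nnsfun_approx measurableT mg.
have cg x : (g_ n x)%:E @[n --> \oo] --> g x by exact: cvg_nnsfun_approx.
transitivity (limn (fun n => \int[dens]_x (g_ n x)%:E)).
  rewrite -monotone_convergence//=.
  - by apply: eq_integral => x _; apply/esym/cvg_lim => //; exact: cg.
  - by move=> n; exact/measurable_EFinP/measurable_funTS.
  - by move=> n x _; rewrite lee_fin.
  - by move=> x _ m n mn; rewrite lee_fin; exact/lefP/nd_nnsfun_approx.
under eq_fun do rewrite integral_dens_nnsfun.
rewrite -monotone_convergence//=.
- apply: eq_integral => x _; apply/cvg_lim => //.
  by apply: cvgeZl => //; exact: cg.
- move=> n; apply: emeasurable_funM => //.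
  by apply/measurable_EFinP; exact: measurable_funTS.
- by move=> n x _; rewrite mule_ge0 ?lee_fin.
- by move=> x _ m n mn; apply: lee_wpmul2l; rewrite lee_fin//; exact/lefP/nd_nnsfun_approx.
Unshelve. all: by end_near. Qed.

End DensityMeasure.

(** * The arcsine law and Archimedes' hat-box theorem *)

Section MeasureRays.
Context {R : realType}.

Lemma measure_eq_rays (m1 m2 : {measure set (measurableTypeR R) -> \bar R}) :
  (m1 setT < +oo)%E -> (forall x : R, m1 `]x, +oo[%classic = m2 `]x, +oo[%classic) ->
  forall A, measurable A -> m1 A = m2 A.
Proof.
move=> fin rays A mA.
apply: (@measure_unique _ R (measurableTypeR R) (@RGenOInfty.G R) (fun k => `](- k%:R), +oo[%classic)) => //.
- exact: RGenOInfty.measurableE.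
- move=> _ _ [x ->] [y ->]; exists (Num.max x y).
  rewrite eqEsubset; split => z /=; rewrite !in_itv/= !andbT gt_max.
    by case=> -> ->.
  by move=> /andP[].
- by move=> k; eexists.
- rewrite eqEsubset; split => // x _; exists (Num.truncn `|x|).+1 => //=.
  rewrite in_itv/= andbT ltrNl (le_lt_trans (ler_norm _))// normrN.
  exact: truncnS_gt.
- by move=> _ [x ->].
- by move=> k; apply: le_lt_trans fin; apply: le_measure; rewrite ?inE.
Qed.

End MeasureRays.

Section CosPushforward.
Context {R : realType}.
Local Notation leb := (@lebesgue_measure R).
Implicit Types (a x : R).

(** As the square root of a negative number is [0], and so is its inverse,
    [arcsine_weight (a^2 - x^2)] is the unnormalized arcsine density extended
    by [0] off [-a, a]. *)
Definition arcsine_weight (q : R) : R := (Num.sqrt q)^-1.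

Lemma arcsine_weight_ge0 q : 0 <= arcsine_weight q.
Proof. by rewrite invr_ge0 sqrtr_ge0. Qed.

Lemma measurable_arcsine_weight : measurable_fun [set: R] arcsine_weight.
Proof.
have -> : arcsine_weight = fun q : R => Num.sqrt q `^ (-1).
  by apply/funext => q; rewrite powR_inv1// sqrtr_ge0.
apply: (measurableT_comp (measurable_powR _)).
by apply: continuous_measurable_fun; exact: sqrt_continuous.
Qed.

Lemma measurable_sqr_weight a :
  measurable_fun [set: R] (fun x => arcsine_weight (a ^+ 2 - x ^+ 2)).
Proof.
apply: (measurableT_comp measurable_arcsine_weight).
by apply: measurable_funB => //; exact: measurable_funX.
Qed.

Lemma arcsine_weight_eq0 a x : 0 < a -> ~~ (- a < x < a) ->
  arcsine_weight (a ^+ 2 - x ^+ 2) = 0.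
Proof.
move=> a0 xa; rewrite /arcsine_weight ler0_sqrtr ?invr0// subr_le0.
move: xa; rewrite -ltr_norml -leNgt => ax.
by rewrite -[x ^+ 2]real_normK ?num_real// ler_pXn2r ?nnegrE// ltW.
Qed.

Lemma integral_arcsine_weight_ray a x : 0 < a -> - a <= x < a ->
  (\int[leb]_(y in `]x, a[) (arcsine_weight (a ^+ 2 - y ^+ 2))%:E = (acos (x / a))%:E)%E.
Proof.
move=> a0 /andP[ax xa].
have qgt0 y : y \in `]x, a[ -> 0 < a ^+ 2 - y ^+ 2.
  rewrite in_itv/= => /andP[xy ya]; nra.
have y1 y : y \in `]x, a[ -> -1 < y / a < 1.
  rewrite in_itv/= => /andP[xy ya]; apply/andP; split.
    by rewrite ltr_pdivlMr// mulN1r (le_lt_trans ax).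
  by rewrite ltr_pdivrMr// mul1r.
pose f y := arcsine_weight (a ^+ 2 - y ^+ 2); pose F (y : R) := - acos (y / a).
have f0 y : y \in `]x, a[ -> 0 <= f y by move=> _; exact: arcsine_weight_ge0.
have cf y : y \in `]x, a[ -> {for y, continuous f}.
  move=> yxa; apply: cvgV; first by rewrite gt_eqF// sqrtr_gt0 qgt0.
  apply: (@continuous_comp R R R (fun y => a ^+ 2 - y ^+ 2) (@Num.sqrt R)).
    by apply: cvgB; [exact: cvg_cst|exact: exprn_continuous].
  exact: sqrt_continuous.
have dF y : y \in `]x, a[ -> is_derive y (1 : R) F (f y).
  move=> yxa; have y1' := y1 _ yxa.
  have dac := @is_derive1_acos R _ y1'.
  have dl : is_derive y (1 : R) (fun y : R => y / a) a^-1.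
    rewrite (_ : (fun y => y / a) = a^-1 *: id); last first.
      by apply/funext => z; rewrite /GRing.scale/= mulrC.
    by apply: is_derive_eq; rewrite /GRing.scale/= mulr1.
  have dc : is_derive y (1 : R) (- (@acos R \o (fun y : R => y / a)))
      (- (- (Num.sqrt (1 - (y / a) ^+ 2))^-1 * a^-1)).
    by apply: is_deriveN.
  apply: (is_derive_eq dc).
  rewrite mulNr opprK -invfM /f /arcsine_weight; congr (_^-1).
  have -> : a ^+ 2 - y ^+ 2 = (1 - (y / a) ^+ 2) * a ^+ 2.
    by field; rewrite gt_eqF.
  by rewrite sqrtrM ?sqrtr_sqr ?gtr0_norm//; nra.
have Fl : F y @[y --> x^'+] --> - acos (x / a).
  apply: cvgN.
  move: ax; rewrite le_eqVlt => /predU1P[<-|ax].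
    rewrite mulNr divff ?gt_eqF// acosN1.
    have := @acos_cvg_rightN1 R.
    move/cvg_at_rightP => h; apply/cvg_at_rightP => u [u1 u2].
    apply: (h (fun n => u n / a)); split.
      by move=> n; rewrite ltr_pdivlMr// mulN1r.
    rewrite -(@divff _ a) ?gt_eqF// -mulNr; apply: cvgM => //; exact: cvg_cst.
  apply: cvg_at_right_filter.
  apply: (@continuous_comp R R R (fun y => y / a) (@acos R)).
    by apply: cvgM; [exact: cvg_id|exact: cvg_cst].
  apply: continuous_acos; apply/andP; split.
    by rewrite ltr_pdivlMr// mulN1r.
  by rewrite ltr_pdivrMr// mul1r.
have Fr : F y @[y --> a^'-] --> - (0 : R).
  apply: cvgN.
  have := @acos_cvg_left1 R.
  move/cvg_at_leftP => h; apply/cvg_at_leftP => u [u1 u2].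
  apply: (h (fun n => u n / a)); split.
    by move=> n; rewrite ltr_pdivrMr// mul1r.
  rewrite -(@divff _ a) ?gt_eqF//; apply: cvgM => //; exact: cvg_cst.
by rewrite (ge0_FTC_oo xa f0 cf dF Fl Fr) oppr0 sub0r opprK.
Qed.

(** The cosine decreases on [[0, pi]], hence its superlevel sets are
    intervals. *)
Lemma cos_superlevel c : -1 <= c <= 1 ->
  `]0, pi[ `&` [set t : R | c < cos t] = `]0, acos c[%classic.
Proof.
move=> c1; have [h0 hpi] := (acos_ge0 c1, acos_lepi c1).
rewrite eqEsubset; split => t /=; rewrite !in_itv/=.
  move=> [/andP[t0 tpi] ct]; rewrite t0/=.
  by rewrite -ltr_cos ?in_itv/= ?h0 ?hpi ?(ltW t0) ?(ltW tpi)// acosK// in_itv.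
move=> /andP[t0 tc]; have tpi := lt_le_trans tc hpi; rewrite t0 tpi; split => //.
by rewrite -[c]acosK ?in_itv// ltr_cos// in_itv/= ?h0 ?hpi ?(ltW t0) ?(ltW tpi).
Qed.

Lemma leb_cos_superlevel a x : 0 < a -> - a <= x < a ->
  leb (`]0, pi[ `&` [set t : R | x < a * cos t]) = (acos (x / a))%:E.
Proof.
move=> a0 /andP[ax xa].
have x1 : -1 <= x / a <= 1.
  by rewrite ler_pdivlMr// mulN1r ax ler_pdivrMr// mul1r ltW.
rewrite (_ : [set t | _] = [set t : R | x / a < cos t]); last first.
  by apply/seteqP; split => t /=; rewrite ltr_pdivrMr// mulrC.
rewrite cos_superlevel// lebesgue_measure_itv/= lte_fin.
case: ifPn => [_|]; first by rewrite oppr0 adde0.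
rewrite -leNgt => h; have := acos_ge0 x1 => h'.
by congr EFin; apply/eqP; rewrite eq_le h h'.
Qed.

Lemma measurable_cos : measurable_fun [set: R] (@cos R).
Proof. by apply: continuous_measurable_fun; exact: continuous_cos. Qed.

Lemma measurable_acos_cos a : measurable_fun [set: R] (fun t => a * cos t).
Proof. by apply: measurable_funM => //; exact: measurable_cos. Qed.

(** The law of [a cos t], for [t] uniform, is the arcsine law: both sides are
    integrals for finite measures that agree on the half-lines, as [acos] is a
    primitive of the weight. *)
Lemma cos_pushforward a (f : R -> \bar R) : 0 < a ->
  measurable_fun [set: R] f -> (forall x, (0 <= f x)%E) ->
  (\int[leb]_(t in `]0%R, pi[) f (a * cos t)%R =
   \int[leb]_x ((arcsine_weight (a ^+ 2 - x ^+ 2)%R)%:E * f x))%E.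
Proof.
move=> a0 mf f0.
pose I : R -> R := \1_(`]0, pi[%classic).
have I0 t : 0 <= I t by [].
have mI : measurable_fun [set: R] I by exact: measurable_indic.
have w0 x : 0 <= arcsine_weight (a ^+ 2 - x ^+ 2) by exact: arcsine_weight_ge0.
have mw := measurable_sqr_weight a.
pose n1 : {measure set (measurableTypeR R) -> \bar R} := density_measure leb I0 mI.
pose m1 : {measure set (measurableTypeR R) -> \bar R} :=
  @measure_function_pushforward__canonical__measure_function_Measure _ _
    (measurableTypeR R) (measurableTypeR R) R n1 _ (measurable_acos_cos a).
pose m2 : {measure set (measurableTypeR R) -> \bar R} := density_measure leb w0 mw.
have mT := measurable_acos_cos a.
have mpre (A : set (measurableTypeR R)) : measurable A -> measurable [set t : measurableTypeR R | A (a * cos t)].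
  by move=> mA; rewrite -[X in measurable X]setTI; exact: mT.
have m1E (A : set (measurableTypeR R)) : measurable A ->
    m1 A = leb (`]0, pi[ `&` [set t : R | A (a * cos t)]).
  move=> mA; have -> : m1 A = (\int[leb]_(t in [set t : R | A (a * cos t)%R]) (I t)%:E)%E by [].
  by rewrite /I integral_indic//; exact: mpre.
have m2E x : m2 `]x, +oo[%classic = (\int[leb]_(y in `]x, +oo[) (arcsine_weight (a ^+ 2 - y ^+ 2))%:E)%E.
  by [].
have rays_mid x : - a <= x < a -> m1 `]x, +oo[%classic = m2 `]x, +oo[%classic.
  move=> xa; rewrite m1E//.
  rewrite (_ : [set t | _] = [set t : R | x < a * cos t]); last first.
    by apply/seteqP; split => t /=; rewrite in_itv/= andbT.
  rewrite leb_cos_superlevel// m2E -integral_arcsine_weight_ray//.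
  rewrite [LHS]integral_mkcond [RHS]integral_mkcond; apply: eq_integral => y _.
  rewrite !patchE !mem_setE !in_itv/= andbT.
  case: (ltP x y) => //= xy; case: (ltP y a) => //= ya.
  by rewrite arcsine_weight_eq0// negb_and -!leNgt ya orbT.
have m12 A : measurable A -> m1 A = m2 A.
  apply: measure_eq_rays.
    have -> : m1 setT = leb `]0, pi[%classic.
      by rewrite m1E//; congr (leb _); apply/seteqP; split => t //= [].
    by rewrite lebesgue_measure_itv/= lte_fin pi_gt0 ltry.
  move=> x; have [xa|ax] := leP a x.
    rewrite m1E// m2E (_ : _ `&` _ = set0); last first.
      rewrite -subset0 => t /= [_]; rewrite in_itv/= andbT => h.
      by have := cos_le1 t; nra.
    rewrite measure0 integral0_eq// => y; rewrite /= in_itv/= andbT => xy.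
    by rewrite arcsine_weight_eq0// negb_and -!leNgt (ltW (le_lt_trans xa xy)) orbT.
  have [xa|xa] := leP (- a) x; first by rewrite rays_mid// xa.
  transitivity (m1 `]- a, +oo[%classic).
    rewrite !m1E//; congr (leb _); apply/seteqP; split => t /= [h]; rewrite !in_itv/= !andbT => h2; split => //.
      rewrite -mulrN1 ltr_pM2l// -cospi ltr_cos ?in_itv/= ?lexx ?pi_ge0//.
        by move: h; rewrite in_itv/= => /andP[].
      by move: h; rewrite in_itv/= => /andP[? ?]; rewrite !ltW.
    by rewrite (lt_trans xa).
  rewrite rays_mid ?lexx ?gtrN// !m2E.
  rewrite [LHS]integral_mkcond [RHS]integral_mkcond; apply: eq_integral => y _.
  rewrite !patchE !mem_setE !in_itv/= !andbT.
  case: (ltP (- a) y) => //= ya; first by rewrite (lt_trans xa).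
  by case: ifP => // _; rewrite arcsine_weight_eq0// negb_and -!leNgt ya.
transitivity (\int[m2]_x f x)%E; last by rewrite integral_density.
transitivity (\int[m1]_x f x)%E; last by apply: eq_measure_integral => A mA _; exact: m12.
have -> : (\int[m1]_x f x)%E = (\int[n1]_t f (a * cos t)%R)%E.
  by rewrite (@ge0_integral_pushforward _ _ (measurableTypeR R) (measurableTypeR R) R _ mT n1 setT f).
rewrite integral_density//; last first.
  exact: measurableT_comp mT.
rewrite [LHS]integral_mkcond. apply: eq_integral => t _.
by rewrite patchE /I indicE; case: ifP => _; rewrite ?mul1e ?mul0e.
Qed.



End CosPushforward.

Section Archimedes.
Context {R : realType}.
Local Notation leb := (@lebesgue_measure R).
Local Notation mR := (measurableTypeR R).

Lemma arcsine_weight_le0 (q : R) : q <= 0 -> arcsine_weight q = 0.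
Proof. by move=> q0; rewrite /arcsine_weight ler0_sqrtr ?invr0. Qed.

Lemma measurable_arcsine_weight2 : measurable_fun [set: mR * mR]
  (fun p : mR * mR => arcsine_weight (1 - p.1 ^+ 2 - p.2 ^+ 2) : mR).
Proof.
apply: (measurableT_comp measurable_arcsine_weight).
apply: measurable_funB; last by apply: measurable_funX; exact: measurable_snd.
apply: measurable_funB => //; apply: measurable_funX; exact: measurable_fst.
Qed.

(** On the half sphere, the length of the part above height [kappa] of the
    half circle with first coordinate [x]. *)
Definition cap_angle (kappa x : R) : \bar R :=
  leb (`]0, pi[ `&` [set t : R | kappa < Num.sqrt (1 - x ^+ 2) * cos t]).

(** The substitution [k = sqrt (1 - x^2) cos t] turns the length of the arc into
    an integral over the height [k]. *)
Lemma cap_angleE kappa x : 0 <= kappa ->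
  cap_angle kappa x = (\int[leb]_k ((arcsine_weight (1 - k ^+ 2 - x ^+ 2))%:E *
     (\1_(`]kappa, 1[%classic) k)%:E))%E.
Proof.
move=> kappa0; have [x1|x1] := leP (1 - x ^+ 2) 0.
  rewrite /cap_angle (_ : _ `&` _ = set0) ?measure0; last first.
    by rewrite -subset0 => t /= [_]; rewrite ler0_sqrtr// mul0r ltNge kappa0.
  rewrite integral0_eq// => k _; rewrite arcsine_weight_le0 ?mul0e//.
  by rewrite addrAC subr_le0 (le_trans x1)// sqr_ge0.
have a0 : 0 < Num.sqrt (1 - x ^+ 2) by rewrite sqrtr_gt0.
have a2 : Num.sqrt (1 - x ^+ 2) ^+ 2 = 1 - x ^+ 2 by rewrite sqr_sqrtr// ltW.
have := @cos_pushforward R _ (fun y : R => (\1_(`]kappa, +oo[%classic) y)%:E : \bar R) a0.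
move=> /(_ _ _) e; transitivity (\int[leb]_(t in `]0%R, pi[)
    (\1_(`]kappa, +oo[%classic) (Num.sqrt (1 - x ^+ 2) * cos t)%R)%:E)%E.
  rewrite /cap_angle.
  have mS : measurable ([set t | kappa < Num.sqrt (1 - x ^+ 2) * cos t] : set mR).
    rewrite (_ : [set t | _] = [set: mR] `&` (fun t => Num.sqrt (1 - x ^+ 2) * cos t) @^-1` `]kappa, +oo[); last first.
      by apply/seteqP; split => t /=; rewrite in_itv/= andbT => // -[].
    exact: measurable_acos_cos.
  rewrite setIC -integral_indic//; apply: eq_integral => t _.
  rewrite !indicE; congr ((_ : bool)%:R%:E); apply/idP/idP; rewrite !inE/= in_itv/= andbT//.
rewrite e.
- apply: eq_integral => k _; rewrite a2 addrAC.
  have [k1|k1] := ltP k 1.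
    by congr (_ * _)%E; rewrite !indicE !mem_setE !in_itv/= k1 andbT.
  rewrite arcsine_weight_le0 ?mul0e//; have := sqr_ge0 x; nra.
- by apply/measurable_EFinP/measurable_indic.
- by move=> y; rewrite lee_fin.
Qed.

Lemma measurable_cap_angle kappa : 0 <= kappa -> measurable_fun [set: mR] (cap_angle kappa).
Proof.
move=> kappa0; rewrite (_ : cap_angle kappa = fubini_G leb
   (fun p : mR * mR => ((arcsine_weight (1 - p.1 ^+ 2 - p.2 ^+ 2))%:E *
     (\1_(`]kappa, 1[%classic) p.1)%:E))%E); last first.
  by apply/funext => x; rewrite cap_angleE.
apply: measurable_fun_fubini_tonelli_G.
  apply: emeasurable_funM; apply/measurable_EFinP.
    exact: measurable_arcsine_weight2.
  have mi : measurable_fun [set: mR] (\1_(`]kappa, 1[%classic) : mR -> R) by exact: measurable_indic.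
  exact: (measurableT_comp mi measurable_fst).
by move=> p; rewrite mule_ge0 ?lee_fin// arcsine_weight_ge0.
Qed.

(** Archimedes' hat-box theorem: the half circle at height [k] is
    parametrized by the angle [t], whose image on the axis has the arcsine
    weight [(1 - k^2 - x^2)^(-1/2)].  This weight is symmetric in [k] and [x],
    and Fubini-Tonelli exchanges the two slicings. *)
Lemma archimedes kappa (f : R -> \bar R) : 0 <= kappa < 1 ->
  measurable_fun [set: mR] f -> (forall x, (0 <= f x)%E) ->
  (\int[leb]_(k in `]kappa, 1%R[) \int[leb]_(t in `]0%R, pi[)
      f (Num.sqrt (1 - k ^+ 2) * cos t)%R =
   \int[leb]_x (f x * cap_angle kappa x))%E.
Proof.
move=> /andP[kappa0 kappa1] mf f0.
pose h (p : mR * mR) := ((arcsine_weight (1 - p.1 ^+ 2 - p.2 ^+ 2))%:E *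
     (\1_(`]kappa, 1[%classic) p.1)%:E * f p.2)%E.
have mh1 : measurable_fun [set: mR * mR] (fun p : mR * mR => ((arcsine_weight (1 - p.1 ^+ 2 - p.2 ^+ 2))%:E *
     (\1_(`]kappa, 1[%classic) p.1)%:E)%E).
  apply: emeasurable_funM; apply/measurable_EFinP.
    exact: measurable_arcsine_weight2.
  have mi : measurable_fun [set: mR] (\1_(`]kappa, 1[%classic) : mR -> R) by exact: measurable_indic.
  exact: (measurableT_comp mi measurable_fst).
have mh : measurable_fun [set: mR * mR] h.
  apply: emeasurable_funM => //.
  exact: (measurableT_comp mf measurable_snd).
have h0 p : (0 <= h p)%E by rewrite !mule_ge0 ?lee_fin// arcsine_weight_ge0.
transitivity (\int[leb]_k \int[leb]_x h (k, x))%E.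
  rewrite [LHS]integral_mkcond; apply: eq_integral => k _; rewrite patchE.
  have [k1|k1] := boolP (k \in `]kappa, 1[%classic); last first.
    rewrite integral0_eq// => x _; rewrite /h /= indicE (negbTE k1).
    by rewrite mule0 mul0e.
  move: (k1); rewrite inE/= in_itv/= => /andP[kk1 kk2].
  have a0 : 0 < 1 - k ^+ 2 by nra.
  have mw x : (0 <= (arcsine_weight x)%:E)%E by rewrite lee_fin arcsine_weight_ge0.
  rewrite cos_pushforward ?sqrtr_gt0// sqr_sqrtr ?(ltW a0)//.
  by apply: eq_integral => x _; rewrite /h /= indicE k1 mule1.
rewrite (@fubini_tonelli _ _ mR mR R leb leb h)//.
apply: eq_integral => x _; rewrite /h /= cap_angleE//.
under eq_integral do rewrite muleC.
rewrite ge0_integralZl//.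
- exact: (measurableT_comp mh1 (measurable_pair2 x)).
- by move=> y _; rewrite mule_ge0 ?lee_fin// arcsine_weight_ge0.
Qed.

End Archimedes.

(** * Mixtures of arcsine laws *)

Section LogPotential.
Context {R : realType}.
Local Notation mR := (measurableTypeR R).
Implicit Types (m : {measure set mR -> \bar R}) (z : R[i]).

(** The integral of [f] may be infinite, so this is not an instance of the
    linearity of the integral of integrable functions. *)
Lemma integralB_cst m (D : set mR) (f : mR -> \bar R) (c : R) : measurable D ->
  (m D < +oo)%E -> measurable_fun D f -> (forall x, D x -> 0 <= f x)%E -> 0 <= c ->
  (\int[m]_(x in D) (f x - c%:E) = \int[m]_(x in D) f x - c%:E * m D)%E.
Proof.
move=> mD Dfin mf f0 c0.
have ic : m.-integrable D (EFin \o cst c).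
  apply/integrableP; split; first by apply/measurable_EFinP.
  rewrite (eq_integral (cst c%:E)); last by move=> x _ /=; rewrite ger0_norm.
  by rewrite integral_cst// lte_mul_pinfty.
have [foo|] := ltP (\int[m]_(x in D) f x)%E +oo%E.
  have If : m.-integrable D f.
    apply/integrableP; split => //; apply: le_lt_trans foo.
    by apply: ge0_le_integral => //; [exact: measurableT_comp|move=> x Dx; rewrite gee0_abs ?f0].
  by rewrite integralB// integral_cst.
rewrite leye_eq => /eqP foo; rewrite foo.
have cD : (c%:E * m D)%E \is a fin_num.
  by rewrite fin_numM// ge0_fin_numE.
rewrite addye ?fin_num_eqNyN//; last by case: (c%:E * m D)%E cD.
pose g x := (f x - c%:E)%E.
have mg : measurable_fun D g by apply: emeasurable_funB => //; exact: measurable_cst.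
rewrite -/g integralE.
have gn : (\int[m]_(x in D) g^\- x < +oo)%E.
  apply: (@le_lt_trans _ _ (\int[m]_(x in D) c%:E)%E); last first.
    by rewrite integral_cst// ltey_eq cD.
  apply: ge0_le_integral => //.
  - exact: measurable_funeneg.
  - move=> x Dx; rewrite funenegE /g oppeB ?fin_num_adde_defl// ge_max; apply/andP; split; last by rewrite lee_fin.
    by rewrite addeC; apply: geeDl; rewrite oppe_le0 f0.
have gp : (\int[m]_(x in D) g^\+ x = +oo)%E.
  apply/eqP; rewrite -leye_eq leNgt; apply/negP => gp.
  suff : (\int[m]_(x in D) f x < +oo)%E by rewrite foo ltxx.
  apply: (@le_lt_trans _ _ (\int[m]_(x in D) (g^\+ x + c%:E))%E).
    apply: ge0_le_integral => //.
    - by apply: emeasurable_funD => //; exact: measurable_funepos.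
    - move=> x Dx; rewrite funeposE /g -leeBlDr//.
      by rewrite le_max lexx.
  rewrite ge0_integralD//; last exact: measurable_funepos.
  by rewrite lte_add_pinfty// integral_cst// ltey_eq cD.
by rewrite gp addye// eqe_oppLR; move: gn; rewrite lt_neqAle => /andP[].
Qed.

Definition logkerz (M : R) z (x : R) : \bar R := logker M (normc (x%:C - z)).

Lemma measurable_logker_normc (M : R) z :
  measurable_fun [set: mR] (logkerz M z).
Proof.
apply: (measurableT_comp (measurable_logker M)).
have -> : (fun x : mR => normc (x%:C - z)) =
    (fun x : R => Num.sqrt ((x - complex.Re z) ^+ 2 + complex.Im z ^+ 2)).
  apply/funext => x; rewrite normcE ReD ImD ReN ImN /=.
  by rewrite sub0r sqrrN.
apply: continuous_measurable_fun => x.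
apply: (@continuous_comp R R R (fun x => (x - complex.Re z) ^+ 2 + complex.Im z ^+ 2) (@Num.sqrt R)); last exact: sqrt_continuous.
apply: cvgD; last exact: cvg_cst.
apply: (@continuous_comp R R R (fun x => x - complex.Re z) (fun x => x ^+ 2)); last exact: exprn_continuous.
by apply: cvgB; [exact: cvg_id|exact: cvg_cst].
Qed.

Lemma log_potentialE m z (M : R) : m `[-1, 1]%classic = 1%E ->
  m (~` `[-1, 1]%classic) = 0%E -> 1 <= M ->
  (forall x : R, -1 <= x <= 1 -> normc (x%:C - z) <= M) ->
  (log_potential m z =
   \int[m]_(x in `[(-1)%R, 1%R]) logkerz M z x - (ln M)%:E)%E.
Proof.
move=> m1 m0 M1 zM.
have lM : 0 <= ln M by rewrite ln_ge0.
pose g (x : mR) := (logkerz M z x - (ln M)%:E)%E.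
have gE x : (- lne (normc (x%:C - z)%R)%:E)%E = g x.
  rewrite /g /logkerz logkerE ?normc_ge0//.
  case: (lne _) => [r| |] //=.
  by rewrite -!EFinB; congr EFin; ring.
have mg : measurable_fun [set: mR] g.
  by apply: emeasurable_funB => //; exact: measurable_logker_normc.
rewrite /log_potential; under eq_integral do rewrite gE.
transitivity (\int[m]_(x in `[(-1)%R, 1%R]) g x)%E.
  rewrite [RHS]integral_mkcond; apply: ae_eq_integral => //.
    exact/(measurable_restrictT g)/measurable_funTS.
  exists (~` `[-1, 1]%classic); split => //; first exact: measurableC.
  move=> x /=; apply: contra_not => x1 _.
  by rewrite patchE mem_set.
rewrite integralB_cst//.
- by rewrite m1 mule1.
- by rewrite m1 ltry.
- by apply: measurable_funTS; exact: measurable_logker_normc.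
- by move=> x; rewrite /= in_itv/= => /zM ?; rewrite /logkerz logker_ge0 ?normc_ge0.
Qed.

End LogPotential.

Section CapMeasure.
Context {R : realType}.
Local Notation leb := (@lebesgue_measure R).
Local Notation mR := (measurableTypeR R).
Implicit Types (kappa x : R).

Lemma leb_0pi : leb `]0, pi[%classic = pi%:E.
Proof. by rewrite lebesgue_measure_itv/= lte_fin pi_gt0 oppr0 adde0. Qed.

Lemma measurable_superlevel (a c : R) : measurable ([set t | c < a * cos t] : set mR).
Proof.
rewrite (_ : [set t | _] = [set: mR] `&` (fun t => a * cos t) @^-1` `]c, +oo[); last first.
  by apply/seteqP; split => t /=; rewrite in_itv/= andbT => // -[].
exact: measurable_acos_cos.
Qed.

Lemma cap_angle_le kappa x : (0 <= cap_angle kappa x <= pi%:E)%E.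
Proof.
rewrite measure_ge0 -leb_0pi /=; apply: le_measure; rewrite ?inE//.
by apply: measurableI => //; exact: measurable_superlevel.
Qed.

Lemma cap_angle_fin kappa x : cap_angle kappa x \is a fin_num.
Proof.
have /andP[a0 api] := cap_angle_le kappa x.
by rewrite ge0_fin_numE// (le_lt_trans api)// ltry.
Qed.

Lemma cap_angle_acos kappa x : 0 <= kappa -> x ^+ 2 < 1 - kappa ^+ 2 ->
  cap_angle kappa x = (acos (kappa / Num.sqrt (1 - x ^+ 2)))%:E.
Proof.
move=> kappa0 x2.
have a0 : 0 < 1 - x ^+ 2 by have := sqr_ge0 kappa; lra.
rewrite /cap_angle leb_cos_superlevel ?sqrtr_gt0//; apply/andP; split.
  by rewrite (le_trans _ kappa0)// oppr_le0 sqrtr_ge0.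
by rewrite -[kappa]ger0_norm// -sqrtr_sqr ltr_sqrt//; lra.
Qed.

Lemma cap_angle0 kappa x : 0 <= kappa -> 1 - kappa ^+ 2 <= x ^+ 2 ->
  cap_angle kappa x = 0%E.
Proof.
move=> kappa0 x2; rewrite /cap_angle (_ : _ `&` _ = set0) ?measure0//.
rewrite -subset0 => t /= [_].
suff : Num.sqrt (1 - x ^+ 2) <= kappa.
  have := cos_le1 t; have := cos_geN1 t; have := sqrtr_ge0 (1 - x ^+ 2).
  move: (Num.sqrt _) (cos t) => s c s0 c0 c1 sk h; clear -s0 c1 sk h; nra.
by rewrite -[kappa]ger0_norm// -sqrtr_sqr ler_wsqrtr//; lra.
Qed.

(** The total angle over all [x] is [pi (1 - kappa)], by [archimedes] applied to
    the constant [1]. *)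
Definition cap_density kappa x : R := fine (cap_angle kappa x) / (pi * (1 - kappa)).

Lemma cap_density_ge0 kappa : kappa < 1 -> forall x, 0 <= cap_density kappa x.
Proof.
move=> kappa1 x; apply: divr_ge0.
  by apply: fine_ge0; have /andP[] := cap_angle_le kappa x.
by rewrite mulr_ge0 ?pi_ge0// subr_ge0 ltW.
Qed.

Lemma measurable_cap_density kappa : 0 <= kappa ->
  measurable_fun [set: mR] (cap_density kappa).
Proof.
move=> kappa0; apply: measurable_funM => //.
apply: (@measurableT_comp _ _ _ _ _ _ (@fine R)) => //.
exact: measurable_cap_angle.
Qed.

Section CapMeasureDef.
Variables (kappa : R) (kappa0 : 0 <= kappa) (kappa1 : kappa < 1).

Definition cap_measure : {measure set mR -> \bar R} :=
  density_measure leb (cap_density_ge0 kappa1) (measurable_cap_density kappa0).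

Lemma integral_cap (f : mR -> \bar R) : measurable_fun [set: mR] f ->
  (forall x, 0 <= f x)%E ->
  (\int[cap_measure]_x f x = ((1 - kappa)^-1)%:E *
   \int[leb]_(k in `]kappa, 1%R[) ((pi^-1)%:E * \int[leb]_(t in `]0%R, pi[)
      f (Num.sqrt (1 - k ^+ 2) * cos t)%R))%E.
Proof.
move=> mf f0; rewrite integral_density//.
have mc := measurable_cap_angle kappa0.
have c0 x : (0 <= cap_angle kappa x)%E by have /andP[] := cap_angle_le kappa x.
have k0 : 0 < 1 - kappa by rewrite subr_gt0.
have p0 := pi_gt0 R.
have mff : measurable_fun [set: mR * mR] (fun p : mR * mR => f (Num.sqrt (1 - p.1 ^+ 2) * cos p.2)).
  apply: (measurableT_comp mf); apply: measurable_funM.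
    apply: (@measurableT_comp _ _ _ _ _ _ (fun k : mR => Num.sqrt (1 - k ^+ 2))).
      apply: continuous_measurable_fun => k.
      apply: (@continuous_comp R R R (fun k => 1 - k ^+ 2) (@Num.sqrt R)); last exact: sqrt_continuous.
      by apply: cvgB; [exact: cvg_cst|exact: exprn_continuous].
    exact: measurable_fst.
  exact: (measurableT_comp measurable_cos measurable_snd).
transitivity (((pi * (1 - kappa))^-1)%:E * \int[leb]_x (f x * cap_angle kappa x))%E.
  rewrite -ge0_integralZl//; last 3 first.
  - exact: emeasurable_funM.
  - by move=> x _; rewrite mule_ge0.
  - by rewrite lee_fin invr_ge0 mulr_ge0 ?ltW.
  apply: eq_integral => x _; rewrite /cap_density EFinM fineK ?cap_angle_fin//.
  by rewrite muleAC muleC; congr (_ * _)%E; exact: muleC.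
rewrite -archimedes ?kappa0//.
rewrite invfM mulrC EFinM -muleA; congr (_ * _)%E.
rewrite ge0_integralZl//.
- pose F := fubini_F leb (fun p : mR * mR => (f (Num.sqrt (1 - p.1 ^+ 2) * cos p.2)%R * (\1_(`]0, pi[%classic) p.2)%:E)%E).
  rewrite [X in measurable_fun _ X](_ : _ = F).
    apply: measurable_funTS; apply: measurable_fun_fubini_tonelli_F.
      apply: emeasurable_funM => //; apply/measurable_EFinP.
      have mi : measurable_fun [set: mR] (\1_(`]0, pi[%classic) : mR -> R) by exact: measurable_indic.
      exact: (measurableT_comp mi measurable_snd).
    by move=> p; rewrite mule_ge0 ?lee_fin.
  apply/funext => k; rewrite /F /fubini_F [LHS]integral_mkcond; apply: eq_integral => t _.
  by rewrite patchE indicE /=; case: ifP => _; rewrite ?mule1 ?mule0.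
- by move=> k _; apply: integral_ge0 => t _.
- by rewrite lee_fin invr_ge0 ltW.
Qed.

End CapMeasureDef.

End CapMeasure.

Section ArcsinePotentials.
Context {R : realType}.
Local Notation leb := (@lebesgue_measure R).
Local Notation mR := (measurableTypeR R).
Implicit Types (k kappa x M : R) (z : R[i]).

(** The potential at [z] of the arcsine law of [[-a_k, a_k]], shifted by
    [ln M]. *)
Definition arcpot M z k : \bar R :=
  ((pi^-1)%:E * \int[leb]_(t in `]0%R, pi[) logkerz M z (Num.sqrt (1 - k ^+ 2) * cos t)%R)%E.

Lemma halfchord_gt0 k : 0 <= k < 1 -> 0 < Num.sqrt (1 - k ^+ 2).
Proof. by move=> k1; rewrite sqrtr_gt0; nra. Qed.

Lemma halfchord_le1 k : Num.sqrt (1 - k ^+ 2) <= 1.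
Proof. by rewrite -[leRHS]sqrtr1 ler_wsqrtr// gerBl sqr_ge0. Qed.

Lemma ln_halfchord k : 0 <= k < 1 ->
  ln (Num.sqrt (1 - k ^+ 2)) = (ln (1 + k) + ln (1 - k)) / 2.
Proof.
move=> k1; have a0 := halfchord_gt0 k1.
have [p q] : 0 < 1 + k /\ 0 < 1 - k by split; lra.
suff : ln (1 + k) + ln (1 - k) = 2 * ln (Num.sqrt (1 - k ^+ 2)) by lra.
rewrite -lnM ?posrE// (_ : (1 + k) * (1 - k) = 1 - k ^+ 2); last by ring.
have e : 1 - k ^+ 2 = Num.sqrt (1 - k ^+ 2) ^+ 2 by rewrite sqr_sqrtr// ltW// -sqrtr_gt0.
by rewrite [in LHS]e lnXn// mulr_natl.
Qed.

Lemma logkerz_fin M z x : x%:C - z != 0 ->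
  logkerz M z x = (ln M - ln (normc (z - x%:C)))%:E.
Proof.
move=> xz; rewrite /logkerz /logker gt_eqF ?normc_gt0//.
by rewrite -[z - _]opprB normcN.
Qed.

Lemma integral_0pi_open (f : R -> \bar R) : measurable_fun [set: mR] f ->
  (\int[leb]_(t in `]0%R, pi[) f t = \int[leb]_(t in `[0%R, pi]) f t)%E.
Proof. by move=> mf; rewrite (integral_itv_bndoo true false)//; exact: measurable_funTS. Qed.

Lemma arcpot_off M z k : 0 <= k < 1 -> ~ csegment (Num.sqrt (1 - k ^+ 2)) z ->
  arcpot M z k = (ln M - ln (normc (joukowski (Num.sqrt (1 - k ^+ 2)) z)))%:E.
Proof.
move=> k1 zk; have a0 := halfchord_gt0 k1; set a := Num.sqrt _ in zk a0 *.
have cG : continuous_pm1 (fun x => ln (normc (z - (a * x)%:C))).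
  move=> x x1.
  have h : z + (- a%:C) * x%:C != 0 by rewrite mulNr -rmorphM; exact: segment_affine_neq0.
  have := continuous_ln_normc_affine h.
  by under [X in {for _, continuous X}]eq_fun do rewrite mulNr -rmorphM.
have cF : continuous_pm1 (fun x => ln M - ln (normc (z - (a * x)%:C))).
  by move=> x x1; apply: cvgB; [exact: cvg_cst|exact: cG].
rewrite /arcpot -/a integral_0pi_open; last first.
  exact: (measurableT_comp (measurable_logker_normc M z) (measurable_acos_cos a)).
transitivity ((pi^-1)%:E * \int[leb]_(t in `[0%R, pi]) (ln M - ln (normc (z - (a * cos t)%:C)))%:E)%E.
  congr (_ * _)%E; apply: eq_integral => t _; rewrite logkerz_fin//.
  by rewrite -opprB oppr_eq0 segment_affine_neq0// cos_geN1 cos_le1.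
rewrite (@cos_integralE R (fun x => ln M - ln (normc (z - (a * x)%:C))))//.
rewrite -EFinM; congr EFin.
have -> : cos_integral (fun x : R => ln M - ln (normc (z - (a * x)%:C))) =
    pi * ln M - pi * ln (normc (joukowski a z)).
  rewrite -(arcsine_log a0 zk) -[cos_integral _ in RHS]mul1r -mulNr -cos_integralZ// -cos_integral_cst.
  rewrite -cos_integralD.
  - by apply: eq_Rintegral => t _; rewrite mulN1r.
  - by move=> x _; exact: cvg_cst.
  - by move=> x x1; apply: cvgM; [exact: cvg_cst|exact: cG].
by rewrite -mulrBr mulKf ?gt_eqF ?pi_gt0//.
Qed.

Lemma arcpot_on M x k : 0 <= k < 1 -> x ^+ 2 <= 1 - k ^+ 2 -> 9 / 4 <= M ->
  arcpot M x%:C k = (ln M - ln (Num.sqrt (1 - k ^+ 2) / 2))%:E.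
Proof.
move=> k1 xk M9; have a0 := halfchord_gt0 k1; have ale := halfchord_le1 k.
have a2 : Num.sqrt (1 - k ^+ 2) ^+ 2 = 1 - k ^+ 2.
  by rewrite sqr_sqrtr// ltW// -sqrtr_gt0.
rewrite /arcpot; set a := Num.sqrt _ in a0 ale a2 *.
rewrite integral_0pi_open; last first.
  exact: (measurableT_comp (measurable_logker_normc M x%:C) (measurable_acos_cos a)).
have c1 : -1 <= x / a <= 1.
  rewrite -ler_norml normrM normfV (gtr0_norm a0) ler_pdivrMr// mul1r.
  by rewrite -(@ler_pXn2r _ 2) ?nnegrE ?(ltW a0)// real_normK ?num_real// a2.
have bM : 9 / 4 * a <= M by lra.
transitivity ((pi^-1)%:E * \int[leb]_(t in `[0%R, pi]) logker M `|a * (x / a) - a * cos t|%R)%E.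
  congr (_ * _)%E; apply: eq_integral => t _.
  rewrite /logkerz -rmorphB normc_real distrC; congr (logker _ `|_ - _|).
  by rewrite mulrCA divff ?mulr1// gt_eqF.
rewrite arcsine_log_on// -EFinM mulrA mulVf ?mul1r// gt_eqF ?pi_gt0//.
Qed.

(** Outside the segment the potential is [- ln |p|] with [|p|] larger than half
    of the half-length ([joukowski_gt]). *)
Lemma arcpot_le M x k : 0 <= k < 1 -> 9 / 4 <= M ->
  (arcpot M x%:C k <= (ln M - ln (Num.sqrt (1 - k ^+ 2) / 2))%:E)%E.
Proof.
move=> k1 M9; have a0 := halfchord_gt0 k1.
have [xk|xk] := leP (x ^+ 2) (1 - k ^+ 2); first by rewrite arcpot_on.
have a2 : Num.sqrt (1 - k ^+ 2) ^+ 2 = 1 - k ^+ 2.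
  by rewrite sqr_sqrtr// ltW// -sqrtr_gt0.
have zk : ~ csegment (Num.sqrt (1 - k ^+ 2)) x%:C.
  move=> [y /=]; rewrite in_itv/= -ler_norml => ya [yx].
  move: xk; rewrite -yx -a2 ltNge -[y ^+ 2]real_normK ?num_real//.
  by rewrite ler_pXn2r ?nnegrE ?ya// ltW.
rewrite arcpot_off// lee_fin lerD2l lerN2 ler_ln ?posrE.
- by rewrite ltW// joukowski_gt.
- by rewrite divr_gt0.
- by rewrite normc_gt0 joukowski_neq0.
Qed.

Section CapPotential.
Variables (kappa : R) (kappa0 : 0 <= kappa) (kappa1 : kappa < 1).
Local Notation cap := (cap_measure kappa0 kappa1).

Lemma halfchord_cos_in k t : -1 <= Num.sqrt (1 - k ^+ 2) * cos t <= 1.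
Proof.
rewrite -ler_norml normrM (ger0_norm (sqrtr_ge0 _)).
by rewrite -[leRHS]mulr1 ler_pM ?sqrtr_ge0// ?halfchord_le1// ler_norml cos_geN1 cos_le1.
Qed.

Lemma integral_cap_itv (f : mR -> \bar R) : measurable_fun [set: mR] f ->
  (forall x : R, -1 <= x <= 1 -> (0 <= f x)%E) ->
  (\int[cap]_(x in `[(-1)%R, 1%R]) f x = ((1 - kappa)^-1)%:E *
   \int[leb]_(k in `]kappa, 1%R[) ((pi^-1)%:E * \int[leb]_(t in `]0%R, pi[)
      f (Num.sqrt (1 - k ^+ 2) * cos t)%R))%E.
Proof.
move=> mf f0; rewrite integral_mkcond integral_cap.
- congr (_ * _)%E; apply: eq_integral => k _; congr (_ * _)%E.
  apply: eq_integral => t _; rewrite patchE mem_set//= in_itv/=.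
  exact: halfchord_cos_in.
- exact/(measurable_restrictT f)/measurable_funTS.
- by move=> x; apply: erestrict_ge0 => y; rewrite /= in_itv/=; exact: f0.
Qed.

Lemma cap_itv : cap `[-1, 1]%classic = 1%E.
Proof.
have -> : cap `[-1, 1]%classic = (\int[cap]_(x in `[(-1)%R, 1%R]) (cst 1 x))%E.
  by rewrite integral_cst// mul1e.
rewrite integral_cap_itv//.
under eq_integral.
  move=> k _; rewrite integral_cst// mul1e [X in (_ * X)%E]leb_0pi -EFinM mulVf ?gt_eqF ?pi_gt0//; over.
have mE : leb `]kappa, 1[%classic = (1 - kappa)%:E.
  by rewrite lebesgue_measure_itv/= lte_fin kappa1 -EFinB.
rewrite integral_cst// mul1e [X in (_ * X)%E]mE -EFinM.
by rewrite mulVf// gt_eqF// subr_gt0.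
Qed.

Lemma cap_itvC : cap (~` `[-1, 1]%classic) = 0%E.
Proof.
have mC : measurable (~` `[-1, 1]%classic : set mR) by exact: measurableC.
have -> : cap (~` `[-1, 1]%classic) = (\int[cap]_x (\1_(~` `[-1, 1]%classic) x)%:E)%E.
  by rewrite integral_indic// setIT.
rewrite integral_cap.
- rewrite [X in (_ * X)%E]integral0_eq ?mule0// => k _.
  rewrite integral0_eq ?mule0// => t _; rewrite indicE memNset//=; apply.
  by rewrite in_itv/= halfchord_cos_in.
- by apply/measurable_EFinP/measurable_indic.
- by move=> x; rewrite lee_fin.
Qed.

Lemma cap_potential M z : 0 < M ->
  (forall x : R, -1 <= x <= 1 -> normc (x%:C - z) <= M) ->
  (\int[cap]_(x in `[(-1)%R, 1%R]) logkerz M z x =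
   ((1 - kappa)^-1)%:E * \int[leb]_(k in `]kappa, 1%R[) arcpot M z k)%E.
Proof.
move=> M0 zM; rewrite integral_cap_itv//; first exact: measurable_logker_normc.
by move=> x x1; rewrite /logkerz logker_ge0 ?normc_ge0// zM.
Qed.

End CapPotential.

(** For [kappa = 0] the arc is a quarter of a circle for every [x], which is
    the case of a constant density. *)
Lemma integral_lambda (f : mR -> \bar R) : measurable_fun [set: mR] f ->
  (forall x, 0 <= f x)%E ->
  (\int[lambda]_x f x = \int[cap_measure (lexx (0%R:R)) ltr01]_x f x)%E.
Proof.
move=> mf f0; rewrite integral_uniform// integral_density//.
rewrite -ge0_integralZl//; last exact: measurable_funTS.
rewrite integral_itv_bndoo; last first.
  by apply: emeasurable_funM => //; exact: measurable_funTS.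
rewrite [LHS]integral_mkcond; apply: eq_integral => x _; rewrite patchE.
have [x1|x1] := boolP (x \in `]-1, 1[%classic).
  move: (x1); rewrite inE/= in_itv/= => /andP[xa xb].
  rewrite /cap_density cap_angle_acos//; last by nra.
  rewrite mul0r acos0 /= subr0 mulr1; congr (_%:E * _)%E.
  by rewrite mulrAC divff ?mul1r ?gt_eqF ?pi_gt0// opprK.
rewrite /cap_density cap_angle0//; first by rewrite /= mul0r mul0e.
move: x1; rewrite notin_setE/= in_itv/= => /negP; rewrite negb_and -!leNgt => /orP[] h; nra.
Qed.

End ArcsinePotentials.

(** * The logarithmic kernel as a superposition of windows *)

Section KernelDecomposition.
Context {R : realType}.
Local Notation leb := (@lebesgue_measure R).
Local Notation mR := (measurableTypeR R).
Implicit Types (x y r s u : R).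

(** The weight [r^-1] enters squared: [int_u^3 (r - u) / r^2 dr] equals
    [ln (3 / u)] up to the term [1 - u / 3], which the windows of parameter
    [r > 3] supply. *)
Definition win_weight r : R := if r <= 3 then r^-1 else (Num.sqrt 3)^-1.

(** The half-open interval ]s, s + min r 3] for [p = (r, s)]. The windows with
    [3 < r < 4] all have length [3]: they account for the part of the
    logarithmic kernel that the windows of length [r < 3] leave out. *)
Definition window (p : mR * mR) x : bool := p.2 < x <= p.2 + Num.min p.1 3.

Definition window_fun (p : mR * mR) x : R :=
  win_weight p.1 * (((0 < p.1 < 4) && window p x) && (-1 <= x <= 1))%:R.

Lemma win_weight_ge0 r : 0 < r -> 0 <= win_weight r.
Proof. by move=> r0; rewrite /win_weight; case: ifP => _; rewrite invr_ge0 ?sqrtr_ge0 ?ltW. Qed.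

Lemma window_fun_ge0 p x : 0 <= window_fun p x.
Proof.
rewrite /window_fun; have [/andP[p0 _]|_] := boolP (0 < p.1 < 4); last by rewrite mulr0.
by rewrite mulr_ge0// win_weight_ge0.
Qed.

Lemma measurable_inv_R : measurable_fun [set: mR] (fun r : mR => r^-1 : mR).
Proof.
have -> : (fun r : mR => r^-1 : mR) = fun r => if 0 <= r then `|r| `^ (-1) else - (`|r| `^ (-1)).
  apply/funext => r; rewrite powR_inv1//; case: ifPn => r0; first by rewrite ger0_norm.
  by rewrite ltr0_norm ?ltNge// invrN opprK.
have m1 : measurable_fun [set: mR] (fun r : mR => `|r| `^ (-1) : mR).
  by apply: (measurableT_comp (measurable_powR _)); exact: normr_measurable.
apply: measurable_fun_ifT => //; first exact: measurable_fun_ler.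
exact: measurableT_comp.
Qed.

Lemma measurable_win_weight : measurable_fun [set: mR] (win_weight : mR -> mR).
Proof.
apply: measurable_fun_ifT => //; first exact: measurable_fun_ler.
exact: measurable_inv_R.
Qed.

Lemma measurable_window_fun :
  measurable_fun [set: (mR * mR) * mR] (fun p : (mR * mR) * mR => window_fun p.1 p.2 : mR).
Proof.
have m1 : measurable_fun [set: (mR * mR) * mR] (fun p : (mR * mR) * mR => p.1.1 : mR).
  exact: (measurableT_comp measurable_fst measurable_fst).
have m2 : measurable_fun [set: (mR * mR) * mR] (fun p : (mR * mR) * mR => p.1.2 : mR).
  exact: (measurableT_comp measurable_snd measurable_fst).
have m3 : measurable_fun [set: (mR * mR) * mR] (fun p : (mR * mR) * mR => p.2 : mR).
  exact: measurable_snd.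
have mmin : measurable_fun [set: (mR * mR) * mR] (fun p : (mR * mR) * mR => p.1.2 + Num.min p.1.1 3 : mR).
  by apply: measurable_funD => //; exact: measurable_minr.
apply: measurable_funM.
  exact: (measurableT_comp measurable_win_weight m1).
rewrite (_ : (fun _ => _) = (fun p : (mR * mR) * mR => if [&& 0 < p.1.1 < 4, window p.1 p.2 & -1 <= p.2 <= 1] then 1 else 0 : mR)); last first.
  by apply/funext => p; rewrite -andbA; case: ifP.
apply: measurable_fun_ifT => //.
by repeat apply: measurable_and; first [exact: measurable_fun_ltr|exact: measurable_fun_ler].
Qed.

(** The left end points [s] of the windows of length [l] that contain two
    points at distance [d] form an interval of length [l - d], if [d < l]. *)
Lemma window_overlap x y l :
  leb [set s : R | (s < x <= s + l) && (s < y <= s + l)] =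
  (Num.max 0 (l - `|x - y|))%:E.
Proof.
wlog xy : x y / x <= y.
  move=> H; have [xy|/ltW yx] := leP x y; first exact: H.
  rewrite distrC -H//; congr (leb _); apply/seteqP; split => s /=; by rewrite andbC.
have e : [set s : R | (s < x <= s + l) && (s < y <= s + l)] = `[y - l, x[%classic.
  apply/seteqP; split => s /=; rewrite in_itv/=.
    by move=> /andP[/andP[h1 h2] /andP[h3 h4]]; rewrite h1 andbT lerBlDr.
  move=> /andP[h1 h2]; rewrite h2 (lt_le_trans h2 xy)/= -!lerBlDr h1 andbT.
  by rewrite (le_trans _ h1)// lerB.
rewrite e lebesgue_measure_itv/= lte_fin distrC ger0_norm ?subr_ge0//.
case: ifPn => h; rewrite -?EFinB; congr EFin.
  by rewrite max_r; [ring|lra].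
by rewrite max_l//; move: h; rewrite -leNgt; lra.
Qed.

Lemma window_section x y r : -1 <= x <= 1 -> -1 <= y <= 1 ->
  (\int[leb]_s (window_fun (r, s) x * window_fun (r, s) y)%:E =
  ((0 < r < 4)%R%:R * (win_weight r ^+ 2 * Num.max 0 (Num.min r 3 - `|x - y|)))%:E)%E.
Proof.
move=> x1 y1.
have [r04|r04] := boolP (0 < r < 4); last first.
  by rewrite integral0_eq ?mul0r// => s _; rewrite /window_fun (negbTE r04) /= mulr0 mul0r.
pose W := [set s : R | (s < x <= s + Num.min r 3) && (s < y <= s + Num.min r 3)].
have eW : W = `[Num.max x y - Num.min r 3, Num.min x y[%classic.
  apply/seteqP; split => s; rewrite /W /= in_itv/= lt_min lerBlDr ge_max.
    by move=> /andP[/andP[-> ->] /andP[-> ->]].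
  by move=> /andP[/andP[-> ->] /andP[-> ->]].
have mW : measurable (W : set mR) by rewrite eW.
rewrite mul1r EFinM -window_overlap -/W.
transitivity (\int[leb]_s ((win_weight r ^+ 2)%:E * (\1_W s)%:E))%E.
  apply: eq_integral => s _; rewrite /window_fun r04 x1 y1 /= !andbT -EFinM; congr EFin.
  rewrite indicE mulrACA -expr2; congr (_ * _).
  by rewrite /window /= -natrM mulnb mem_setE.
rewrite ge0_integralZl//.
- by rewrite integral_indic// setIT.
- exact/measurable_EFinP/measurable_indic.
- by rewrite lee_fin sqr_ge0.
Qed.

End KernelDecomposition.

Section KernelIntegral.
Context {R : realType}.
Local Notation leb := (@lebesgue_measure R).
Local Notation mR := (measurableTypeR R).
Implicit Types (x y r s u : R).

Definition win_mass u r : R := win_weight r ^+ 2 * Num.max 0 (Num.min r 3 - u).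

Lemma win_mass_ge0 u r : 0 <= win_mass u r.
Proof. by rewrite mulr_ge0 ?sqr_ge0// le_max lexx. Qed.

Lemma measurable_win_mass u : measurable_fun [set: mR] (win_mass u : mR -> mR).
Proof.
apply: measurable_funM; first by apply: measurable_funX; exact: measurable_win_weight.
by apply: measurable_maxr => //; apply: measurable_funB => //; exact: measurable_minr.
Qed.

Lemma win_mass_long u : u <= 3 ->
  (\int[leb]_(r in `]3%R, 4%R[) (win_mass u r)%:E = (1 - u / 3)%:E)%E.
Proof.
move=> u3; transitivity (\int[leb]_(r in `]3%R, 4%R[) (cst (1 - u / 3)%:E r))%E.
  apply: eq_integral => r; rewrite inE /= in_itv/= => /andP[r3 r4].
  rewrite /win_mass /win_weight leNgt r3/= exprVn sqr_sqrtr//.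
  rewrite min_r ?(ltW r3)// max_r ?subr_ge0//; congr EFin. by field.
have mE : leb `]3, 4[%classic = 1%:E.
  by rewrite lebesgue_measure_itv/= lte_fin ltr_nat/= -EFinB; congr EFin; ring.
by rewrite integral_cst// [X in (_ * X)%E]mE mule1.
Qed.

Lemma is_derive_ln_div u r : 0 < r -> is_derive r (1 : R) (fun r => ln r + u / r) (r^-1 - u / r ^+ 2).
Proof.
move=> r0.
have rn : r != 0 by rewrite gt_eqF.
have d1 := is_derive1_ln r0.
have d2 : is_derive r (1 : R) (fun r : R => r^-1) (- r ^- 2 *: 1).
  exact: (@is_deriveV R id r 1 1).
have d3 : is_derive r (1 : R) (@ln R + u *: (fun r : R => r^-1)) (r^-1 + u *: (- r ^- 2 *: 1)).
  exact: is_deriveD.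
by apply: (is_derive_eq d3); rewrite /GRing.scale/= mulr1 mulrN.
Qed.

Lemma win_mass_FTC u a : 0 <= u -> u <= a -> 0 < a -> a < 3 ->
  (\int[leb]_(r in `]a, 3%R[) (win_mass u r)%:E = (ln 3 + u / 3 - (ln a + u / a))%:E)%E.
Proof.
move=> u0 ua a0 a3.
pose f r : R := r^-1 - u / r ^+ 2.
transitivity (\int[leb]_(r in `]a, 3%R[) (f r)%:E)%E.
  apply: eq_integral => r; rewrite inE /= in_itv/= => /andP[ar r3].
  have r0 : 0 < r by exact: lt_trans ar.
  have ur : u <= r by rewrite (le_trans ua)// ltW.
  rewrite /win_mass /win_weight (ltW r3) min_l ?ltW// max_r ?subr_ge0//.
  by congr EFin; rewrite /f; field; rewrite gt_eqF.
have f0 r : r \in `]a, 3[ -> 0 <= f r.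
  rewrite in_itv/= => /andP[ar r3]; have r0 : 0 < r by exact: lt_trans ar.
  rewrite (_ : f r = (r - u) / r ^+ 2); last by rewrite /f; field; rewrite gt_eqF.
  by rewrite divr_ge0 ?sqr_ge0// subr_ge0 (le_trans ua)// ltW.
have cf r : r \in `]a, 3[ -> {for r, continuous f}.
  rewrite in_itv/= => /andP[ar r3]; have r0 : 0 < r by exact: lt_trans ar.
  apply: cvgB; first by apply: cvgV => //; rewrite gt_eqF.
  apply: cvgM; first exact: cvg_cst.
  by apply: cvgV; [rewrite gt_eqF// exprn_gt0|exact: exprn_continuous].
pose F r : R := ln r + u / r.
have dF r : r \in `]a, 3[ -> is_derive r (1 : R) F (f r).
  rewrite in_itv/= => /andP[ar r3]; have r0 : 0 < r by exact: lt_trans ar.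
  exact: is_derive_ln_div.
have cF r : 0 < r -> {for r, continuous F}.
  by move=> r0; exact: (is_derive_cvg (is_derive_ln_div u r0)).
have Fl : F r @[r --> a^'+] --> F a by apply: cvg_at_right_filter; exact: cF.
have Fr : F r @[r --> 3^'-] --> F 3 by apply: cvg_at_left_filter; exact: cF.
by rewrite (ge0_FTC_oo a3 f0 cf dF Fl Fr).
Qed.

(** For [u = 0] both sides are infinite: the primitive of [win_mass_FTC] tends
    to [+oo] at [0]. *)
Lemma win_mass_short u : 0 <= u < 3 ->
  (\int[leb]_(r in `]0%R, 3%R[) (win_mass u r)%:E + (1 - u / 3)%:E = logker 3 u)%E.
Proof.
move=> /andP[u0 u3]; have m0 r : (0 <= (win_mass u r)%:E)%E by rewrite lee_fin win_mass_ge0.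
have mm : measurable_fun [set: mR] (EFin \o win_mass u).
  by apply/measurable_EFinP; exact: measurable_win_mass.
have [u00|un0] := eqVneq u 0; last first.
  have {}u0 : 0 < u by rewrite lt_neqAle eq_sym un0.
  rewrite /logker (negbTE un0).
  transitivity (\int[leb]_(r in `]u, 3%R[) (win_mass u r)%:E + (1 - u / 3)%:E)%E.
    congr (_ + _)%E; rewrite [LHS]integral_mkcond [RHS]integral_mkcond.
    apply: eq_integral => r _; rewrite !patchE !mem_setE !in_itv/=.
    have [ur|ru] := ltP u r; first by rewrite (lt_trans u0 ur).
    case: ifP => // /andP[r0 r3]; rewrite /win_mass max_l ?mulr0// min_l ?(ltW r3)//.
    by rewrite subr_le0.
  rewrite win_mass_FTC ?(ltW u0)// -EFinD; congr EFin.
  by field.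
rewrite u00 /logker eqxx; rewrite u00 in m0 mm.
suff -> : (\int[leb]_(r in `]0%R, 3%R[) (win_mass 0 r)%:E = +oo)%E by rewrite addye.
apply/eqyP => A A0; pose a : R := 3 * expR (- A).
have a0 : 0 < a by rewrite mulr_gt0// expR_gt0.
have a3 : a < 3 by rewrite gtr_pMr// expR_lt1 oppr_lt0.
apply: (@le_trans _ _ (\int[leb]_(r in `]a, 3%R[) (win_mass 0 r)%:E)%E).
  rewrite win_mass_FTC//; last exact: ltW.
  rewrite lee_fin !mul0r !addr0 /a lnM ?posrE ?expR_gt0// expRK; lra.
apply: ge0_subset_integral => //.
- exact: measurable_funTS.
- by apply: subset_itvr; rewrite bnd_simp ltW.
Qed.

(** The decomposition that makes the logarithmic energy positive definite; the
    constant [3] exceeds every distance in [[-1, 1]]. *)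
Lemma window_kernel x y : -1 <= x <= 1 -> -1 <= y <= 1 ->
  (\int[(leb \x leb)%E]_z (window_fun z x * window_fun z y)%:E = logker 3 `|x - y|%R)%E.
Proof.
move=> x1 y1.
have mz t : measurable_fun [set: mR * mR] (fun z : mR * mR => window_fun z t : mR).
  exact: (measurableT_comp measurable_window_fun (measurable_pair2 t)).
rewrite (@fubini_tonelli1 _ _ mR mR R leb leb (fun z => (window_fun z x * window_fun z y)%:E)); last 2 first.
- by apply/measurable_EFinP; exact: (measurable_funM (mz x) (mz y)).
- by move=> z; rewrite lee_fin mulr_ge0// window_fun_ge0.
rewrite /fubini_F; under eq_integral do rewrite window_section//.
set u := `|x - y|%R.
have u2 : 0 <= u < 3.
  by rewrite normr_ge0/= ltr_norml; lra.
rewrite -win_mass_short// -win_mass_long; last by case/andP: u2 => _ /ltW.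
have mw : measurable_fun [set: mR] (EFin \o win_mass u).
  by apply/measurable_EFinP; exact: measurable_win_mass.
transitivity (\int[leb]_(r in `]0%R, 3%R] `|` `]3%R, 4%R[) (win_mass u r)%:E)%E.
  rewrite [RHS]integral_mkcond; apply: eq_integral => r _.
  rewrite patchE -/(win_mass u r) (_ : (r \in _) = (0 < r < 4)); last first.
    apply/idP/idP; rewrite inE/= !in_itv/=; first by case=> /andP[h1 h2]; apply/andP; split; lra.
    by move=> /andP[h1 h2]; rewrite h1 h2 andbT/=; have [|] := leP r 3; [left|right].
  by case: ifP; rewrite ?mul1r ?mul0r.
rewrite ge0_integral_setU//.
- congr (_ + _)%E. rewrite -integral_itv_bndo_bndc//. exact: measurable_funTS.
- exact: measurable_funTS.
- by move=> r _; rewrite lee_fin win_mass_ge0.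
- apply/disj_setPS => r [/=]; rewrite !in_itv/= => /andP[_ r3] /andP[r3' _].
  by move: r3'; rewrite ltNge r3.
Qed.

End KernelIntegral.

(** * Energies and uniqueness *)

Section WindowSpace.
Context {R : realType}.
Local Notation leb := (@lebesgue_measure R).
Local Notation mR := (measurableTypeR R).

(** A name for the product measure, to which its sigma-finiteness can be
    attached. *)
Definition lebesgue2 : set (mR * mR)%type -> \bar R := (leb \x leb)%E.

HB.instance Definition _ := Measure.on lebesgue2.

Let lebesgue2_sigma_finite : sigma_finite setT lebesgue2.
Proof.
have /sigma_finiteP[F [TF ndF Foo]] := sigma_finiteT leb.
exists (fun n => F n `*` F n).
  rewrite -setXTT TF predeqE => -[x y]; split.
    move=> [/= [n _ Fnx] [k _ Gky]]; exists (maxn n k) => //; split.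
    - by move: x Fnx; exact/subsetPset/ndF/leq_maxl.
    - by move: y Gky; exact/subsetPset/ndF/leq_maxr.
  by move=> [n _ []/= ? ?]; split; exists n.
move=> k; have [? ?] := Foo k.
split; first exact: measurableX.
by rewrite /lebesgue2 product_measure1E// lte_mul_pinfty// ge0_fin_numE.
Qed.

HB.instance Definition _ := Measure_isSigmaFinite.Build _ _ _ lebesgue2
  lebesgue2_sigma_finite.

End WindowSpace.

Section Energy.
Context {R : realType}.
Local Notation leb := (@lebesgue_measure R).
Local Notation mR := (measurableTypeR R).
Local Notation leb2 := (@lebesgue2 R).
Implicit Types (m n : probability mR R) (x y : R) (z : mR * mR).

Local Notation D := (`[-1, 1]%classic : set R).

Definition window_mass m z : \bar R := (\int[m]_x (window_fun z x)%:E)%E.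

Lemma measurable_window_l z : measurable_fun [set: mR] (fun x : mR => window_fun z x : mR).
Proof. exact: (measurableT_comp measurable_window_fun (measurable_pair1 z)). Qed.

Lemma measurable_window_r x : measurable_fun [set: mR * mR] (fun z => window_fun z x : mR).
Proof. exact: (measurableT_comp measurable_window_fun (measurable_pair2 x)). Qed.

Lemma window_fun_notin z x : ~~ (-1 <= x <= 1) -> window_fun z x = 0.
Proof. by move=> x1; rewrite /window_fun (negbTE x1) andbF mulr0. Qed.

Definition win_kernel x y : \bar R :=
  (\int[leb2]_z (window_fun z x * window_fun z y)%:E)%E.

Lemma win_kernelE x y : win_kernel x y =
  if (-1 <= x <= 1) && (-1 <= y <= 1) then logker 3 `|x - y| else 0%E.
Proof.
case: ifPn => [/andP[x1 y1]|]; first exact: window_kernel.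
rewrite negb_and => /orP[] h; rewrite /win_kernel integral0_eq// => z _.
  by rewrite window_fun_notin ?mul0r.
by rewrite [window_fun z y]window_fun_notin ?mulr0.
Qed.

Lemma win_kernel_ge0 x y : (0 <= win_kernel x y)%E.
Proof. by apply: integral_ge0 => z _; rewrite lee_fin mulr_ge0// window_fun_ge0. Qed.

Lemma measurable_window_mass m : measurable_fun [set: mR * mR] (window_mass m).
Proof.
apply: (@measurable_fun_fubini_tonelli_F _ _ (mR * mR)%type mR R m (fun p => (window_fun p.1 p.2)%:E)).
  by apply/measurable_EFinP; exact: measurable_window_fun.
by move=> p; rewrite lee_fin window_fun_ge0.
Qed.

Lemma window_mass_ge0 m z : (0 <= window_mass m z)%E.
Proof. by apply: integral_ge0 => x _; rewrite lee_fin window_fun_ge0. Qed.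

Lemma measurable_win_kernel : measurable_fun [set: mR * mR] (fun p : mR * mR => win_kernel p.1 p.2).
Proof.
pose f (p : (mR * mR) * (mR * mR)) : \bar R := (window_fun p.2 p.1.1 * window_fun p.2 p.1.2)%:E.
rewrite (_ : (fun p => _) = fubini_F leb2 f)//.
apply: measurable_fun_fubini_tonelli_F.
  apply/measurable_EFinP.
  have mp (t : (mR * mR) * (mR * mR) -> mR) : measurable_fun setT t ->
      measurable_fun [set: (mR * mR) * (mR * mR)] (fun p => window_fun p.2 (t p) : mR).
    move=> mt; apply: (measurableT_comp measurable_window_fun (g := fun p => (p.2, t p))).
    by apply: measurable_fun_pair => //; exact: measurable_snd.
  apply: (measurable_funM (mp (fun p => p.1.1) _) (mp (fun p => p.1.2) _)).
    exact: (measurableT_comp measurable_fst measurable_fst).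
  exact: (measurableT_comp measurable_snd measurable_fst).
by move=> p; rewrite lee_fin mulr_ge0// window_fun_ge0.
Qed.

Definition win_potential m x : \bar R := (\int[m]_y win_kernel x y)%E.

Lemma win_potential_ge0 m x : (0 <= win_potential m x)%E.
Proof. by apply: integral_ge0 => y _; exact: win_kernel_ge0. Qed.

Lemma measurable_win_potential m : measurable_fun [set: mR] (win_potential m).
Proof.
apply: (@measurable_fun_fubini_tonelli_F _ _ mR mR R m (fun p => win_kernel p.1 p.2)).
  exact: measurable_win_kernel.
by move=> p; exact: win_kernel_ge0.
Qed.

Lemma win_potentialE m x : -1 <= x <= 1 ->
  win_potential m x = (\int[m]_(y in D) logker 3 `|x - y|%R)%E.
Proof.
move=> x1; rewrite [RHS]integral_mkcond; apply: eq_integral => y _.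
by rewrite patchE win_kernelE x1 /= mem_setE in_itv/=.
Qed.

(** The kernel is an integral of products, hence so is the mutual energy. *)
Lemma energy_window_mass m n :
  (\int[m]_x win_potential n x = \int[leb2]_z (window_mass m z * window_mass n z))%E.
Proof.
transitivity (\int[m]_x \int[leb2]_z ((window_fun z x)%:E * window_mass n z))%E.
  apply: eq_integral => x _; rewrite /win_potential /win_kernel.
  rewrite (@fubini_tonelli _ _ mR (mR * mR)%type R n leb2
    (fun p => (window_fun p.2 x * window_fun p.2 p.1)%:E)); last 2 first.
  - apply/measurable_EFinP; apply: measurable_funM.
      exact: (measurableT_comp (measurable_window_r x) measurable_snd).
    apply: (measurableT_comp measurable_window_fun (g := fun p => (p.2, p.1))).
    by apply: measurable_fun_pair; [exact: measurable_snd|exact: measurable_fst].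
  - by move=> p; rewrite lee_fin mulr_ge0// window_fun_ge0.
  apply: eq_integral => z _; rewrite /=.
  under eq_integral do rewrite EFinM.
  rewrite ge0_integralZl//.
  - by apply/measurable_EFinP; exact: measurable_window_l.
  - by move=> y _; rewrite lee_fin window_fun_ge0.
  - by rewrite lee_fin window_fun_ge0.
rewrite (@fubini_tonelli _ _ mR (mR * mR)%type R m leb2
    (fun p => ((window_fun p.2 p.1)%:E * window_mass n p.2)%E)); last 2 first.
- apply: emeasurable_funM.
    apply/measurable_EFinP.
    apply: (measurableT_comp measurable_window_fun (g := fun p => (p.2, p.1))).
    by apply: measurable_fun_pair; [exact: measurable_snd|exact: measurable_fst].
  exact: (measurableT_comp (measurable_window_mass n) measurable_snd).
- by move=> p; rewrite mule_ge0 ?window_mass_ge0// lee_fin window_fun_ge0.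
apply: eq_integral => z _; rewrite /= ge0_integralZr//.
- by apply/measurable_EFinP; exact: measurable_window_l.
- by move=> y _; rewrite lee_fin window_fun_ge0.
- exact: window_mass_ge0.
Qed.

Lemma window_mass_fin m z : window_mass m z \is a fin_num.
Proof.
rewrite ge0_fin_numE ?window_mass_ge0//.
have [z4|z4] := boolP (0 < z.1 < 4); last first.
  rewrite /window_mass integral0_eq ?ltry// => x _.
  by rewrite /window_fun (negbTE z4) /= mulr0.
have w0 : 0 <= win_weight z.1 by apply: win_weight_ge0; case/andP: z4.
apply: (@le_lt_trans _ _ (\int[m]_x (cst (win_weight z.1)%:E x))%E).
  apply: ge0_le_integral => //.
  - by move=> x _; rewrite lee_fin window_fun_ge0.
  - by apply/measurable_EFinP; exact: measurable_window_l.
  - move=> x _; rewrite lee_fin /window_fun -[leRHS]mulr1 ler_wpM2l//.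
    by case: (_ && _).
have mT : m setT = 1%E by exact: probability_setT.
by rewrite integral_cst// [X in (_ * X)%E]mT mule1 ltry.
Qed.

End Energy.

Section Tail.
Context {R : realType}.
Local Notation leb := (@lebesgue_measure R).
Local Notation mR := (measurableTypeR R).
Implicit Types (m n : probability mR R) (s : R).

Let idTR : mR -> R := idfun.

#[local] HB.instance Definition _ :=
  @isMeasurableFun.Build _ _ _ _ idTR (@measurable_id _ _ setT).

Definition tail m s : R := fine (m `]s, +oo[%classic).

Lemma tailE m s : (tail m s)%:E = m `]s, +oo[%classic.
Proof. by rewrite /tail fineK// fin_num_measure. Qed.

Lemma tail_right_continuous m s : tail m r @[r --> s^'+] --> tail m s.
Proof.
apply: fine_cvg; rewrite fineK ?fin_num_measure//.
exact: (@ccdf_right_continuous _ _ _ m (idTR : {RV m >-> R})).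
Qed.

Lemma measurable_tail m : measurable_fun [set: mR] (tail m : mR -> mR).
Proof.
apply: (@measurableT_comp _ _ _ _ _ _ (@fine R)) => //.
exact: (@ccdf_measurable _ _ _ m (idTR : {RV m >-> R})).
Qed.

(** Right continuity upgrades equality almost everywhere to equality
    everywhere. *)
Lemma tail_eq m n (a b : R) : a < b ->
  (\int[leb]_(s in `]a, b[) ((tail m s - tail n s) ^+ 2)%:E = 0)%E ->
  forall s, a <= s < b -> tail m s = tail n s.
Proof.
move=> ab int0 s /andP[as_ sb]; apply/eqP; rewrite -subr_eq0; apply/negPn/negP => d0.
pose h r := (tail m r - tail n r) ^+ 2.
have hs0 : 0 < h s by rewrite exprn_even_gt0.
have hc : h r @[r --> s^'+] --> h s.
  apply: (@cvg_comp _ _ _ (fun r => tail m r - tail n r) (fun x => x ^+ 2)); last exact: exprn_continuous.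
  by apply: cvgB; exact: tail_right_continuous.
have hs2 : h s / 2 < h s by rewrite ltr_pdivrMr// ltr_pMr// ltr1n.
have [e /= e0 he] := cvgr_gt _ hc _ hs2.
pose e' := Num.min e (b - s).
have e'0 : 0 < e' by rewrite lt_min e0 subr_gt0.
have mh : measurable_fun [set: mR] (fun r => (h r)%:E : \bar R).
  apply/measurable_EFinP; apply: measurable_funX.
  exact: (measurable_funB (measurable_tail m) (measurable_tail n)).
have : (\int[leb]_(r in `]s, (s + e')%R[) (cst (h s / 2)%:E r) <= \int[leb]_(r in `]a, b[) (h r)%:E)%E.
  apply: (@le_trans _ _ (\int[leb]_(r in `]s, (s + e')%R[) (h r)%:E)%E).
    apply: ge0_le_integral => //.
    - by move=> r _; rewrite lee_fin divr_ge0// ltW.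
    - exact: measurable_funTS.
    - move=> r; rewrite /= in_itv/= => /andP[sr re]; rewrite lee_fin ltW//.
      apply: he => //=; rewrite distrC gtr0_norm ?subr_gt0// ltrBlDl.
      by rewrite (lt_le_trans re)// lerD2l ge_min lexx.
  apply: ge0_subset_integral => //.
  - exact: measurable_funTS.
  - by move=> r _; rewrite lee_fin sqr_ge0.
  - move=> r; rewrite /= !in_itv/= => /andP[sr re].
    rewrite (le_lt_trans as_ sr)/= (lt_le_trans re)// -lerBrDl.
    by rewrite ge_min lexx orbT.
have mE : leb `]s, s + e'[%classic = e'%:E.
  by rewrite lebesgue_measure_itv/= lte_fin ltrDl e'0 -EFinD addrAC subrr add0r.
rewrite int0 integral_cst// [X in (_ * X)%E]mE -EFinM lee_fin leNgt.
by rewrite mulr_gt0// divr_gt0.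
Qed.

End Tail.

Section Uniqueness.
Context {R : realType}.
Local Notation leb := (@lebesgue_measure R).
Local Notation leb2 := (@lebesgue2 R).
Local Notation mR := (measurableTypeR R).
Implicit Types (m n : probability mR R) (x y : R) (z : mR * mR).

Local Notation D := (`[-1, 1]%classic : set R).

Lemma prob_integral_cst m (c : R) : (\int[m]_x c%:E = c%:E)%E.
Proof.
have mT : m setT = 1%E by exact: probability_setT.
by rewrite integral_cst// [X in (_ * X)%E]mT mule1.
Qed.

Lemma EFin_addeI (r : R) (u v : \bar R) : (r%:E + u = r%:E + v)%E -> u = v.
Proof. by case: u => [u||]; case: v => [v||] //= [] /addrI ->. Qed.

(** Integrating a potential against a probability measure.  The constant [c]
    may be negative, so both sides are first shifted by [|c|], which makes
    their terms nonnegative. *)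
Section EnergyBounds.
Variables (h : mR -> R) (mh : measurable_fun [set: mR] h) (h0 : forall x, 0 <= h x).
Variables (m n : probability mR R) (c : R) (T : set mR) (mT : measurable T) (nT : n (~` T) = 0%E).

Let shift := `|c|.
Let s0 : 0 <= shift + c.
Proof. by rewrite /shift; have := ler_norm (- c); rewrite normrN; lra. Qed.

Let mw := measurable_win_potential m.

Let shift_int : (\int[n]_x ((shift + c)%:E + (h x)%:E) = (shift + c)%:E + \int[n]_x (h x)%:E)%E.
Proof.
rewrite ge0_integralD//; first by rewrite prob_integral_cst.
- by move=> x _; rewrite lee_fin.
- exact/measurable_EFinP.
Qed.

Let shift_pot : (\int[n]_x (shift%:E + win_potential m x) = shift%:E + \int[n]_x win_potential m x)%E.
Proof.
rewrite ge0_integralD//; first by rewrite prob_integral_cst.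
- by move=> x _; rewrite lee_fin normr_ge0.
- by move=> x _; exact: win_potential_ge0.
Qed.

Let mf1 : measurable_fun [set: mR] (fun x => (shift + c)%:E + (h x)%:E)%E.
Proof. by apply: emeasurable_funD => //; exact/measurable_EFinP. Qed.

Let mf2 : measurable_fun [set: mR] (fun x => shift%:E + win_potential m x)%E.
Proof. exact: emeasurable_funD. Qed.

Let f10 x : (0 <= (shift + c)%:E + (h x)%:E)%E.
Proof. by rewrite -EFinD lee_fin addr_ge0. Qed.

Let f20 x : (0 <= shift%:E + win_potential m x)%E.
Proof. by rewrite adde_ge0 ?win_potential_ge0// lee_fin normr_ge0. Qed.

Lemma energy_ge : (forall x, T x -> ((c + h x)%:E <= win_potential m x)%E) ->
  (c%:E + \int[n]_x (h x)%:E <= \int[n]_x win_potential m x)%E.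
Proof.
move=> le; rewrite -(@leeD2lE _ shift%:E)// (addeA shift%:E c%:E) -EFinD -shift_int -shift_pot.
apply: ae_ge0_le_integral => //.
exists (~` T); split => //; first exact: measurableC.
move=> x /=; apply: contra_not => Tx _.
by rewrite -EFinD -addrA EFinD leeD2l// le.
Qed.

Lemma energy_eq : (forall x, T x -> win_potential m x = (c + h x)%:E) ->
  (\int[n]_x win_potential m x = c%:E + \int[n]_x (h x)%:E)%E.
Proof.
move=> eq; suff : (shift%:E + \int[n]_x win_potential m x =
    shift%:E + (c%:E + \int[n]_x (h x)%:E))%E.
  exact: EFin_addeI.
rewrite (addeA shift%:E c%:E) -EFinD -shift_int -shift_pot.
apply: ge0_ae_eq_integral => //.
exists (~` T); split => //; first exact: measurableC.
move=> x /=; apply: contra_not => Tx _.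
by rewrite eq// -!EFinD addrA.
Qed.

End EnergyBounds.

(** A window of length [3] that starts in [[-1, 1]] contains all of [[-1, 1]] to
    the right of its starting point. *)
Lemma window_massE m (r s : R) : m (~` D) = 0%E -> 3 < r < 4 -> -1 <= s ->
  window_mass m (r, s) = ((Num.sqrt 3)^-1 * tail m s)%:E.
Proof.
move=> mD /andP[r3 r4] s1; rewrite EFinM tailE.
have mS : measurable (`]s, +oo[%classic `&` D : set mR) by exact: measurableI.
transitivity (\int[m]_x (((Num.sqrt 3)^-1)%:E * (\1_(`]s, +oo[%classic `&` D) x)%:E))%E.
  apply: eq_integral => x _; rewrite /window_fun /win_weight /= leNgt r3 /=.
  have -> : 0 < r < 4 by rewrite r4 andbT; lra.
  rewrite -EFinM; congr EFin; congr (_ * _).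
  rewrite /window /= min_r ?(ltW r3)// indicE; congr ((_ : bool)%:R).
  apply/idP/idP; rewrite inE /= !in_itv/= andbT.
    by move=> /andP[/andP[-> _] ->].
  by move=> [-> /andP[x1 x1']]; rewrite x1 x1' !andbT/=; lra.
rewrite ge0_integralZl//.
- congr (_ * _)%E; rewrite integral_indic// setIT.
  rewrite -[LHS]adde0; have <- : m (`]s, +oo[%classic `&` ~` D) = 0%E.
    apply/eqP; rewrite -measure_le0 -mD; apply: le_measure; rewrite ?inE//; last exact: measurableC.
    by apply: measurableI => //; exact: measurableC.
  rewrite -measureU//.
  + by rewrite -setIUr setUv setIT.
  + by apply: measurableI => //; exact: measurableC.
  + by rewrite setIACA setICr setI0.
- by apply/measurable_EFinP; exact: measurable_indic.
Qed.

(** Uniqueness of the equilibrium measure: testing the two potentials against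
    both measures shows that the energy of the difference is nonpositive, while
    this energy is the integral over all windows of the square of the
    difference of their masses.  The windows of length [3] already determine
    the measures.  Equality of potential and field is only asked on sets of full
    measure, as the potential may be larger off the support. *)
Lemma potential_unique m n (c1 c2 B : R) (h : mR -> R) (S T : set mR) :
  measurable_fun [set: mR] h -> (forall x, 0 <= h x <= B) ->
  m (~` D) = 0%E -> n (~` D) = 0%E ->
  measurable S -> m (~` S) = 0%E -> measurable T -> n (~` T) = 0%E ->
  (forall x, D x -> ((c1 + h x)%:E <= win_potential m x)%E) ->
  (forall x, S x -> win_potential m x = (c1 + h x)%:E) ->
  (forall x, D x -> ((c2 + h x)%:E <= win_potential n x)%E) ->
  (forall x, T x -> win_potential n x = (c2 + h x)%:E) ->
  forall A, measurable A -> m A = n A.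
Proof.
move=> mh hB mD nD mS mS0 mT nT0 m_ge m_eq n_ge n_eq.
have h0 x : 0 <= h x by have /andP[] := hB x.
have mDm : measurable (D : set mR) by [].
have Hfin (k : probability mR R) : (\int[k]_x (h x)%:E)%E \is a fin_num.
  rewrite ge0_fin_numE; last by apply: integral_ge0 => x _; rewrite lee_fin.
  apply: (@le_lt_trans _ _ (\int[k]_x B%:E)%E); last by rewrite prob_integral_cst ltry.
  apply: ge0_le_integral => //.
  - by move=> x _; rewrite lee_fin.
  - exact/measurable_EFinP.
  - by move=> x _; rewrite lee_fin; have /andP[] := hB x.
pose H (k : probability mR R) := fine (\int[k]_x (h x)%:E)%E.
have HE (k : probability mR R) : (\int[k]_x (h x)%:E = (H k)%:E)%E by rewrite /H fineK.
have Emm := energy_eq mh h0 mS mS0 m_eq.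
have Enn := energy_eq mh h0 mT nT0 n_eq.
have Enm := energy_ge mh h0 mDm nD m_ge.
have Emn := energy_ge mh h0 mDm mD n_ge.
rewrite HE -EFinD in Emm; rewrite HE -EFinD in Enn.
rewrite HE -EFinD in Enm; rewrite HE -EFinD in Emn.
rewrite energy_window_mass in Emm; rewrite energy_window_mass in Enn.
rewrite energy_window_mass in Enm; rewrite energy_window_mass in Emn.
pose a z := fine (window_mass m z); pose b z := fine (window_mass n z).
have aE z : window_mass m z = (a z)%:E by rewrite /a fineK// window_mass_fin.
have bE z : window_mass n z = (b z)%:E by rewrite /b fineK// window_mass_fin.
have a0 z : 0 <= a z by rewrite -lee_fin -aE window_mass_ge0.
have b0 z : 0 <= b z by rewrite -lee_fin -bE window_mass_ge0.
have ma : measurable_fun [set: mR * mR] (a : _ -> mR).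
  by apply: (@measurableT_comp _ _ _ _ _ _ (@fine R)) => //; exact: measurable_window_mass.
have mb : measurable_fun [set: mR * mR] (b : _ -> mR).
  by apply: (@measurableT_comp _ _ _ _ _ _ (@fine R)) => //; exact: measurable_window_mass.
have maa := measurable_funM ma ma; have mbb := measurable_funM mb mb.
have mab := measurable_funM ma mb; have mba := measurable_funM mb ma.
have md : measurable_fun [set: mR * mR] (fun z => (a z - b z) ^+ 2 : mR).
  by apply: measurable_funX; exact: measurable_funB.
pose dif := (\int[leb2]_z ((a z - b z) ^+ 2)%:E)%E.
pose II (f g : mR * mR -> R) := (\int[leb2]_z (f z * g z)%:E)%E.
have IIE (k l : probability mR R) (f g : mR * mR -> R) :
    (forall z, window_mass k z = (f z)%:E) -> (forall z, window_mass l z = (g z)%:E) ->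
    (\int[leb2]_z (window_mass k z * window_mass l z))%E = II f g.
  by move=> fE gE; apply: eq_integral => z _; rewrite fE gE.
rewrite (IIE _ _ _ _ aE aE) in Emm; rewrite (IIE _ _ _ _ bE bE) in Enn.
rewrite (IIE _ _ _ _ bE aE) in Enm; rewrite (IIE _ _ _ _ aE bE) in Emn.
(* Polarization, arranged without subtraction of extended reals. *)
have sum : (II a a + II b b = II a b + II b a + dif)%E.
  have IDD (f g : mR * mR -> mR) : measurable_fun setT f -> measurable_fun setT g ->
      (forall z, 0 <= f z) -> (forall z, 0 <= g z) ->
      (\int[leb2]_z (f z)%:E + \int[leb2]_z (g z)%:E = \int[leb2]_z (f z + g z)%:E)%E.
    move=> mf mg f0 g0; under [RHS]eq_integral do rewrite EFinD.
    rewrite ge0_integralD//.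
    - by move=> z _; rewrite lee_fin.
    - by apply/measurable_EFinP.
    - by move=> z _; rewrite lee_fin.
    - by apply/measurable_EFinP.
  have ab0 z : 0 <= a z * b z by rewrite mulr_ge0.
  have ba0 z : 0 <= b z * a z by rewrite mulr_ge0.
  rewrite /II /dif (IDD _ _ maa mbb) ?(IDD _ _ mab mba)//; last 2 first.
  - by move=> z; rewrite mulr_ge0.
  - by move=> z; rewrite mulr_ge0.
  rewrite (IDD _ _ (measurable_funD mab mba) md).
  - apply: eq_integral => z _; congr EFin => /=; ring.
  - by move=> z /=; exact: (addr_ge0 (ab0 z) (ba0 z)).
  - by move=> z /=; exact: sqr_ge0.
have dif0 : (0 <= dif)%E by apply: integral_ge0 => z _; rewrite lee_fin sqr_ge0.
have {}dif0 : dif = 0%E.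
  apply/eqP; rewrite eq_le dif0 andbT.
  move: sum Enm Emn; rewrite Emm Enn -EFinD => sum Enm Emn.
  have := leeD Emn Enm; rewrite -EFinD => le2.
  rewrite -(@leeD2lE _ (c1 + H m + (c2 + H n))%:E)// adde0 [leRHS]sum leeD2r//.
  by apply: le_trans le2; rewrite lee_fin; lra.
have tails (s : R) : -1 <= s < 1 -> tail m s = tail n s.
  move=> s1; apply: (@tail_eq R m n (-1)%R 1%R _ _ s s1); first by lra.
  pose c : R := (Num.sqrt 3)^-1.
  have c20 : 0 < c ^+ 2 by rewrite exprn_gt0// invr_gt0 sqrtr_gt0.
  have mt : measurable_fun [set: mR] (fun t => ((tail m t - tail n t) ^+ 2)%:E : \bar R).
    apply/measurable_EFinP; apply: measurable_funX.
    exact: (measurable_funB (measurable_tail m) (measurable_tail n)).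
  set J := (\int[leb]_(t in _) _)%E.
  have J0 : (0 <= J)%E by apply: integral_ge0 => t _; rewrite lee_fin sqr_ge0.
  apply/eqP; rewrite eq_le J0 andbT.
  suff : ((c ^+ 2)%:E * J <= 0)%E by rewrite pmule_rle0// lte_fin.
  rewrite -dif0 /dif /lebesgue2.
  have md' : measurable_fun [set: mR * mR] (fun z => ((a z - b z) ^+ 2)%:E : \bar R).
    exact/measurable_EFinP.
  rewrite (@fubini_tonelli1 _ _ mR mR R leb leb (fun z => ((a z - b z) ^+ 2)%:E))//; last first.
    by move=> z; rewrite lee_fin sqr_ge0.
  have mE : leb `]3, 4[%classic = 1%:E.
    by rewrite lebesgue_measure_itv/= lte_fin ltr_nat/= -EFinB; congr EFin; ring.
  have -> : ((c ^+ 2)%:E * J = \int[leb]_(r in `]3%R, 4%R[) cst ((c ^+ 2)%:E * J) r)%E.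
    by rewrite integral_cst// [X in _ = (_ * X)%E]mE mule1.
  have mF : measurable_fun [set: mR] (fubini_F leb (fun z => ((a z - b z) ^+ 2)%:E)).
    apply: (@measurable_fun_fubini_tonelli_F _ _ mR mR R leb (fun z => ((a z - b z) ^+ 2)%:E)) => //.
    by move=> z; rewrite lee_fin sqr_ge0.
  have F0 r : (0 <= fubini_F leb (fun z => ((a z - b z) ^+ 2)%:E) r)%E.
    by apply: integral_ge0 => t _; rewrite lee_fin sqr_ge0.
  apply: (@le_trans _ _ (\int[leb]_(r in `]3%R, 4%R[) fubini_F leb (fun z => ((a z - b z) ^+ 2)%:E) r)%E); last first.
    by apply: ge0_subset_integral.
  apply: ge0_le_integral => //.
  - by move=> r _; rewrite /= mule_ge0// lee_fin ltW.
  - exact: measurable_funTS.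
  move=> r; rewrite /= in_itv/= => r34; rewrite /fubini_F.
  apply: (@le_trans _ _ (\int[leb]_(t in `](-1)%R, 1%R[) ((a (r, t) - b (r, t)) ^+ 2)%:E)%E); last first.
    apply: ge0_subset_integral => //.
    - exact: (measurableT_comp md' (measurable_pair1 r)).
    - by move=> t _; rewrite lee_fin sqr_ge0.
  rewrite /J -ge0_integralZl//; last 3 first.
  - exact: measurable_funTS.
  - by move=> t _; rewrite lee_fin sqr_ge0.
  - by rewrite lee_fin ltW.
  rewrite le_eqVlt; apply/orP; left; apply/eqP; apply: eq_integral => t; rewrite inE /= in_itv/= => /andP[t1 t2].
  rewrite -EFinM /a /b !window_massE ?(ltW t1)//=; congr EFin.
  by rewrite -/c; ring.
have out (k : probability mR R) x : k (~` D) = 0%E -> 1 <= x -> k `]x, +oo[%classic = 0%E.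
  move=> kD x1; apply/eqP; rewrite -measure_le0 -kD; apply: le_measure; rewrite ?inE//; first exact: measurableC.
  by move=> y /=; rewrite !in_itv/= andbT => xy; apply/negP; rewrite negb_and -!ltNge (le_lt_trans x1 xy) orbT.
have full (k : probability mR R) x : k (~` D) = 0%E -> x < -1 -> k `]x, +oo[%classic = 1%E.
  move=> kD x1; rewrite -[`]x, +oo[%classic]setCK probability_setC; last exact: measurableC.
  suff -> : k (~` `]x, +oo[%classic) = 0%E by rewrite sube0.
  apply/eqP; rewrite -measure_le0 -kD; apply: le_measure; rewrite ?inE//; try exact: measurableC.
  move=> y /=; rewrite !in_itv/= andbT => /negP; rewrite -leNgt => yx; apply/negP.
  by rewrite negb_and -!ltNge (le_lt_trans yx x1).
apply: measure_eq_rays => [|x].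
  by rewrite -ge0_fin_numE ?measure_ge0// fin_num_measure.
have [x1|x1] := ltP x (-1).
  by apply: (@etrans _ _ 1%E); [exact: full|apply/esym; exact: full].
have [x2|x2] := leP 1 x.
  by apply: (@etrans _ _ 0%E); [exact: out|apply/esym; exact: out].
have := tails x; rewrite x1 x2 => /(_ isT) e.
by apply: (@etrans _ _ (tail m x)%:E); [rewrite tailE|rewrite e tailE].
Qed.

End Uniqueness.

(** * The potential of the uniform law, and null sets off the support *)

Section UniformPotential.
Context {R : realType}.
Local Notation leb := (@lebesgue_measure R).
Local Notation mR := (measurableTypeR R).
Implicit Types (a b c x y u : R).

(** From [ln v < v] for [v = u^(-1/2)]. *)
Lemma xlnx_bound u : 0 < u <= 1 -> `|u * ln u| <= 2 * Num.sqrt u.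
Proof.
move=> /andP[u0 u1].
have s0 : 0 < Num.sqrt u by rewrite sqrtr_gt0.
have s2 : Num.sqrt u ^+ 2 = u by rewrite sqr_sqrtr// ltW.
have := @ln_sublinear R (Num.sqrt u)^-1; rewrite invr_gt0 => /(_ s0).
rewrite lnV ?posrE// => lt1.
have lE : ln u = 2 * ln (Num.sqrt u) by rewrite -[in LHS]s2 lnXn// mulr_natl.
have l0 : ln u <= 0 by rewrite ln_le0.
rewrite normrM (gtr0_norm u0) (ler0_norm l0) lE.
have -> : u * - (2 * ln (Num.sqrt u)) = 2 * Num.sqrt u * (Num.sqrt u * - ln (Num.sqrt u)).
  rewrite -[X in X * _ = _]s2; ring.
rewrite -[leRHS]mulr1 ler_pM2l ?mulr_gt0//.
by rewrite -(mulfV (lt0r_neq0 s0)) ler_pM2l// ltW.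
Qed.

(** Since [ln] is [0] on the negative half-line, the function is continuous
    everywhere, also at [0]. *)
Lemma continuous_xlnx u : {for u, continuous (fun v : R => v * ln v)}.
Proof.
have [u0|u0|->] := ltgtP u 0.
- have : (cst 0 : R -> R) v @[v --> u] --> (u * ln u : R).
    by rewrite ln0 ?mulr0 ?ltW//; exact: cvg_cst.
  apply: cvg_trans; apply: near_eq_cvg; near=> v => /=.
  rewrite ln0 ?mulr0// ltW//; near: v; exact: lt_nbhsl.
- by apply: cvgM; [exact: cvg_id|exact: continuous_ln].
- apply/cvgrPdist_lt => e e0; near=> v.
  rewrite mul0r sub0r normrN.
  have [v0|v0] := leP v 0; first by rewrite ln0// mulr0 normr0.
  have v1 : v <= 1 by rewrite ltW//; near: v; apply: lt_nbhsl; exact: ltr01.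
  have ve : v < (e / 3) ^+ 2 by near: v; apply: lt_nbhsl; rewrite exprn_gt0// divr_gt0.
  apply: le_lt_trans (xlnx_bound _) _; first by rewrite v0.
  have : Num.sqrt v < e / 3.
    have e3 : 0 < e / 3 by rewrite divr_gt0.
    by rewrite -[ltRHS](gtr0_norm e3) -sqrtr_sqr ltr_sqrt// exprn_gt0.
  lra.
Unshelve. all: by end_near. Qed.

Let G u : R := u * (ln 3 + 1) - u * ln u.

Let continuous_G u : {for u, continuous G}.
Proof.
apply: cvgB; last exact: continuous_xlnx.
by apply: cvgM; [exact: cvg_id|exact: cvg_cst].
Qed.

Let is_derive_G u : 0 < u -> is_derive u (1 : R) G (ln 3 - ln u).
Proof.
move=> u0; have dl := is_derive1_ln u0.
have d1 : is_derive u (1 : R) (fun u => u * (ln 3 + 1)) (u *: 0 + (ln 3 + 1) *: 1).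
  exact: is_deriveM.
have d2 : is_derive u (1 : R) (fun u => u * ln u) (u *: u^-1 + ln u *: 1) by exact: is_deriveM.
have -> : ln 3 - ln u = (u *: 0 + (ln 3 + 1) *: 1) - (u *: u^-1 + ln u *: 1).
  by rewrite /GRing.scale /= mulfV ?gt_eqF//; ring.
exact: (is_deriveB d1 d2).
Qed.

Lemma ge0_integral_oo_split (f : R -> \bar R) a c b : a <= c <= b ->
  measurable_fun (`]a, b] : set mR) f ->
  (forall x, x \in `]a, b] -> 0 <= f x)%E ->
  (\int[leb]_(x in `]a, b[) f x = \int[leb]_(x in `]a, c[) f x + \int[leb]_(x in `]c, b[) f x)%E.
Proof.
move=> /andP[ac cb] mf f0.
have s1 : `]a, c] `<=` `]a, b] by move=> y /=; rewrite !in_itv/= => /andP[-> /le_trans->].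
have s2 : `]c, b] `<=` `]a, b] by move=> y /=; rewrite !in_itv/= => /andP[/(le_lt_trans ac)-> ->].
have E (p q : R) : `]p, q] `<=` `]a, b] -> (\int[leb]_(x in `]p, q[) f x = \int[leb]_(x in `]p, q]) f x)%E.
  move=> s; rewrite [RHS]integral_itv_bndoo//; apply: measurable_funS mf => //.
  by apply: subset_trans s; exact: subset_itv_oo_oc.
rewrite !E// -ge0_integral_setU//.
- congr integral; apply/seteqP; split => y /=; rewrite !in_itv/=.
  + by move=> /andP[-> ->]; have [yc|yc] := leP y c; [left|right].
  + by move=> [] h; [apply: s1|apply: s2].
- by apply: (measurable_funS _ _ mf) => // y [/s1|/s2].
- by move=> y [/s1|/s2] h; exact: f0.
- rewrite disj_set2E; apply/eqP; rewrite -subset0 => y /= []; rewrite !in_itv/=.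
  by move=> /andP[_ yc] /andP[cy _]; rewrite ltNge yc in cy.
Qed.

(** On [[-1, 1]], the opposite of the potential of the uniform law. *)
Definition uniform_field x : R :=
  ((1 + x) * ln (1 + x) + (1 - x) * ln (1 - x) - 2) / 2.

Lemma potential_lambda3 x : -1 <= x <= 1 ->
  (\int[lambda]_(y in `[(-1)%R, 1%R]) logkerz 3 x%:C y = (ln 3 - uniform_field x)%:E)%E.
Proof.
move=> /andP[x1 x2].
have mk := measurable_logker_normc 3 x%:C.
have kE y : logkerz 3 x%:C y = logker 3 `|y - x| by rewrite /logkerz -rmorphB normc_real.
have k0 y : -1 <= y <= 1 -> (0 <= logkerz 3 x%:C y)%E.
  by move=> y1; rewrite kE logker_ge0// ler_norml; lra.
have mr : measurable_fun [set: mR] (logkerz 3 x%:C \_ `[-1, 1]).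
  exact/(measurable_restrictT (logkerz 3 x%:C))/measurable_funTS.
rewrite integral_mkcond integral_uniform//; last first.
  move=> y; rewrite patchE; case: ifP => //; rewrite inE/= in_itv/=; exact: k0.
have -> : (\int[leb]_(y in `[(-1)%R, 1%R]) (logkerz 3 x%:C \_ `[(-1)%R, 1%R]) y =
    \int[leb]_(y in `](-1)%R, 1%R[) logkerz 3 x%:C y)%E.
  rewrite integral_itv_bndoo; last exact: measurable_funTS.
  by apply: eq_integral => y; rewrite inE/= => y1; rewrite patchE mem_set//; exact: subset_itv_oo_cc.
rewrite (@ge0_integral_oo_split _ _ x)//; last 3 first.
- by rewrite x1.
- exact: measurable_funTS.
- by move=> y; rewrite in_itv/= => /andP[/ltW ? ?]; apply: k0; apply/andP.
have cln (f : R -> R) y : {for y, continuous f} -> 0 < f y -> {for y, continuous (fun y => ln 3 - ln (f y))}.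
  move=> cf fy; apply: cvgB; first exact: cvg_cst.
  by apply: (cvg_comp f (@ln R)); [exact: cf|exact: continuous_ln].
have c1 y : {for y, continuous (fun y : R => y - x)} by apply: cvgB; [exact: cvg_id|exact: cvg_cst].
have c2 y : {for y, continuous (fun y : R => x - y)} by apply: cvgB; [exact: cvg_cst|exact: cvg_id].
have ln3 (u : R) : 0 < u -> u <= 3 -> 0 <= ln 3 - ln u by move=> u0 u3; rewrite subr_ge0 ler_ln ?posrE.
have cG1 y : G (z - x) @[z --> y] --> G (y - x).
  exact: (cvg_comp (fun z => z - x) G (c1 y) (@continuous_G _)).
have cG2 y : G (x - z) @[z --> y] --> G (x - y).
  exact: (cvg_comp (fun z => x - z) G (c2 y) (@continuous_G _)).
have G0 : G 0 = 0 by rewrite /G !mul0r subrr.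
have right : (\int[leb]_(y in `]x, 1%R[) logkerz 3 x%:C y = (G (1 - x))%:E)%E.
  move: x2; rewrite le_eqVlt => /predU1P[->|x2].
    by rewrite set_itv_ge -?leNgt ?bnd_simp// integral_set0 subrr G0.
  transitivity (\int[leb]_(y in `]x, 1%R[) (ln 3 - ln (y - x))%:E)%E.
    apply: eq_integral => y; rewrite inE/= in_itv/= => /andP[xy y1].
    by rewrite kE /logker normr_eq0 subr_eq0 gt_eqF// gtr0_norm// subr_gt0.
  have f0 y : y \in `]x, 1[ -> 0 <= ln 3 - ln (y - x).
    by rewrite in_itv/= => /andP[xy y1]; apply: ln3; lra.
  have cf y : y \in `]x, 1[ -> {for y, continuous (fun y => ln 3 - ln (y - x))}.
    by rewrite in_itv/= => /andP[xy y1]; apply: (cln (fun y => y - x)) => //; lra.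
  have dF y : y \in `]x, 1[ -> is_derive y (1 : R) (fun y => G (y - x)) (ln 3 - ln (y - x)).
    rewrite in_itv/= => /andP[xy y1].
    have dG : is_derive (y - x) (1 : R) G (ln 3 - ln (y - x)) by apply: is_derive_G; lra.
    have ds : is_derive y (1 : R) (fun y => y - x) (1 - 0) by exact: is_deriveB.
    have := is_derive1_comp (f := G) (g := fun y => y - x) dG ds.
    by rewrite subr0 mulr1.
  have Fl : G (y - x) @[y --> x^'+] --> G (x - x) by apply: cvg_at_right_filter; exact: cG1.
  have Fr : G (y - x) @[y --> 1^'-] --> G (1 - x) by apply: cvg_at_left_filter; exact: cG1.
  by rewrite (ge0_FTC_oo x2 f0 cf dF Fl Fr) subrr G0 subr0.
have left : (\int[leb]_(y in `](-1)%R, x[) logkerz 3 x%:C y = (G (1 + x))%:E)%E.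
  move: x1; rewrite le_eqVlt => /predU1P[<-|x1].
    by rewrite set_itv_ge -?leNgt ?bnd_simp// integral_set0 subrr G0.
  transitivity (\int[leb]_(y in `](-1)%R, x[) (ln 3 - ln (x - y))%:E)%E.
    apply: eq_integral => y; rewrite inE/= in_itv/= => /andP[y1 xy].
    by rewrite kE /logker normr_eq0 subr_eq0 lt_eqF// ltr0_norm ?subr_lt0// opprB.
  have f0 y : y \in `]-1, x[ -> 0 <= ln 3 - ln (x - y).
    by rewrite in_itv/= => /andP[xy y1]; apply: ln3; lra.
  have cf y : y \in `]-1, x[ -> {for y, continuous (fun y => ln 3 - ln (x - y))}.
    by rewrite in_itv/= => /andP[xy y1]; apply: (cln (fun y => x - y)) => //; lra.
  have dF y : y \in `]-1, x[ -> is_derive y (1 : R) (fun y => - G (x - y)) (ln 3 - ln (x - y)).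
    rewrite in_itv/= => /andP[xy y1].
    have dG : is_derive (x - y) (1 : R) G (ln 3 - ln (x - y)) by apply: is_derive_G; lra.
    have ds : is_derive y (1 : R) (fun y => x - y) (0 - 1) by exact: is_deriveB.
    have dc := is_derive1_comp (f := G) (g := fun y => x - y) dG ds.
    rewrite (_ : _ - _ = - ((ln 3 - ln (x - y)) * (0 - 1))); last by ring.
    exact: is_deriveN.
  have Fl : - G (x - y) @[y --> (-1)^'+] --> - G (x - -1).
    by apply: cvgN; apply: cvg_at_right_filter; exact: cG2.
  have Fr : - G (x - y) @[y --> x^'-] --> - G (x - x).
    by apply: cvgN; apply: cvg_at_left_filter; exact: cG2.
  by rewrite (ge0_FTC_oo x1 f0 cf dF Fl Fr) subrr G0 oppr0 sub0r opprK opprK addrC.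
rewrite left right -EFinD -EFinM; congr EFin; rewrite /G /uniform_field opprK -[1 + 1]/2%:R.
by field.
Qed.

Lemma probability_setC0 (m : probability mR R) (A : set mR) : measurable A ->
  m A = 1%E -> m (~` A) = 0%E.
Proof. by move=> mA A1; have := probability_setC m mA; rewrite A1 subee. Qed.

Lemma log_potential_lambda x : -1 <= x <= 1 ->
  log_potential lambda x%:C = (- uniform_field x)%:E.
Proof.
move=> x1.
have l1 : lambda `[(-1 : R), 1]%classic = 1%E.
  by apply: integral_uniform_pdf1 ltrN11 _.
rewrite (@log_potentialE R _ _ 3)//.
- rewrite potential_lambda3// -EFinB; congr EFin; ring.
- exact: (@probability_setC0 (@lambda R)).
- by rewrite ler1n.
- move=> y y1; rewrite -rmorphB normc_real ler_norml; lra.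
Qed.

End UniformPotential.

Section Support.
Context {R : realType}.
Local Notation mR := (measurableTypeR R).
Implicit Types (m : {measure set mR -> \bar R}).

Definition null_rat_itv m (n : nat) : set R :=
  if unpickle n is Some pq then
    let I := `]ratr pq.1, ratr pq.2[%classic in if m I == 0%E then I else set0
  else set0.

Lemma supp_setCE m : ~` supp m = \bigcup_n null_rat_itv m n.
Proof.
apply/seteqP; split => x /=.
- move/existsNP => [U] /not_implyP[oU] /not_implyP[Ux] /negP.
  rewrite -leNgt measure_le0 => /eqP mU.
  have [e /= e0 eU] := open_nbhs_nbhs (conj oU Ux).
  have [p] := @rat_in_itvoo R (x - e) x ltac:(by rewrite ltrBlDr ltrDl).
  have [q] := @rat_in_itvoo R x (x + e) ltac:(by rewrite ltrDl).
  rewrite !in_itv/= => /andP[xq qe] /andP[ep px].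
  have IU : `]ratr p, ratr q[ `<=` U.
    move=> y; rewrite /= in_itv/= => /andP[py yq]; apply: eU => /=.
    by rewrite ltr_norml; lra.
  have mI : m `]ratr p, ratr q[%classic = 0%E.
    apply/eqP; rewrite -measure_le0 -mU; apply: le_measure; rewrite ?inE//.
    exact: open_measurable.
  have [n nE] : exists n, unpickle n = Some (p, q).
    by exists (pickle (p, q)); rewrite pickleK.
  exists n => //; rewrite /null_rat_itv nE /= mI eqxx.
  by rewrite /= in_itv/= px xq.
- move=> [n _]; rewrite /null_rat_itv; case: unpickle => // -[p q] /=.
  case: ifPn => // /eqP mI xI; apply/existsNP; exists `]ratr p, ratr q[%classic.
  apply/not_implyP; split; first exact: interval_open.
  by apply/not_implyP; split => //; rewrite mI ltxx.
Qed.

Lemma measurable_null_rat_itv m n : measurable (null_rat_itv m n : set mR).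
Proof. by rewrite /null_rat_itv; case: unpickle => // pq /=; case: ifP. Qed.

Lemma measurable_supp m : measurable (supp m : set mR).
Proof.
rewrite -[supp m]setCK supp_setCE; apply: measurableC.
by apply: bigcup_measurable => n _; exact: measurable_null_rat_itv.
Qed.

(** The complement of the support is covered by the countably many null
    intervals with rational end points. *)
Lemma supp_setC_null m : m (~` supp m) = 0%E.
Proof.
apply/eqP; rewrite -measure_le0.
have m0 n : m (null_rat_itv m n) = 0%E.
  rewrite /null_rat_itv; case: unpickle => [pq|]; last exact: measure0.
  by case: ifP => [/eqP|] //; rewrite measure0.
have s0 : (\sum_(0 <= n <oo) m (null_rat_itv m n) = 0)%E by apply: eseries0.
rewrite -s0; apply: measure_sigma_subadditive.
- exact: measurable_null_rat_itv.
- by rewrite supp_setCE; apply: bigcup_measurable => n _; exact: measurable_null_rat_itv.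
- by rewrite supp_setCE.
Qed.

End Support.

(** * The cap measure is the equilibrium measure *)

Section CapField.
Context {R : realType}.
Local Notation leb := (@lebesgue_measure R).
Local Notation mR := (measurableTypeR R).
Implicit Types (k x : R).

(** The primitive of [ln (sqrt (1 - k^2) / 2)] that vanishes at [0]. *)
Definition cap_constant k : R :=
  ((1 + k) * ln (1 + k) - (1 - k) * ln (1 - k)) / 2 - k - k * ln 2.

Let measurable_halfchord : measurable_fun [set: mR] (fun k : mR => Num.sqrt (1 - k ^+ 2) : mR).
Proof.
apply: continuous_measurable_fun => k.
apply: (cvg_comp (fun k => 1 - k ^+ 2) (@Num.sqrt R)); last exact: sqrt_continuous.
by apply: cvgB; [exact: cvg_cst|exact: exprn_continuous].
Qed.

Let logkerz_chord_ge0 x k t : -1 <= x <= 1 ->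
  (0 <= logkerz 3 x%:C (Num.sqrt (1 - k ^+ 2) * cos t)%R)%E.
Proof.
move=> x1; have := halfchord_cos_in k t => h.
by rewrite /logkerz -rmorphB normc_real logker_ge0// ler_norml; lra.
Qed.

Lemma arcpot_ge0 x k : -1 <= x <= 1 -> (0 <= arcpot 3 x%:C k)%E.
Proof.
move=> x1; rewrite /arcpot mule_ge0// ?lee_fin ?invr_ge0 ?pi_ge0//.
by apply: integral_ge0 => t _; exact: logkerz_chord_ge0.
Qed.

Lemma measurable_arcpot x : -1 <= x <= 1 -> measurable_fun [set: mR] (arcpot 3 x%:C).
Proof.
move=> x1.
pose h (p : mR * mR) := (logkerz 3 x%:C (Num.sqrt (1 - p.1 ^+ 2) * cos p.2)%R *
  (\1_(`]0, pi[%classic) p.2)%:E)%E.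
have -> : arcpot 3 x%:C = (fun k => (pi^-1)%:E * fubini_F leb h k)%E.
  apply/funext => k; rewrite /arcpot; congr (_ * _)%E.
  rewrite integral_mkcond; apply: eq_integral => t _.
  by rewrite patchE /h indicE; case: ifP => _; rewrite ?mule1 ?mule0.
apply: emeasurable_funM; first exact: measurable_cst.
apply: measurable_fun_fubini_tonelli_F.
  apply: emeasurable_funM.
    apply: (measurableT_comp (measurable_logker_normc 3 x%:C)).
    apply: measurable_funM.
      exact: (measurableT_comp measurable_halfchord measurable_fst).
    have mc : measurable_fun [set: mR] (@cos R : mR -> mR).
      by apply: continuous_measurable_fun; exact: continuous_cos.
    exact: (measurableT_comp mc measurable_snd).
  apply/measurable_EFinP.
  have mi : measurable_fun [set: mR] (\1_(`]0, pi[%classic) : mR -> R) by exact: measurable_indic.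
  exact: (measurableT_comp mi measurable_snd).
by move=> p; rewrite /h mule_ge0 ?lee_fin//; exact: logkerz_chord_ge0.
Qed.

Let continuous_line k : 0 <= k < 1 -> {for k, continuous (fun k => ln 3 - ln (Num.sqrt (1 - k ^+ 2) / 2))}.
Proof.
move=> k1; have a0 := halfchord_gt0 k1.
apply: cvgB; first exact: cvg_cst.
apply: (cvg_comp (fun k => Num.sqrt (1 - k ^+ 2) / 2) (@ln R)); last first.
  by apply: continuous_ln; rewrite divr_gt0.
apply: cvgM; last exact: cvg_cst.
apply: (cvg_comp (fun k => 1 - k ^+ 2) (@Num.sqrt R)); last exact: sqrt_continuous.
apply: cvgB; [exact: cvg_cst|exact: exprn_continuous].
Qed.

Let measurable_line :
  measurable_fun [set: mR] (fun k : mR => ln 3 - ln (Num.sqrt (1 - k ^+ 2) / 2) : mR).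
Proof.
apply: measurable_funB; first exact: measurable_cst.
apply: (measurableT_comp (@measurable_ln R)).
by apply: measurable_funM; [exact: measurable_halfchord|exact: measurable_cst].
Qed.

Let lnE k : 0 <= k < 1 -> ln 3 - ln (Num.sqrt (1 - k ^+ 2) / 2) =
  ln 3 + ln 2 - (ln (1 + k) + ln (1 - k)) / 2.
Proof.
move=> k1; have a0 := halfchord_gt0 k1.
by rewrite ln_div ?posrE// ln_halfchord//; ring.
Qed.

Let dprim k : 0 <= k < 1 ->
  is_derive k (1 : R) (fun k => k * ln 3 - cap_constant k) (ln 3 - ln (Num.sqrt (1 - k ^+ 2) / 2)).
Proof.
move=> k1; have [p q] : 0 < 1 + k /\ 0 < 1 - k by split; lra.
have d1 : is_derive k (1 : R) (fun k => 1 + k) (0 + 1) by exact: is_deriveD.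
have d2 : is_derive k (1 : R) (fun k => 1 - k) (0 - 1) by exact: is_deriveB.
have l1 := is_derive1_comp (f := @ln R) (g := fun k => 1 + k) (is_derive1_ln p) d1.
have l2 := is_derive1_comp (f := @ln R) (g := fun k => 1 - k) (is_derive1_ln q) d2.
have m1 := is_deriveM d1 l1; have m2 := is_deriveM d2 l2.
have k3 : is_derive k (1 : R) (fun k => k * ln 3) (k *: 0 + ln 3 *: 1) by exact: is_deriveM.
have k2 : is_derive k (1 : R) (fun k => k * ln 2) (k *: 0 + ln 2 *: 1) by exact: is_deriveM.
have cc : is_derive k (1 : R) (fun _ : R => (2^-1 : R)) 0 by exact: is_derive_cst.
have ik : is_derive k (1 : R) (fun k : R => k) 1 by exact: is_derive_id.
have D := is_deriveB k3 (is_deriveB (is_deriveB (is_deriveM (is_deriveB m1 m2) cc) ik) k2).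
have -> : ln 3 - ln (Num.sqrt (1 - k ^+ 2) / 2) = k *: 0 + ln 3 *: 1 -
 (((1 + k) * ln (1 + k) - (1 - k) * ln (1 - k)) *: 0 +
     2^-1 *: ((1 + k) *: ((1 + k)^-1 * (0 + 1)) + ln (1 + k) *: (0 + 1)
       - ((1 - k) *: ((1 - k)^-1 * (0 - 1)) + ln (1 - k) *: (0 - 1))) - 1 - (k *: 0 + ln 2 *: 1)).
  by rewrite lnE// /GRing.scale /=; field; rewrite !gt_eqF.
exact: D.
Qed.

Section Cap.
Variables (kappa : R) (kappa0 : 0 < kappa) (kappa1 : kappa < 1).
Local Notation cap := (cap_measure (ltW kappa0) kappa1).

Let integral_le : (\int[leb]_(k in `]0%R, kappa[) (ln 3 - ln (Num.sqrt (1 - k ^+ 2) / 2))%:E =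
  (kappa * ln 3 - cap_constant kappa)%:E)%E.
Proof.
have h k : k \in `[0, kappa] -> 0 <= k < 1 by rewrite in_itv/= => /andP[-> /le_lt_trans->].
have cl k : k \in `[0, kappa] -> {for k, continuous (fun k => ln 3 - ln (Num.sqrt (1 - k ^+ 2) / 2))}.
  by move=> /h; exact: continuous_line.
have dl k : k \in `[0, kappa] -> is_derive k (1 : R) (fun k => k * ln 3 - cap_constant k)
    (ln 3 - ln (Num.sqrt (1 - k ^+ 2) / 2)).
  by move=> /h; exact: dprim.
have := FTC_cc kappa0 cl dl.
rewrite (_ : cap_constant 0 = 0); last by rewrite /cap_constant !subr0 addr0 ln1 !(mul0r, mulr0, subrr).
rewrite mul0r !subr0 => <-; rewrite [RHS]integral_itv_bndoo//.
by apply/measurable_EFinP; apply: measurable_funTS; exact: measurable_line.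
Qed.

Let potential_split x : -1 <= x <= 1 ->
  (\int[leb]_(k in `]0%R, kappa[) arcpot 3 x%:C k + \int[leb]_(k in `]kappa, 1%R[) arcpot 3 x%:C k
   = (ln 3 - uniform_field x)%:E)%E.
Proof.
move=> x1; rewrite -(@ge0_integral_oo_split R _ 0 kappa 1); last 3 first.
- by rewrite !ltW.
- by apply: measurable_funTS; exact: measurable_arcpot.
- by move=> k _; exact: arcpot_ge0.
have x3 y : -1 <= y <= 1 -> normc (y%:C - x%:C) <= 3.
  by move=> y1; rewrite -rmorphB normc_real ler_norml; lra.
have mr : measurable_fun [set: mR] (logkerz 3 x%:C \_ `[-1, 1]).
  by apply/(measurable_restrictT (logkerz 3 x%:C))/measurable_funTS => //; exact: measurable_logker_normc.
have r0 y : (0 <= (logkerz 3 x%:C \_ `[(-1)%R, 1%R]) y)%E.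
  rewrite patchE; case: ifP => //; rewrite inE/= in_itv/= => y1.
  by rewrite /logkerz logker_ge0 ?normc_ge0// x3.
rewrite -(potential_lambda3 x1) [RHS]integral_mkcond integral_lambda// -integral_mkcond.
rewrite (@cap_potential R 0 _ _ 3 x%:C)//.
by rewrite subr0 invr1 mul1e.
Qed.

Let cap_int x : -1 <= x <= 1 -> exists2 r : R,
  (\int[leb]_(k in `]0%R, kappa[) arcpot 3 x%:C k = r%:E)%E &
  (\int[cap]_(y in `[(-1)%R, 1%R]) logkerz 3 x%:C y =
    ((1 - kappa)^-1 * (ln 3 - uniform_field x - r))%:E)%E.
Proof.
move=> x1; rewrite cap_potential//; last first.
  by move=> y y1; rewrite -rmorphB normc_real ler_norml; lra.
have := potential_split x1.
have : (0 <= \int[leb]_(k in `]0%R, kappa[) arcpot 3 x%:C k)%E.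
  by apply: integral_ge0 => k _; exact: arcpot_ge0.
have : (0 <= \int[leb]_(k in `]kappa, 1%R[) arcpot 3 x%:C k)%E.
  by apply: integral_ge0 => k _; exact: arcpot_ge0.
move: (integral _ _ _) (integral _ _ _) => [p||] [q||] //= _ _ [pq].
by exists p => //; rewrite -pq addrAC subrr add0r EFinM.
Qed.

(** The integral over ]kappa, 1[ is that over ]0, 1[, which is the uniform
    potential, minus that over ]0, kappa[, where [arcpot_le] applies. *)
Lemma cap_field_ge x : -1 <= x <= 1 ->
  ((ln 3 + (1 - kappa)^-1 * (cap_constant kappa - uniform_field x))%:E <=
   \int[cap]_(y in `[(-1)%R, 1%R]) logkerz 3 x%:C y)%E.
Proof.
move=> x1; have [r rE ->] := cap_int x1.
have : (r%:E <= (kappa * ln 3 - cap_constant kappa)%:E)%E.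
  rewrite -rE -integral_le; apply: ge0_le_integral => //.
  - by move=> k _; exact: arcpot_ge0.
  - by apply: measurable_funTS; exact: measurable_arcpot.
  - by apply: measurable_funTS; apply/measurable_EFinP; exact: measurable_line.
  - move=> k; rewrite /= in_itv/= => /andP[k0 k1]; apply: arcpot_le; first by rewrite (ltW k0) (lt_trans k1).
    by lra.
rewrite !lee_fin => rle; have k1 : 0 < 1 - kappa by rewrite subr_gt0.
rewrite -(ler_pM2l k1) mulrDr !mulrA divff ?gt_eqF// !mul1r; lra.
Qed.

(** For these [x] the inequality [arcpot_le] is an equality for all [k <= kappa],
    because the segments decrease with [k]. *)
Lemma cap_field_eq x : x ^+ 2 <= 1 - kappa ^+ 2 ->
  (\int[cap]_(y in `[(-1)%R, 1%R]) logkerz 3 x%:C y =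
   (ln 3 + (1 - kappa)^-1 * (cap_constant kappa - uniform_field x))%:E)%E.
Proof.
move=> x2; have k1 : 0 < 1 - kappa by rewrite subr_gt0.
have x1 : -1 <= x <= 1.
  rewrite -ler_norml -(@ler_pXn2r _ 2) ?nnegrE// real_normK ?num_real// expr1n.
  by rewrite (le_trans x2)// gerBl sqr_ge0.
have [r rE ->] := cap_int x1.
have : r%:E = (kappa * ln 3 - cap_constant kappa)%:E.
  rewrite -rE -integral_le; apply: eq_integral => k; rewrite inE/= in_itv/= => /andP[k0 kk].
  apply: arcpot_on; [by rewrite (ltW k0) (lt_trans kk)| |by lra].
  by rewrite (le_trans x2)// lerD2l lerN2 ler_pXn2r ?nnegrE ?ltW.
by move=> [->]; congr EFin; field; rewrite gt_eqF.
Qed.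

Let capT : (cap : set mR -> \bar R) setT = 1%E.
Proof.
rewrite -(setUv `[-1, 1]%classic) measureU//.
- by rewrite [X in (X + _)%E]cap_itv [X in (_ + X)%E]cap_itvC adde0.
- exact: measurableC.
- by rewrite setICr.
Qed.

Definition cap_probability : probability mR R :=
  HB.pack (cap : set mR -> \bar R) (Measure.class cap) (@Measure_isProbability.Build _ _ R cap capT).

End Cap.
End CapField.

Section EquilibriumIsCap.
Context {R : realType}.
Local Notation leb := (@lebesgue_measure R).
Local Notation mR := (measurableTypeR R).
Local Notation D := (`[(-1)%R, 1%R]%classic : set R).
Implicit Types (k x : R).

(** Both bounds come from [u - 1 <= u ln u <= u (u - 1)]. *)
Lemma uniform_field_bounds x : -1 <= x <= 1 -> -1 <= uniform_field x <= 0.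
Proof.
move=> x1; have b (u : R) : 0 <= u -> u - 1 <= u * ln u <= u * (u - 1).
  rewrite le_eqVlt => /predU1P[<-|u0]; first by rewrite !mul0r lexx; lra.
  have ui : 0 < u^-1 by rewrite invr_gt0.
  have le1 : ln u <= u - 1.
    by have := @le_ln1Dx R (u - 1); rewrite [1 + _]addrC subrK; apply; lra.
  have le2 : - ln u <= u^-1 - 1.
    by have := @le_ln1Dx R (u^-1 - 1); rewrite [1 + _]addrC subrK lnV ?posrE//; apply; lra.
  rewrite ler_pM2l// le1 andbT.
  have : u * - ln u <= u * (u^-1 - 1) by rewrite ler_pM2l.
  by rewrite mulrN mulrBr mulfV ?gt_eqF// mulr1; lra.
have := b (1 + x); have := b (1 - x); rewrite /uniform_field.
move=> /(_ ltac:(lra)) /andP[? ?] /(_ ltac:(lra)) /andP[? ?].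
have : x ^+ 2 <= 1 by rewrite -[leRHS](@expr1n R 2) -[x ^+ 2]real_normK ?num_real// ler_pXn2r ?nnegrE// ler_norml.
by move=> ?; apply/andP; split; nra.
Qed.

Let clamp x : R := Num.max (-1) (Num.min x 1).

Let clamp_itv x : -1 <= clamp x <= 1.
Proof. by rewrite /clamp le_max lexx/= ge_max (ltW ltrN11) ge_min lexx orbT. Qed.

Let clampE x : -1 <= x <= 1 -> clamp x = x.
Proof. by move=> /andP[x1 x2]; rewrite /clamp (min_l x2) max_r. Qed.

Let measurable_field : measurable_fun [set: mR] (fun x : mR => uniform_field (clamp x) : mR).
Proof.
apply: (@measurableT_comp _ _ _ mR mR mR uniform_field _ clamp).
  apply: continuous_measurable_fun => x.
  have cx (f : R -> R) : {for x, continuous f} -> {for x, continuous (fun x => f x * ln (f x))}.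
    by move=> cf; apply: (cvg_comp f (fun v => v * ln v)); [exact: cf|exact: continuous_xlnx].
  have i : {for x, continuous (fun y : R => y)} by exact: cvg_id.
  have c c : {for x, continuous (fun _ : R => c : R)} by exact: cvg_cst.
  rewrite /uniform_field; apply: cvgM; last exact: c.
  apply: cvgB; last exact: c.
  have ax : {for x, continuous (fun y : R => 1 + y)} by apply: cvgD; [exact: c|exact: i].
  have bx : {for x, continuous (fun y : R => 1 - y)} by apply: cvgB; [exact: c|exact: i].
  by apply: cvgD; [exact: (cx _ ax)|exact: (cx _ bx)].
apply: measurable_maxr; first exact: measurable_cst.
by apply: measurable_minr; [exact: measurable_id|exact: measurable_cst].
Qed.

Lemma log_potential_win (m : probability mR R) x : m D = 1%E -> -1 <= x <= 1 ->
  (log_potential m x%:C = win_potential m x - (ln 3)%:E)%E.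
Proof.
move=> m1 x1; rewrite win_potentialE// (@log_potentialE R m _ 3)//.
- by congr (_ - _)%E; apply: eq_integral => y _; rewrite /logkerz -rmorphB normc_real distrC.
- exact: probability_setC0.
- by rewrite ler1n.
- by move=> y y1; rewrite -rmorphB normc_real ler_norml; lra.
Qed.

Lemma cap_measureE (kappa : R) (kappa0 : 0 <= kappa) (kappa1 : kappa < 1) (A : set mR) :
  cap_measure kappa0 kappa1 A = (\int[leb]_(x in A) (cap_density kappa x)%:E)%E.
Proof. by []. Qed.

Section Cap.
Variables (kappa : R) (kappa0 : 0 < kappa) (kappa1 : kappa < 1).
Local Notation cap := (cap_probability kappa0 kappa1).
Local Notation T := ([set x : R | x ^+ 2 <= 1 - kappa ^+ 2]).

Lemma cap_support_itv : T = `[- Num.sqrt (1 - kappa ^+ 2), Num.sqrt (1 - kappa ^+ 2)]%classic.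
Proof.
have k2 : 0 <= 1 - kappa ^+ 2 by rewrite subr_ge0 expr_le1// ltW.
have E x : (x ^+ 2 <= 1 - kappa ^+ 2) = (`|x| <= Num.sqrt (1 - kappa ^+ 2)).
  rewrite -[in LHS](sqr_sqrtr k2) -[x ^+ 2]real_normK ?num_real//.
  by rewrite ler_pXn2r ?nnegrE ?sqrtr_ge0.
by apply/seteqP; split => x /=; rewrite in_itv/= -ler_norml E.
Qed.

Lemma cap_supportC : (cap : set mR -> \bar R) (~` T) = 0%E.
Proof.
rewrite [LHS](cap_measureE (ltW kappa0) kappa1); apply: integral0_eq => x /= /negP.
rewrite -ltNge => x2; rewrite /cap_density cap_angle0 ?mul0r//; exact: ltW.
Qed.

(** Both measures satisfy the hypotheses of [potential_unique] with the same
    external field; the two constants agree since the two potentials do. *)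
Lemma equilibrium_is_cap (tau omega : R) (mu : probability mR R) :
  tau = - (1 - kappa)^-1 -> is_equilibrium tau mu omega ->
  (forall A, measurable A -> mu A = cap_measure (ltW kappa0) kappa1 A) /\
  omega = (1 - kappa)^-1 * cap_constant kappa.
Proof.
move=> tauE [mu1 eq_supp ge_itv]; pose t := (1 - kappa)^-1.
have t0 : 0 < t by rewrite invr_gt0 subr_gt0.
pose h x := t * - uniform_field (clamp x).
have mh : measurable_fun [set: mR] (h : mR -> mR).
  by apply: measurable_funM; [exact: measurable_cst|exact: measurable_funN].
have hB x : 0 <= h x <= t.
  have := uniform_field_bounds (clamp_itv x) => /andP[u1 u0].
  apply/andP; split; first by rewrite mulr_ge0 ?oppr_ge0// ltW.
  by rewrite -[leRHS]mulr1 ler_pM2l// lerNl.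
have muD : mu (~` D) = 0%E by exact: probability_setC0.
have capD : (cap : set mR -> \bar R) (~` D) = 0%E by exact: cap_itvC.
have Wle x : -1 <= x <= 1 -> forall W : \bar R,
    ((omega%:E <= W - (ln 3)%:E + tau%:E * (- uniform_field x)%:E) -> ((omega + ln 3) + h x)%:E <= W)%E /\
    ((W - (ln 3)%:E + tau%:E * (- uniform_field x)%:E = omega%:E) -> W = ((omega + ln 3) + h x)%:E)%E.
  move=> x1 [w||]; split => //=; rewrite -?EFinM -?EFinD /h clampE// tauE -/t.
  - by rewrite !lee_fin; lra.
  - by move=> [e]; congr EFin; lra.
  - by move=> _; rewrite leey.
have mS : measurable (supp mu `&` D : set mR).
  by apply: measurableI => //; exact: measurable_supp.
have mT : measurable (T : set mR) by rewrite cap_support_itv.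
have muS : mu (~` (supp mu `&` D)) = 0%E.
  rewrite setCI; apply/eqP; rewrite -measure_le0 -[leRHS]adde0.
  rewrite -{2}muD -(supp_setC_null mu); apply: measureU2.
  + by apply: measurableC; exact: measurable_supp.
  + exact: measurableC.
have mu_ge : forall x : R, D x -> ((omega + ln 3 + h x)%:E <= win_potential mu x)%E.
  move=> x Dx; have := ge_itv x Dx; move: Dx; rewrite /= in_itv/= => x1.
  by rewrite log_potential_win// log_potential_lambda//; exact: (Wle x x1 _).1.
have mu_eq : forall x : R, (supp mu `&` D) x -> win_potential mu x = (omega + ln 3 + h x)%:E.
  move=> x [Sx Dx]; have := eq_supp x Sx; move: Dx; rewrite /= in_itv/= => x1.
  by rewrite log_potential_win// log_potential_lambda//; exact: (Wle x x1 _).2.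
pose c := t * cap_constant kappa + ln 3.
have cE x : -1 <= x <= 1 -> c + h x = ln 3 + t * (cap_constant kappa - uniform_field x).
  by move=> x1; rewrite /c /h clampE//; ring.
have WE x : -1 <= x <= 1 -> win_potential cap x =
    (\int[cap_measure (ltW kappa0) kappa1]_(y in `[(-1)%R, 1%R]) logkerz 3 x%:C y)%E.
  move=> x1; rewrite win_potentialE//; apply: eq_integral => y _.
  by rewrite /logkerz -rmorphB normc_real distrC.
have cap_ge : forall x : R, D x -> ((c + h x)%:E <= win_potential cap x)%E.
  move=> x; rewrite /= in_itv/= => x1; rewrite WE// cE//; exact: cap_field_ge.
have T1 : forall x : R, T x -> -1 <= x <= 1.
  move=> x /= x2; rewrite -ler_norml -(@ler_pXn2r _ 2) ?nnegrE// real_normK ?num_real// expr1n.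
  by rewrite (le_trans x2)// gerBl sqr_ge0.
have cap_eq : forall x : R, T x -> win_potential cap x = (c + h x)%:E.
  by move=> x Tx; rewrite WE ?T1// cE ?T1//; exact: cap_field_eq.
have eqm : forall A, measurable A -> mu A = cap A.
  exact: (potential_unique mh hB muD capD mS muS mT cap_supportC mu_ge mu_eq cap_ge cap_eq).
split; first exact: eqm.
(* Both sets have full measure, so they meet. *)
have [x [Sx Tx]] : exists x, (supp mu `&` D) x /\ T x.
  apply: contrapT => /forallNP none.
  have : (mu setT <= mu (~` (supp mu `&` D) `|` ~` T))%E.
    apply: le_measure; rewrite ?inE//; first by apply: measurableU; exact: measurableC.
    by move=> x _; rewrite -setCI; exact: none.
  apply/negP; rewrite -ltNge.
  apply: (@le_lt_trans _ _ 0%E); last by rewrite [ltRHS]probability_setT lte01.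
  have e : mu (~` T) = 0%E by rewrite (eqm _ (measurableC mT)); exact: cap_supportC.
  rewrite -[leRHS]adde0 -{1}muS -{1}e; apply: measureU2; exact: measurableC.
have x1 := T1 x Tx.
have : win_potential mu x = win_potential cap x.
  by apply: eq_measure_integral => A mA _; exact: eqm.
by rewrite mu_eq// cap_eq// => -[]; rewrite /c -/t; lra.
Qed.

End Cap.
End EquilibriumIsCap.

(** * Primitives along the family of square roots *)

Section Primitives.
Context {R : realType}.
Implicit Types (k : R) (z : R[i]).

(** The square root of [z^2 - 1 + k^2] of the branch of [sqrt_branch], written so
    as to be smooth in [k] also at [k = 1], where the segment [[-a_k, a_k]]
    degenerates. *)
Definition chord_root z k : R[i] := z * sqrtc (1 - (1 - k%:C ^+ 2) / z ^+ 2).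

Lemma halfchord_sqrC k : 0 <= k <= 1 ->
  (Num.sqrt (1 - k ^+ 2))%:C ^+ 2 = 1 - k%:C ^+ 2 :> R[i].
Proof.
move=> /andP[k0 k1]; rewrite -rmorphXn sqr_sqrtr /=.
  by rewrite rmorphB rmorph1 rmorphXn.
by rewrite subr_ge0 expr_le1.
Qed.

Lemma chord_rootE z k : 0 <= k <= 1 ->
  chord_root z k = sqrt_branch (Num.sqrt (1 - k ^+ 2)) z.
Proof. by move=> k1; rewrite /chord_root /sqrt_branch halfchord_sqrC. Qed.

Lemma chord_rootN1 k : 0 <= k -> chord_root (-1) k = - k%:C.
Proof.
move=> k0; rewrite /chord_root sqrrN expr1n divr1 opprB addrC subrK.
rewrite -rmorphXn sqrtc_sqrtr /= ?lecR ?sqr_ge0// sqrtr_sqr ger0_norm//.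
by rewrite mulN1r.
Qed.

(** At [z = -1] the quotient is replaced by its limit. *)
Definition chord_slope z k : R[i] :=
  if z == -1 then (k%:C)^-1 else (chord_root z k + k%:C) / (z + 1).

Variables (kappa : R) (kappa0 : 0 < kappa) (kappa1 : kappa < 1) (z : R[i]).
Hypothesis zb : ~ csegment (Num.sqrt (1 - kappa ^+ 2)) z.

Local Notation s := (chord_root z).
Local Notation w := (chord_slope z).

Let kpos k : kappa <= k <= 1 -> 0 < k.
Proof. by move=> /andP[+ _]; exact: lt_le_trans. Qed.

Lemma csegment_chord k : kappa <= k <= 1 -> ~ csegment (Num.sqrt (1 - k ^+ 2)) z.
Proof.
move=> k1 [x /= xk xz]; apply: zb; exists x => //=.
move: xk; rewrite !in_itv/= -!ler_norml => /le_trans; apply.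
have [kk _] := andP k1.
by rewrite ler_wsqrtr// lerD2l lerN2 ler_pXn2r// ?nnegrE ?(le_trans _ kk) ?ltW.
Qed.

Let z0 : z != 0.
Proof. exact: (notin_csegment_neq0 (sqrtr_ge0 _) zb). Qed.

Let slit_rad k : kappa <= k <= 1 -> slit (1 - (1 - k%:C ^+ 2) / z ^+ 2).
Proof.
move=> k1; have [<-|k2] := eqVneq 1 k.
  by rewrite expr1n subrr mul0r subr0 => -[_] /=; rewrite ler10.
have kk : 0 <= k < 1 by rewrite lt_neqAle eq_sym k2 (ltW (kpos k1)); have /andP[] := k1.
have := sqrt_branch_Re_gt0 (csegment_chord k1) (halfchord_gt0 kk).
rewrite halfchord_sqrC; last by case/andP: kk => -> /ltW.
move=> + [i0 r0].
rewrite Re_sqrtcE normcE i0 expr0n addr0 sqrtr_sqr ler0_norm// addNr mul0r.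
by rewrite sqrtr0 ltxx.
Qed.

Let q k := sqrtc (1 - (1 - k%:C ^+ 2) / z ^+ 2).

Let q_gt0 k : kappa <= k <= 1 -> 0 < complex.Re (q k).
Proof. by move=> k1; apply: Re_sqrtc_gt0; exact: slit_rad. Qed.

Let q0 k : kappa <= k <= 1 -> q k != 0.
Proof. by move=> /q_gt0; apply: contraTneq => ->; rewrite ltxx. Qed.

Lemma chord_root_neq0 k : kappa <= k <= 1 -> s k != 0.
Proof. by move=> k1; rewrite mulf_neq0//; exact: q0. Qed.

Lemma chord_root_sqr k : s k ^+ 2 = z ^+ 2 - 1 + k%:C ^+ 2.
Proof.
rewrite /chord_root exprMn sqr_sqrtc mulrBr mulr1 mulrCA divff ?expf_neq0// mulr1.
by rewrite opprB addrA addrAC.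
Qed.

Lemma cderive_chord_root k : kappa <= k <= 1 -> cderive s k (k%:C / s k).
Proof.
move=> k1; have sl := slit_rad k1.
have dk := cderive_real k.
have d2 : cderive (fun t : R => t%:C ^+ 2) k (k%:C * 1 + 1 * k%:C) by exact: (cderiveM dk dk).
have dF : cderive (fun t : R => 1 - (1 - t%:C ^+ 2) / z ^+ 2) k (2 * k%:C / z ^+ 2).
  have d3 := cderiveD (cderive_cst (1 - (z ^+ 2)^-1) k) (cderiveM d2 (cderive_cst (z ^+ 2)^-1 k)).
  apply: (cderive_eq (D := 0 + (k%:C ^+ 2 * 0 + (k%:C * 1 + 1 * k%:C) * (z ^+ 2)^-1))).
    rewrite (_ : (fun t => _) = (fun t : R => 1 - (z ^+ 2)^-1 + t%:C ^+ 2 * (z ^+ 2)^-1))//.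
    by apply/funext => t; ring.
  by ring.
have d4 := cderiveM (cderive_cst z k) (cderive_sqrtc sl dF).
apply: (cderive_eq d4); rewrite /chord_root -/(q k).
by field; rewrite (q0 k1) z0.
Qed.

Lemma chord_sum_neq0 k : kappa <= k <= 1 -> z + s k != 0.
Proof.
move=> k1; rewrite /chord_root -[X in X + _]mulr1 -mulrDr mulf_neq0//.
have := q_gt0 k1; rewrite -/(q k) => qp; apply/eqP => e.
have : complex.Re (1 + q k) = 0 by rewrite e.
by have := kpos k1; rewrite ReD /=; lra.
Qed.

Lemma chord_sum_mul_neq0 k : kappa <= k <= 1 -> s k + z * k%:C != 0.
Proof.
move=> k1; rewrite /chord_root -mulrDr mulf_neq0//.
have := q_gt0 k1; rewrite -/(q k) => qp; apply/eqP => e.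
have : complex.Re (q k + k%:C) = 0 by rewrite e.
by have := kpos k1; rewrite ReD /=; lra.
Qed.

(** If the slope were [- r] with [r >= 0], the equation of the square root would
    make the quotient of the root by [z] a negative real number. *)
Lemma slit_chord_slope k : kappa <= k <= 1 -> slit (w k).
Proof.
move=> k1; have kp := kpos k1.
rewrite /chord_slope; case: ifPn => [_|z1].
  by move=> [_]; rewrite -fmorphV /= leNgt invr_gt0 kp.
have z10 : z + 1 != 0 by rewrite addr_eq0.
move=> [wi wr].
have [r r0 wE] : exists2 r : R, 0 <= r & s k + k%:C = - r%:C * (z + 1).
  exists (- complex.Re ((s k + k%:C) / (z + 1))); first by rewrite oppr_ge0.
  have e : (s k + k%:C) / (z + 1) = (complex.Re ((s k + k%:C) / (z + 1)))%:C.
    by apply: eq_ReIm.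
  by rewrite rmorphN opprK [X in X * _](esym e) divfK.
have sE : s k = - r%:C * (z + 1) - k%:C by rewrite -wE addrK.
pose p := 2 * r * k + r ^+ 2 + 1; have p0 : 0 < p by rewrite ltr_wpDl// addr_ge0 ?sqr_ge0// mulr_ge0 ?mulr_ge0// ltW.
pose m := k * (r ^+ 2 + 1) + 2 * r.
have m0 : 0 < m by rewrite ltr_wpDr ?mulr_ge0// mulr_gt0// ltr_wpDl ?sqr_ge0.
(* Substitute [s] in [s^2 = z^2 - 1 + k^2] and cancel [z + 1]. *)
have e1 : (r ^+ 2 - 1)%:C * z = - p%:C.
  have h : (z + 1) * ((r ^+ 2 - 1)%:C * z + p%:C) = 0.
    have := chord_root_sqr k; rewrite sE /p !(rmorphD, rmorphN, rmorphM, rmorph1, rmorphXn) /= => h.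
    have h0 : (- r%:C * (z + 1) - k%:C) ^+ 2 - (z ^+ 2 - 1 + k%:C ^+ 2) = 0 by rewrite h subrr.
    by rewrite -[RHS]h0; ring.
  by move/eqP: h; rewrite mulf_eq0 (negPf z10)/= addr_eq0 => /eqP.
have e2 : (r ^+ 2 - 1)%:C * s k = m%:C.
  have -> : (r ^+ 2 - 1)%:C * s k = - r%:C * ((r ^+ 2 - 1)%:C * z + (r ^+ 2 - 1)%:C) - k%:C * (r ^+ 2 - 1)%:C.
    by rewrite sE; ring.
  rewrite e1 /p /m !(rmorphD, rmorphN, rmorphM, rmorph1, rmorphXn) /=.
  by ring.
have e3 : - p%:C * q k = m%:C by rewrite -e1 -e2 /chord_root -/(q k) mulrA.
have := q_gt0 k1; have : complex.Re (- p%:C * q k) = m by rewrite e3.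
rewrite ReM /= oppr0 mul0r subr0 => e4 qp.
have : - p * complex.Re (q k) <= 0 by rewrite mulNr oppr_le0 mulr_ge0// ltW.
by rewrite e4 leNgt m0.
Qed.

Lemma cderive_chord_slope k : kappa <= k <= 1 -> cderive w k (w k / s k).
Proof.
move=> k1; have kp := kpos k1.
have kC : k%:C != 0 by rewrite eq_complex /= eqxx andbT gt_eqF.
have sk := chord_root_neq0 k1.
rewrite {1}/chord_slope; case: (eqVneq z (-1)) => [z1|z1].
  apply: (cderive_eq (cderiveV kC (cderive_real k))).
  have -> : s k = - k%:C by rewrite z1 chord_rootN1// ltW.
  by rewrite /chord_slope z1 eqxx; field.
have z10 : z + 1 != 0 by rewrite addr_eq0.
have d := cderiveM (cderiveD (cderive_chord_root k1) (cderive_real k)) (cderive_cst (z + 1)^-1 k).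
apply: (cderive_eq d); rewrite /chord_slope (negPf z1).
by field; rewrite sk z10.
Qed.

(** If [s] is the root, then [s' = k / s], and so [(s + k)' = (s + k) / s]. *)
Lemma cderive_log_slope k : kappa <= k <= 1 -> cderive (fun k => clog (w k)) k (s k)^-1.
Proof.
move=> k1; have sw := slit_chord_slope k1.
apply: (cderive_eq (cderive_clog sw (cderive_chord_slope k1))).
by rewrite mulrAC divff ?slit_neq0// mul1r.
Qed.

Lemma chord_root1 : s 1 = z.
Proof. by rewrite /chord_root expr1n subrr mul0r subr0 sqrtc1 mulr1. Qed.

Lemma clog_slope1 : clog (w 1) = 0.
Proof.
have -> : w 1 = 1.
  rewrite /chord_slope chord_root1; case: eqVneq => [_|z1]; first by rewrite invr1.
  by rewrite divff// addr_eq0.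
by rewrite /clog carg_atan ?normc1 ?ln1/= ?mul0r ?atan0 ?mulr0// => -[_] /=; rewrite ler10.
Qed.

(** A primitive of [ln |(z + s_k) / 2|].  Integration by parts leaves the integral
    of [1 - Re (z / s) + Re (1 / (s (z + s)))], whose terms have the primitives
    [k], [- Re (z log w)], with [w] the slope, and
    [ln |s + z k| - ln (1 + k)]. *)
Definition log_primitive z k : R :=
  k * ln (normc ((z + chord_root z k) / 2)) - k + complex.Re (z * clog (chord_slope z k))
  - ln (normc (chord_root z k + z * k%:C)) + ln (1 + k).

Lemma is_derive_log_primitive k : kappa <= k <= 1 ->
  is_derive k (1 : R) (log_primitive z) (ln (normc ((z + s k) / 2))).
Proof.
move=> k1; have kp := kpos k1.
have sk := chord_root_neq0 k1; have zs := chord_sum_neq0 k1; have szk := chord_sum_mul_neq0 k1.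
have half0 : (2^-1 : R[i]) != 0 by rewrite invr_eq0 pnatr_eq0.
have j0 : (z + s k) / 2 != 0 by rewrite mulf_neq0.
have dj := cderiveM (cderiveD (cderive_cst z k) (cderive_chord_root k1)) (cderive_cst (2^-1 : R[i]) k).
have d1 := is_deriveM (is_derive_id k (1 : R)) (is_derive_ln_normc j0 dj).
have [d2 _] := cderiveM (cderive_cst z k) (cderive_log_slope k1).
have dn := cderiveD (cderive_chord_root k1) (cderiveM (cderive_cst z k) (cderive_real k)).
have d3 := is_derive_ln_normc szk dn.
have d0 : is_derive k (1 : R) (fun k => 1 + k) (0 + 1) by exact: is_deriveD.
have p : 0 < 1 + k by lra.
have d4 := is_derive1_comp (f := @ln R) (g := fun k => 1 + k) (is_derive1_ln p) d0.
have D := is_deriveD (is_deriveB (is_deriveD (is_deriveB d1 (is_derive_id k (1 : R))) d2) d3) d4.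
apply: (is_derive_eq D).
have kC : (1 + k%:C : R[i]) != 0.
  by rewrite (_ : 1 = 1%:C)// -rmorphD eq_complex /= eqxx andbT gt_eqF.
(* The equation of the root, to which [field] reduces the identity [key]. *)
pose eps : R[i] := z ^+ 2 - s k ^+ 2 - 1 + k%:C ^+ 2.
have eps0 : eps = 0 by rewrite /eps chord_root_sqr; ring.
have key : k%:C * (k%:C / s k / (z + s k)) - 1 + z / s k
    - (k%:C / s k + z) / (s k + z * k%:C) + (1 + k%:C)^-1 = 0.
  transitivity (eps / (s k * (z + s k)) - eps / ((z + s k) * (s k + z * k%:C) * (1 + k%:C))).
    by rewrite /eps; field; rewrite sk zs szk kC.
  by rewrite eps0 !mul0r subrr.
have kR X : complex.Re (k%:C * X) = k * complex.Re X by rewrite ReM /= mul0r subr0.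
have e1 : ((z + s k) * 0 + (0 + k%:C / s k) / 2) / ((z + s k) / 2) = k%:C / s k / (z + s k).
  by field; rewrite sk zs.
have e2 : (1 + k%:C)^-1 = ((1 + k)^-1)%:C :> R[i] by rewrite fmorphV rmorphD rmorph1.
move/(congr1 (@complex.Re R)): key; rewrite e2 !(ReD, ReN) kR /= => key.
rewrite e1 !mulr1 !mul0r !subr0 !addr0 !add0r /GRing.scale /= !mulr1.
by apply/eqP; rewrite -subr_eq0 -[X in _ == X]key; apply/eqP; ring.
Qed.

Lemma log_primitive1 : log_primitive z 1 = - 1.
Proof.
rewrite /log_primitive clog_slope1 chord_root1 mulr0 /= addr0 mul1r mulr1.
have -> : (z + z) / 2 = z by field.
have -> : z + z = 2%:C * z by rewrite -[2%:R]/(2%:R) rmorph_nat; ring.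
rewrite Normc.normcM normc_real ger0_norm// lnM ?posrE ?normc_gt0//.
by rewrite -[1 + 1]/(2%:R); ring.
Qed.

End Primitives.

(** * Potential and Cauchy transform off the support *)

Section OffSupport.
Context {R : realType}.
Local Notation leb := (@lebesgue_measure R).
Local Notation mR := (measurableTypeR R).
Implicit Types (k x : R) (c z : R[i]).

Section Cap.
Variables (kappa : R) (kappa0 : 0 < kappa) (kappa1 : kappa < 1) (z : R[i]).
Hypothesis zb : ~ csegment (Num.sqrt (1 - kappa ^+ 2)) z.
Local Notation cap := (cap_probability kappa0 kappa1).
Local Notation beta := (Num.sqrt (1 - kappa ^+ 2)).
Local Notation T := ([set x : R | x ^+ 2 <= 1 - kappa ^+ 2]).

Let beta_gt0 : 0 < beta.
Proof. by apply: halfchord_gt0; rewrite (ltW kappa0). Qed.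

Let integral_oo_cc (f : R -> R) : (forall k, k \in `[kappa, 1] -> {for k, continuous f}) ->
  (\int[leb]_(k in `]kappa, 1%R[) (f k)%:E = \int[leb]_(k in `[kappa, 1%R]) (f k)%:E)%E.
Proof.
move=> cf; rewrite [RHS]integral_itv_bndoo//; apply/measurable_EFinP.
have : measurable_fun (`[kappa, 1] : set mR) (f : mR -> mR).
  apply: subspace_continuous_measurable_fun => //.
  by apply: continuous_in_subspaceT => k; rewrite inE => /cf.
by apply: measurable_funS => //; exact: subset_itv_oo_cc.
Qed.

Let in_cc k : k \in `[kappa, 1] -> kappa <= k <= 1. Proof. by rewrite in_itv. Qed.

Let in_oo k : k \in `]kappa, 1[ -> (0 <= k < 1) /\ kappa <= k <= 1.
Proof.
by rewrite in_itv/= => /andP[k1 k2]; rewrite (ltW (lt_trans kappa0 k1)) (ltW k1) (ltW k2) k2.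
Qed.

(** The potential of the mixture is the mean of [- ln |(z + s_k) / 2|] over
    [kappa < k < 1], and [log_primitive] equals [-1] at [k = 1]. *)
Lemma cap_log_potential :
  log_potential cap z = ((1 - kappa)^-1 * (log_primitive z kappa + 1))%:E.
Proof.
pose M := normc z + 1 + 1.
have M1 : 1 <= M by rewrite lerDr addr_ge0 ?normc_ge0.
have zM x : -1 <= x <= 1 -> normc (x%:C - z) <= M.
  move=> x1; rewrite (le_trans (normc_triangle _ _))// normcN normc_real /M addrC -addrA lerD2l.
  by rewrite (@le_trans _ _ 1) ?lerDl// ler_norml.
rewrite (@log_potentialE R cap z M)//; last 2 first.
- exact: cap_itv.
- exact: cap_itvC.
rewrite [X in (X - _)%E](@cap_potential R _ (ltW kappa0) kappa1 M z)//; last by rewrite (lt_le_trans ltr01).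
pose f k := ln M - ln (normc ((z + chord_root z k) / 2)).
pose F k := k * ln M - log_primitive z k.
have dF k : k \in `[kappa, 1] -> is_derive k (1 : R) F (f k).
  move=> /in_cc k1.
  have d1 : is_derive k (1 : R) (fun k => k * ln M) (k *: 0 + ln M *: 1) by exact: is_deriveM.
  have := is_deriveB d1 (is_derive_log_primitive kappa0 zb k1).
  by rewrite scaler0 add0r /GRing.scale /= mulr1.
have cf k : k \in `[kappa, 1] -> {for k, continuous f}.
  move=> /in_cc k1; apply: cvgB; first exact: cvg_cst.
  have half0 : (2^-1 : R[i]) != 0 by rewrite invr_eq0 pnatr_eq0.
  have j0 : (z + chord_root z k) / 2 != 0.
    by rewrite mulf_neq0// (chord_sum_neq0 kappa0 zb).
  have dj := cderiveM (cderiveD (cderive_cst z k) (cderive_chord_root kappa0 zb k1)) (cderive_cst (2^-1 : R[i]) k).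
  exact: is_derive_cvg (is_derive_ln_normc j0 dj).
rewrite (_ : (\int[leb]_(k in `]kappa, 1%R[) arcpot M z k =
    \int[leb]_(k in `]kappa, 1%R[) (f k)%:E)%E); last first.
  apply: eq_integral => k; rewrite inE/= => /in_oo[k1 k2].
  rewrite arcpot_off//; last exact: (csegment_chord kappa0 zb k2).
  by rewrite /f /joukowski chord_rootE// (andP k1).1 ltW// (andP k1).2.
rewrite integral_oo_cc// (FTC_cc kappa1 cf dF) -EFinM -EFinB; congr EFin.
rewrite /F (log_primitive1 zb) mul1r.
by field; rewrite subr_eq0 gt_eqF.
Qed.

Let neq0_T x : T x -> z - x%:C != 0.
Proof.
move=> /= x2; have x1 : -1 <= x / beta <= 1.
  rewrite -ler_norml normrM normfV (gtr0_norm beta_gt0) ler_pdivrMr// mul1r.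
  rewrite -(@ler_pXn2r _ 2) ?nnegrE ?sqrtr_ge0// real_normK ?num_real// sqr_sqrtr//.
  by apply/ltW; rewrite -sqrtr_gt0.
by have := segment_affine_neq0 beta_gt0 zb x1; rewrite (mulrC beta) divfK // gt_eqF.
Qed.

Let fc c x : R := complex.Re (c / (z - x%:C)).

Let fc_affine c : fc c = fun x => complex.Re (c / (z + (-1) * x%:C)).
Proof. by apply/funext => x; rewrite /fc mulN1r. Qed.

Let continuous_fc c x : T x -> {for x, continuous (fc c)}.
Proof.
move=> /neq0_T xT; rewrite fc_affine; apply: continuous_Re_div_affine.
by rewrite mulN1r.
Qed.

Let measurable_fc c : measurable_fun [set: mR] (fc c : mR -> mR).
Proof.
rewrite (_ : fc c = fun x : mR => ((complex.Re c * (complex.Re z - x) + complex.Im c * complex.Im z)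
   * ((complex.Re z - x) ^+ 2 + (complex.Im z) ^+ 2)^-1 : R)); last first.
  apply/funext => x; rewrite /fc ReM ReV ImV !(ReD, ImD, ReN, ImN) /= oppr0 addr0; ring.
have ma : measurable_fun [set: mR] (fun x : mR => complex.Re z - x : mR).
  by apply: measurable_funB; [exact: measurable_cst|exact: measurable_id].
apply: measurable_funM.
  apply: measurable_funD; last exact: measurable_cst.
  by apply: measurable_funM => //; exact: measurable_cst.
apply: (measurableT_comp (@measurable_inv_R R)).
by apply: measurable_funD; [exact: measurable_funX|exact: measurable_cst].
Qed.

Let fc_lower c : exists2 B : R, 0 <= B & forall x, T x -> 0 <= fc c x + B.
Proof.
have bb : - beta <= beta by have := beta_gt0; lra.
have cf : {within `[- beta, beta], continuous (fc c)}.
  apply: continuous_in_subspaceT => x; rewrite inE => xb; apply: continuous_fc.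
  by rewrite (cap_support_itv kappa0 kappa1).
have [x0 _ hx0] := EVT_min bb cf.
exists (`|fc c x0|); first exact: normr_ge0.
move=> x; rewrite (cap_support_itv kappa0 kappa1) => /hx0 h.
by have := ler_norm (- fc c x0); rewrite normrN; lra.
Qed.

(** With [c = 1] and [c = - i] this gives the real and the imaginary part of the
    Cauchy transform.  The point [z] may lie in [[-1, 1]] outside of the support,
    where the integrand is unbounded, so the integrand is first cut off to the
    support and shifted to become nonnegative. *)
Lemma cap_cauchy c : (\int[cap]_x (complex.Re (c / (z - x%:C)))%:E =
  (- ((1 - kappa)^-1 * complex.Re (c * clog (chord_slope z kappa))))%:E)%E.
Proof.
have [B B0 hB] := fc_lower c.
have mT : measurable (T : set mR) by rewrite (cap_support_itv kappa0 kappa1).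
have capT : (cap : set mR -> \bar R) setT = 1%E by exact: probability_setT.
pose g x : \bar R := if x ^+ 2 <= 1 - kappa ^+ 2 then (fc c x + B)%:E else 0%E.
have mg : measurable_fun [set: mR] g.
  rewrite (_ : g = (fun x => (fc c x + B)%:E) \_ T); last first.
    apply/funext => x; rewrite patchE /g; case: ifPn => [x2|x2]; first by rewrite mem_set.
    by rewrite memNset//; exact/negP.
  apply/(measurable_restrictT (fun x => (fc c x + B)%:E)) => //.
  apply: measurable_funTS; apply/measurable_EFinP.
  by apply: measurable_funD; [exact: measurable_fc|exact: measurable_cst].
have g0 x : (0 <= g x)%E by rewrite /g; case: ifP => // /hB; rewrite lee_fin.
have -> : (\int[cap]_x (complex.Re (c / (z - x%:C)))%:E = \int[cap]_x (g x - B%:E))%E.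
  apply: ae_eq_integral => //.
  - by apply/measurable_EFinP; exact: measurable_fc.
  - by apply: emeasurable_funB => //; exact: measurable_cst.
  - exists (~` T); split; first exact: measurableC.
      exact: cap_supportC.
    move=> x /=; apply: contra_not => /= x2 _; rewrite /g x2 -EFinB addrK//.
rewrite integralB_cst//; last by rewrite [ltLHS]capT ltry.
rewrite [X in (_ * X)%E]capT mule1 [X in (X - _)%E](integral_cap (ltW kappa0) kappa1)//.
pose f k := complex.Re (c / chord_root z k) + B.
have inner k : k \in `]kappa, 1[%classic ->
   ((pi^-1)%:E * \int[leb]_(t in `]0%R, pi[) g (Num.sqrt (1 - k ^+ 2) * cos t)%R = (f k)%:E)%E.
  rewrite inE/= => /in_oo[k1 k2]; have b0 := halfchord_gt0 k1.
  have zk := csegment_chord kappa0 zb k2.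
  set b := Num.sqrt _ in b0 zk *.
  have cF1 : continuous_pm1 (fun x => complex.Re (c / (z - (b * x)%:C))).
    move=> x x1.
    have h : z + (- b%:C) * x%:C != 0 by rewrite mulNr -rmorphM; exact: segment_affine_neq0.
    have := continuous_Re_div_affine (c := c) h.
    by under [X in {for _, continuous X}]eq_fun do rewrite mulNr -rmorphM.
  have cB : continuous_pm1 (fun=> B) by move=> x _; exact: cvg_cst.
  have cF : continuous_pm1 (fun x => complex.Re (c / (z - (b * x)%:C)) + B).
    by move=> x x1; apply: cvgD; [exact: cF1|exact: cB].
  have bT t : (b * cos t) ^+ 2 <= 1 - kappa ^+ 2.
    have cos2 : cos t ^+ 2 <= 1.
      by rewrite -[leRHS](@expr1n R 2) -[_ ^+ 2]real_normK ?num_real// ler_pXn2r ?nnegrE// ler_norml cos_geN1 cos_le1.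
    rewrite exprMn /b sqr_sqrtr; last by rewrite ltW// -sqrtr_gt0.
    rewrite (@le_trans _ _ (1 - k ^+ 2))//.
      by rewrite -[leRHS]mulr1 ler_wpM2l// ltW// -sqrtr_gt0.
    by rewrite lerD2l lerN2 ler_pXn2r ?nnegrE ?(ltW kappa0)// ?(andP k1).1 ?(andP k2).1.
  rewrite integral_0pi_open; last exact: (measurableT_comp mg (measurable_acos_cos b)).
  transitivity ((pi^-1)%:E * \int[leb]_(t in `[0%R, pi]) (complex.Re (c / (z - (b * cos t)%:C)) + B)%:E)%E.
    by congr (_ * _)%E; apply: eq_integral => t _; rewrite /g bT.
  rewrite (@cos_integralE R (fun x => complex.Re (c / (z - (b * x)%:C)) + B))// -EFinM; congr EFin.
  rewrite (cos_integralD cF1 cB) arcsine_cauchy// cos_integral_cst -mulrDr mulKf ?gt_eqF ?pi_gt0//.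
  by rewrite /f chord_rootE// (andP k1).1 ltW// (andP k1).2.
rewrite [X in (_ * X - _)%E](_ : _ = (\int[leb]_(k in `]kappa, 1%R[) (f k)%:E)%E); last first.
  exact: eq_integral.
pose F k := complex.Re (c * clog (chord_slope z k)) + k * B.
have dF k : k \in `[kappa, 1] -> is_derive k (1 : R) F (f k).
  move=> /in_cc k1.
  have d1 : is_derive k (1 : R) (fun k => k * B) (k *: 0 + B *: 1) by exact: is_deriveM.
  have [d2 _] := cderiveM (cderive_cst c k) (cderive_log_slope kappa0 zb k1).
  have := is_deriveD d2 d1.
  by rewrite scaler0 add0r /GRing.scale /= mulr1 mul0r addr0.
have cf k : k \in `[kappa, 1] -> {for k, continuous f}.
  move=> /in_cc k1; apply: cvgD; last exact: cvg_cst.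
  have s0 := chord_root_neq0 kappa0 zb k1.
  have [d _] := cderiveM (cderive_cst c k) (cderiveV s0 (cderive_chord_root kappa0 zb k1)).
  exact: is_derive_cvg d.
rewrite integral_oo_cc// (FTC_cc kappa1 cf dF) -EFinM -EFinB; congr EFin.
rewrite /F clog_slope1 mulr0 /=.
by field; rewrite subr_eq0 gt_eqF.
Qed.

End Cap.
End OffSupport.

(** * Density and support *)

Section CapDensity.
Context {R : realType}.
Local Notation leb := (@lebesgue_measure R).
Local Notation mR := (measurableTypeR R).
Implicit Types (x c : R).

(** The complement of the angle [acos c] has tangent [c / sqrt (1 - c^2)]. *)
Lemma acos_atan c : -1 < c < 1 -> acos c = pi / 2 - atan (c / Num.sqrt (1 - c ^+ 2)).
Proof.
move=> /andP[c1 c2]; have cc : -1 <= c <= 1 by rewrite !ltW.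
have h0 : 0 < acos c by apply: acos_gt0; rewrite (ltW c1).
have hp : acos c < pi by apply: acos_ltpi; rewrite c1 ltW.
have h : atan (tan (acos c - pi / 2)) = acos c - pi / 2.
  by apply: tanK; rewrite in_itv/=; apply/andP; split; lra.
have ht : tan (acos c - pi / 2) = - (c / Num.sqrt (1 - c ^+ 2)).
  by rewrite /tan sinBpihalf cosBpihalf acosK ?in_itv//= sin_acos// mulNr.
by rewrite -[LHS](subrK (pi / 2)) -h ht atanN addrC.
Qed.

Section Cap.
Variables (kappa : R) (kappa0 : 0 < kappa) (kappa1 : kappa < 1).
Local Notation cap := (cap_measure (ltW kappa0) kappa1).
Local Notation beta := (Num.sqrt (1 - kappa ^+ 2)).

Let k2 : 0 <= 1 - kappa ^+ 2.
Proof. by rewrite subr_ge0 expr_le1// ltW. Qed.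

(** At the two end points, where the denominator is [0], the value differs from
    that of [cap_density]; the set is null. *)
Definition arctan_density x : R := (1 - kappa)^-1 / pi *
  (pi / 2 - atan (Num.sqrt (kappa ^+ 2 / (1 - kappa ^+ 2 - x ^+ 2)))).

Lemma cap_density_arctan x : x ^+ 2 < 1 - kappa ^+ 2 ->
  cap_density kappa x = arctan_density x /\ 0 < cap_density kappa x.
Proof.
move=> x2; have kap2 : 0 < kappa ^+ 2 by rewrite exprn_gt0.
have a0 : 0 < 1 - x ^+ 2 by lra.
have d0 : 0 < 1 - kappa ^+ 2 - x ^+ 2 by lra.
pose a := Num.sqrt (1 - x ^+ 2); have ap : 0 < a by rewrite sqrtr_gt0.
have asq : a ^+ 2 = 1 - x ^+ 2 by rewrite sqr_sqrtr// ltW.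
have c0 : 0 < kappa / a by rewrite divr_gt0.
have ka : kappa < a by rewrite -(@ltr_pXn2r _ 2) ?nnegrE ?(ltW kappa0) ?(ltW ap)// asq; lra.
have c1 : kappa / a < 1 by rewrite ltr_pdivrMr// mul1r.
have cc : -1 < kappa / a < 1 by rewrite c1 (lt_trans _ c0).
have sE : kappa / a / Num.sqrt (1 - (kappa / a) ^+ 2) =
    Num.sqrt (kappa ^+ 2 / (1 - kappa ^+ 2 - x ^+ 2)).
  have q0 : 0 < 1 - (kappa / a) ^+ 2 by rewrite subr_gt0 expr_lt1// ltW.
  have e : (kappa / a / Num.sqrt (1 - (kappa / a) ^+ 2)) ^+ 2 = kappa ^+ 2 / (1 - kappa ^+ 2 - x ^+ 2).
    rewrite expr_div_n sqr_sqrtr ?(ltW q0)// expr_div_n asq.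
    by field; rewrite !gt_eqF//; lra.
  by rewrite -e sqrtr_sqr gtr0_norm// divr_gt0// sqrtr_gt0.
have pp := pi_gt0 R.
rewrite /cap_density cap_angle_acos ?(ltW kappa0)// -/a /arctan_density; split.
  rewrite /= (acos_atan cc) sE invfM mulrC; congr (_ * _); exact: mulrC.
rewrite divr_gt0//; last by rewrite mulr_gt0// subr_gt0.
by apply: acos_gt0; rewrite c1 ltW// (lt_trans _ c0).
Qed.

Lemma measurable_arctan_density : measurable_fun [set: mR] (arctan_density : mR -> mR).
Proof.
apply: measurable_funM; first exact: measurable_cst.
apply: measurable_funB; first exact: measurable_cst.
have ma : measurable_fun [set: mR] (@atan R : mR -> mR).
  by apply: continuous_measurable_fun => y; exact: continuous_atan.
have ms : measurable_fun [set: mR] (@Num.sqrt R : mR -> mR).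
  by apply: continuous_measurable_fun => y; exact: sqrt_continuous.
apply: (measurableT_comp ma); apply: (measurableT_comp ms).
apply: measurable_funM; first exact: measurable_cst.
apply: (measurableT_comp (@measurable_inv_R R)).
by apply: measurable_funB; [exact: measurable_cst|exact: measurable_funX].
Qed.

Lemma cap_density_out x : 1 - kappa ^+ 2 <= x ^+ 2 -> cap_density kappa x = 0.
Proof. by move=> x2; rewrite /cap_density cap_angle0 ?mul0r// ltW. Qed.

Lemma cap_measure_arctan (A : set R) : measurable (A : set mR) ->
  cap A = (\int[leb]_(x in A `&` `[(- beta)%R, beta]%classic) (arctan_density x)%:E)%E.
Proof.
move=> mA; rewrite cap_measureE.
have mT : measurable (`[- beta, beta]%classic : set mR) by [].
have md : measurable_fun [set: mR] (fun x : mR => (cap_density kappa x)%:E).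
  by apply/measurable_EFinP; exact: measurable_cap_density (ltW kappa0).
have ma : measurable_fun [set: mR] (fun x : mR => (arctan_density x)%:E).
  by apply/measurable_EFinP; exact: measurable_arctan_density.
transitivity (\int[leb]_(x in A `&` `[(- beta)%R, beta]%classic) (cap_density kappa x)%:E)%E.
  rewrite [LHS]integral_mkcond [RHS]integral_mkcond; apply: eq_integral => x _.
  rewrite !patchE in_setI; case: (x \in A) => //=; case: ifPn => // xb.
  rewrite cap_density_out//; move: xb; rewrite -(cap_support_itv kappa0 kappa1).
  by rewrite notin_setE /= => /negP; rewrite -ltNge => /ltW.
apply: ae_eq_integral => //.
- exact: measurableI.
- exact: measurable_funTS.
- exact: measurable_funTS.
exists [set - beta; beta]; split.
- exact: measurableU.
- apply: countable_lebesgue_measure0; apply: finite_set_countable.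
  by rewrite finite_setU; split; exact: finite_set1.
move=> x /=; apply: contra_notP => /not_orP[/eqP xn /eqP xp] [_].
rewrite in_itv/= => /andP[x1 x2]; congr EFin.
have xb : `|x| < beta by rewrite ltr_norml !lt_neqAle x1 x2 xp eq_sym xn.
apply: (cap_density_arctan _).1.
rewrite -(sqr_sqrtr k2) -[x ^+ 2]real_normK ?num_real// ltr_pXn2r ?nnegrE ?sqrtr_ge0//.
Qed.

Lemma cap_dominated : cap `<< leb.
Proof.
apply/null_content_dominatesP => A mA A0; rewrite cap_measureE.
apply: null_set_integral => //; apply: measurable_funTS; apply/measurable_EFinP.
exact: measurable_cap_density (ltW kappa0).
Qed.

(** The density is positive inside the interval, so every open set that meets
    the interval has positive measure. *)
Lemma supp_cap : supp cap = `[- beta, beta]%classic.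
Proof.
rewrite -(cap_support_itv kappa0 kappa1); apply/seteqP; split => x /=.
  move=> sx; rewrite leNgt; apply/negP => x2.
  pose U := ~` `[- beta, beta]%classic : set R.
  have oU : open U by rewrite openC; exact: itv_closed.
  have Ux : U x.
    rewrite /U -(cap_support_itv kappa0 kappa1) => /=; apply/negP; by rewrite -ltNge.
  have := sx U oU Ux; rewrite /U -(cap_support_itv kappa0 kappa1).
  by rewrite [X in (0 < X)%E](cap_supportC kappa0 kappa1) ltxx.
move=> x2 U oU Ux; rewrite lt_neqAle measure_ge0 andbT eq_sym; apply/eqP => U0.
have bp : 0 < beta by apply: halfchord_gt0; rewrite (ltW kappa0).
have xb : x \in `[- beta, beta] by have : [set x | x ^+ 2 <= 1 - kappa ^+ 2] x := x2; rewrite (cap_support_itv kappa0 kappa1).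
have [a [b [ab abU]]] : exists a b : R, a < b /\ `]a, b[ `<=` U `&` `]- beta, beta[.
  have [e /= e0 eU] := open_nbhs_nbhs (conj oU Ux).
  exists (Num.max (x - e) (- beta)), (Num.min (x + e) beta); split.
    move: xb; rewrite in_itv/= => /andP[xb1 xb2].
    by rewrite gt_max !lt_min; apply/andP; split; apply/andP; split; lra.
  move=> y; rewrite /= !in_itv/= lt_min gt_max => /andP[/andP[y1 y2] /andP[y3 y4]].
  split; last by rewrite y2 y4.
  by apply: eU => /=; rewrite ltr_norml; lra.
have mU : measurable (U : set mR) by exact: open_measurable.
have mf : measurable_fun U (fun y : mR => (cap_density kappa y)%:E).
  by apply: measurable_funTS; apply/measurable_EFinP; exact: measurable_cap_density (ltW kappa0).
have : (\int[leb]_(y in U) `|(cap_density kappa y)%:E| = 0)%E.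
  rewrite -[RHS]U0 cap_measureE; apply: eq_integral => y _ /=.
  by rewrite ger0_norm// cap_density_ge0.
move=> /(ae_eq_integral_abs leb mU mf) [N [mN N0 sN]].
have : (leb `]a, b[%classic <= leb N)%E.
  apply: le_measure; rewrite ?inE// => y yab; apply: sN => /= h.
  have [Uy] := abU y yab; rewrite /= in_itv/= -ltr_norml => yb.
  have y2 : y ^+ 2 < 1 - kappa ^+ 2.
    by rewrite -(sqr_sqrtr k2) -[y ^+ 2]real_normK ?num_real// ltr_pXn2r ?nnegrE ?sqrtr_ge0.
  have [_] := cap_density_arctan y2.
  by have [->] := h Uy; rewrite ltxx.
by rewrite N0 lebesgue_measure_itv/= lte_fin ab -EFinB lee_fin subr_le0 leNgt ab.
Qed.

End Cap.
End CapDensity.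

(** * The removable singularity and the constants *)

Section SlopeLimit.
Context {R : realType}.
Variables (kappa : R) (kappa0 : 0 < kappa) (kappa1 : kappa < 1).
Local Notation beta := (Num.sqrt (1 - kappa ^+ 2)).

Let k01 : 0 <= kappa <= 1. Proof. by rewrite !ltW. Qed.

Lemma halfchord_lt1 : beta < 1.
Proof. by rewrite -[ltRHS]sqrtr1 ltr_sqrt// gtrBl exprn_gt0. Qed.

Lemma notin_csegmentN1 : ~ csegment beta (-1).
Proof.
move=> [x /=]; rewrite in_itv/= => /andP[x1 _] /(congr1 (@complex.Re R)) /= xE.
by move: x1; rewrite xE lerN2 leNgt halfchord_lt1.
Qed.

(** Multiplying by the conjugate, the quotient is [(w - 1) / (s - kappa)] near
    [-1], and there [s = - kappa]. *)
Lemma slope_cvg :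
  ((sqrt_branch beta w + kappa%:C) / (w + 1) : R[i]^o) @[w --> (-1 : R[i]^o)^'] --> (kappa%:C^-1 : R[i]^o).
Proof.
have b0 : 0 < beta by apply: halfchord_gt0; rewrite (ltW kappa0).
have FF : Filter ((-1 : R[i]^o)^') by exact: dnbhs_filter.
have kC : kappa%:C != 0 :> R[i] by rewrite eq_complex /= eqxx andbT gt_eqF.
have sN1 : sqrt_branch beta (-1) = - kappa%:C by rewrite -chord_rootE// chord_rootN1// ltW.
have idc : (w : R[i]^o) @[w --> (-1 : R[i]^o)^'] --> (-1 : R[i]^o).
  by apply: (@cvg_trans _ (nbhs (-1 : R[i]^o))); [exact: nbhs_dnbhs|exact: cvg_id].
have sc : (sqrt_branch beta w : R[i]^o) @[w --> (-1 : R[i]^o)^'] --> (- kappa%:C : R[i]^o).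
  rewrite -sN1; apply: (@cvg_comp _ _ _ id (sqrt_branch beta) _ _ _ idc).
  exact: (sqrt_branch_continuous notin_csegmentN1 b0).
have dc : (sqrt_branch beta w - kappa%:C : R[i]^o) @[w --> (-1 : R[i]^o)^'] --> (- kappa%:C - kappa%:C : R[i]^o).
  have cc : cst (kappa%:C : R[i]^o) @ (-1 : R[i]^o)^' --> (kappa%:C : R[i]^o).
    exact: (@cvg_cst R[i]^o).
  exact: (@cvgB _ R[i]^o _ _ FF (sqrt_branch beta : R[i]^o -> R[i]^o) (cst kappa%:C) _ _ sc cc).
have nc : (w - 1 : R[i]^o) @[w --> (-1 : R[i]^o)^'] --> (-1 - 1 : R[i]^o).
  have cc : cst (1 : R[i]^o) @ (-1 : R[i]^o)^' --> (1 : R[i]^o) by exact: (@cvg_cst R[i]^o).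
  exact: (@cvgB _ R[i]^o _ _ FF (id : R[i]^o -> R[i]^o) (cst 1) _ _ idc cc).
have d0 : - kappa%:C - kappa%:C != 0 :> R[i] by rewrite -opprD oppr_eq0 -mulr2n mulrn_eq0.
have -> : kappa%:C^-1 = (-1 - 1) / (- kappa%:C - kappa%:C) :> R[i].
  by field; rewrite kC d0.
have : (w - 1) / (sqrt_branch beta w - kappa%:C) @[w --> (-1 : R[i]^o)^']
    --> ((-1 - 1) / (- kappa%:C - kappa%:C) : R[i]^o).
  have vc := @cvgV R[i] _ _ FF (fun w => sqrt_branch beta w - kappa%:C) _ d0 dc.
  exact: (@cvgM R[i] _ _ FF (fun w => w - 1) (fun w => (sqrt_branch beta w - kappa%:C)^-1) _ _ nc vc).
apply: cvg_trans; apply: near_eq_cvg; near=> w.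
have w1 : w + 1 != 0.
  have : w != -1 by near: w; exact: (@withinT _ _ _ (nbhs_filter (-1 : R[i]^o))).
  by rewrite addr_eq0.
have w0 : w != 0.
  by near: w; apply: (@cvgr_neq0 _ R[i]^o _ _ FF id _ idc); rewrite oppr_eq0 oner_neq0.
have s0 : sqrt_branch beta w - kappa%:C != 0.
  by near: w; exact: (@cvgr_neq0 _ R[i]^o _ _ FF (fun w => sqrt_branch beta w - kappa%:C) _ dc d0).
have e : (sqrt_branch beta w + kappa%:C) * (sqrt_branch beta w - kappa%:C) = (w - 1) * (w + 1).
  have := sqrt_branchK beta w0; rewrite halfchord_sqrC// => sE.
  rewrite (_ : (w - 1) * (w + 1) = w ^+ 2 - (1 - kappa%:C ^+ 2) - kappa%:C ^+ 2); last by ring.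
  by rewrite -sE; ring.
by apply/eqP; rewrite eq_sym eqr_div// e.
Unshelve. all: by end_near. Qed.

End SlopeLimit.

Section Constants.
Context {R : realType}.

Lemma equilibrium_constantE (tau kappa : R) : 0 < kappa -> kappa < 1 ->
  tau = - (1 - kappa)^-1 ->
  (1 - kappa)^-1 * cap_constant kappa = (1 + tau) * ln 2 - ln (Num.sqrt (1 - kappa ^+ 2))
    + 1 + tau - tau * ln (1 + kappa).
Proof.
move=> k0 k1 ->; have q : 0 < 1 - kappa by lra.
by rewrite ln_halfchord ?(ltW k0)// /cap_constant; field; rewrite gt_eqF.
Qed.

Lemma halfchordK (kappa : R) : 0 < kappa -> kappa < 1 ->
  Num.sqrt (1 - Num.sqrt (1 - kappa ^+ 2) ^+ 2) = kappa.
Proof.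
move=> k0 k1; rewrite sqr_sqrtr; last by rewrite subr_ge0 expr_le1// ltW.
by rewrite opprB addrC subrK sqrtr_sqr gtr0_norm.
Qed.

Lemma joukowski_Phi (b : R) (z : R[i]) : 0 < b ->
  (b / 2)%:C * Phi (z / b%:C) = joukowski b z.
Proof.
move=> b0; have bC : b%:C != 0 :> R[i] by rewrite eq_complex /= eqxx andbT gt_eqF.
rewrite /Phi /joukowski /sqrt_branch half_real.
have -> : 1%:C ^+ 2 / (z / b%:C) ^+ 2 = b%:C ^+ 2 / z ^+ 2.
  by rewrite rmorph1 expr1n mul1r expr_div_n invf_div.
by field; rewrite bC.
Qed.

End Constants.

Theorem theorem3p1 (R : realType) (tau : R) (mu : probability (measurableTypeR R) R) (omega : R)
  (tau_ltN1 : tau < -1) (mu_eq : is_equilibrium tau mu omega) :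
  let beta : R := Num.sqrt (1 - ((1 + tau) / tau) ^+ 2) in
  let kappa : R := Num.sqrt (1 - beta ^+ 2) in
  let density (x : R) : R :=
    - (tau / pi) *
    (pi / 2 - atan (Num.sqrt ((1 - beta ^+ 2) / (beta ^+ 2 - x ^+ 2)))) in
  let q (z : R[i]^o) : R[i]^o := (sqrt_branch beta z + kappa%:C) / (z + 1) in
  let P (z : R[i]) : R[i] := (beta / 2)%:C * Phi (z / beta%:C) in
  let Q (z : R[i]) : R[i] :=
    (sqrt_branch beta z + z * kappa%:C) / (1 + kappa%:C) in
  let C := cauchy_transform mu in
  let V := log_potential mu in
  let g (z : R[i]) : R[i] :=
    z * C z + (1 + tau)%:C * clog (P z) - tau%:C * clog (Q z) - 1 in
  [/\ [/\ 0 < beta < 1,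
          mu `<< lebesgue_measure,
          supp mu = `[- beta, beta]%classic &
          forall A : set R, measurable A ->
            mu A =
            (\int[lebesgue_measure]_(x in A `&` `[(- beta)%R, beta]%classic)
               (density x)%:E)%E],
      cvg (q w @[w --> (-1 : R[i]^o)^']) /\
      (forall z : R[i], ~ csegment beta z ->
         C z = tau%:C *
           clog (if z == -1 then lim (q w @[w --> (-1 : R[i]^o)^']) else q z)),
      forall z : R[i], ~ csegment beta z ->
        V z = (- complex.Re (g z))%:E,
      forall z : R[i], ~ csegment beta z ->
        V z = (- complex.Re (z * C z) - (1 + tau) * ln (normc (P z))
               + tau * ln (normc (Q z)) + 1)%:E &
      (forall x : R, x \in `[- beta, beta] ->
         V x%:C = (tau / 2 * ((1 + x) * ln (1 + x) + (1 - x) * ln (1 - x) - 2)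
                   + omega)%:E) /\
      omega = (1 + tau) * ln 2 - ln beta + 1 + tau - tau * ln (1 + kappa)].
Proof.
have tau0 : tau < 0 by rewrite (lt_trans tau_ltN1)// ltrN10.
set k := (1 + tau) / tau => beta.
have k0 : 0 < k by rewrite /k ltr_ndivlMr// mul0r; lra.
have k1 : k < 1 by rewrite /k ltr_ndivrMr// mul1r; lra.
have tauE : tau = - (1 - k)^-1 by rewrite /k; field; rewrite lt_eqF//; lra.
have tE : (1 - k)^-1 = - tau by rewrite [in RHS]tauE opprK.
have beta0 : 0 < beta by apply: halfchord_gt0; rewrite (ltW k0).
have beta1 : beta < 1 by exact: halfchord_lt1.
move=> kappa density q P Q C V g.
have kappaE : kappa = k by exact: halfchordK.
have [mu_cap omegaE] := equilibrium_is_cap k0 k1 tauE mu_eq.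
have suppE : supp mu = `[- beta, beta]%classic.
  have E U : open U -> (mu : {measure set (measurableTypeR R) -> \bar R}) U =
      cap_measure (ltW k0) k1 U by move=> /open_measurable; exact: mu_cap.
  by rewrite -(supp_cap k0 k1); apply/seteqP; split => x sx U oU Ux;
    have := sx U oU Ux; rewrite E.
have int_cap (f : R -> \bar R) : (\int[mu]_x f x = \int[cap_probability k0 k1]_x f x)%E.
  by apply: eq_measure_integral => A mA _; exact: mu_cap.
have q_cvg : q w @[w --> (-1 : R[i]^o)^'] --> (k%:C^-1 : R[i]^o).
  by rewrite /q kappaE; exact: slope_cvg.
have q_lim : lim (q w @[w --> (-1 : R[i]^o)^']) = k%:C^-1.
  exact: (cvg_lim (@norm_hausdorff _ R[i]^o) q_cvg).
have rootE z : chord_root z k = sqrt_branch beta z by rewrite chord_rootE// !ltW.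
have slopeE z : (if z == -1 then lim (q w @[w --> (-1 : R[i]^o)^']) else q z) = chord_slope z k.
  by rewrite /chord_slope q_lim /q kappaE rootE.
have ReZ (r : R) (w : R[i]) : complex.Re (r%:C * w) = r * complex.Re w.
  by rewrite ReM /= mul0r subr0.
have CE z : ~ csegment beta z -> C z = tau%:C * clog (chord_slope z k).
  move=> zb; move: (clog (chord_slope z k)) (cap_cauchy k0 k1 zb) => L H0.
  have H c : (\int[mu]_x complex.Re (c / (z - x%:C)))%R = tau * complex.Re (c * L).
    by rewrite /Rintegral int_cap H0 /= tE mulNr opprK.
  have ImE (w : R[i]) : complex.Im w = complex.Re ((0 -i* 1) * w).
    by case: w => a b /=; rewrite mul0r mulN1r opprK add0r.
  have re : (\int[mu]_x complex.Re (z - x%:C)^-1)%R = complex.Re (tau%:C * L).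
    by rewrite ReZ -[L in RHS]mul1r -H; under [RHS]eq_Rintegral do rewrite mul1r.
  have im : (\int[mu]_x complex.Im (z - x%:C)^-1)%R = complex.Im (tau%:C * L).
    rewrite ImM /= mul0r addr0 [in RHS]ImE -H.
    by under [LHS]eq_Rintegral do rewrite ImE.
  by rewrite /C /cauchy_transform re im; case: (tau%:C * L).
have VE z : ~ csegment beta z ->
    V z = (- complex.Re (z * C z) - (1 + tau) * ln (normc (P z))
               + tau * ln (normc (Q z)) + 1)%:E.
  move=> zb; have kk : k <= k <= 1 by rewrite lexx ltW.
  have -> : V z = log_potential (cap_probability k0 k1) z by exact: int_cap.
  rewrite (cap_log_potential k0 k1 zb); congr EFin.
  have k1C : 0 < 1 + k by lra.
  have QE : ln (normc (Q z)) = ln (normc (chord_root z k + z * k%:C)) - ln (1 + k).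
    rewrite /Q kappaE -rootE Normc.normcM Normc.normcV.
    have -> : 1 + k%:C = (1 + k)%:C :> R[i] by rewrite rmorphD rmorph1.
    rewrite ger0_normc ?(ltW k1C)// ln_div ?posrE//.
    by rewrite normc_gt0 (chord_sum_mul_neq0 k0 zb).
  rewrite QE CE// /P joukowski_Phi// /joukowski -rootE /log_primitive tE.
  have -> : complex.Re (z * (tau%:C * clog (chord_slope z k))) = tau * complex.Re (z * clog (chord_slope z k)).
    by rewrite mulrCA ReZ.
  have tk : tau * k = 1 + tau by rewrite /k mulrCA divff ?mulr1 ?lt_eqF.
  by rewrite -tk; ring: tk.
split.
- split; [by rewrite beta0| |exact: suppE|].
  + apply/null_content_dominatesP => A mA A0; rewrite mu_cap//.
    by have /null_content_dominatesP := cap_dominated k0 k1; exact.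
  + move=> A mA; rewrite mu_cap// (cap_measure_arctan k0 k1 mA); apply: eq_integral => x _.
    rewrite /density /arctan_density tE -[1 - beta ^+ 2](sqr_sqrtr _); last first.
      by rewrite subr_ge0 expr_le1// ltW.
    rewrite -/kappa kappaE /beta sqr_sqrtr; last by rewrite subr_ge0 expr_le1// ltW.
    by rewrite mulNr.
- split; first by apply/cvg_ex; exists (k%:C^-1).
  by move=> z zb; rewrite slopeE CE.
- move=> z zb; rewrite VE//; congr EFin.
  rewrite /g !(ReD, ReN) !ReZ; move: (complex.Re (z * C z)) => r /=; ring.
- exact: VE.
- split.
    move=> x xb; have x2 : supp mu x by rewrite suppE.
    have x1 : -1 <= x <= 1 by move: xb; rewrite in_itv/= => /andP[? ?]; apply/andP; split; lra.
    have [_ /(_ x x2) + _] := mu_eq.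
    rewrite log_potential_lambda// -/V; case: (V x%:C) => [v||] //= [vE]; congr EFin.
    by move: vE; rewrite /uniform_field; lra.
  by rewrite omegaE kappaE; exact: equilibrium_constantE.
Qed.
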